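(* (1) For every oracle Turing machine $V$ (in particular every universal one), the probability that $V(X)=\rho* 0^{\omega}$ for some finite binary string $\rho$ equals $\alpha-\beta$ for some $\mathbf{0}'$-left-c.e.\ reals $\alpha,\beta$. (2) Conversely, for all $\mathbf{0}'$-left-c.e.\ reals $\alpha,\beta$ with $\alpha-\beta\in(0,1)$, there exists a universal oracle Turing machine $V$ such that the probability that $V(X)=\rho* 0^{\omega}$ for some string $\rho$ is exactly $\alpha-\beta$.
   Context: Machine model: an oracle Turing machine $V$ works on the binary alphabet. It reads an infinite binary oracle $X$ and writes bits contiguously on a one-way write-only output tape. $V(X)$ is the finite or infinite binary sequence eventually written when $V$ runs forever. The probability of a property is the Lebesgue measure of the set of oracles $X$ having it. $*$ denotes concatenation. Universality: fix an effective list $(M_e)$ of all oracle machines. $V$ is universal if there is a computable map $e\mapsto\sigma_e$ into a prefix-free set of strings such that $V(\sigma_e* X)[s]=M_e(X)[s]$ for all $e,X,s$, where $[s]$ is the state after $s$ steps. A real is $\mathbf{0}'$-left-c.e.\ if it is the limit of an increasing sequence of rationals computable relative to $\emptyset'$.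
   Formalization: Universality asks V(σ_e*X)[t(s)]=M_e(X)[s] for all s, for some strictly increasing t depending on e and X; with t(s)=s no universal machine exists, since V's first step on σ_e*X cannot depend on X while some M_e writes the first bit of X at step 1. *)

(* Defs.v *)
From HB Require Import structures.
From mathcomp Require Import all_boot all_order all_algebra.
From mathcomp Require Import all_classical all_reals all_analysis.
Set Implicit Arguments.
Unset Strict Implicit.
Unset Printing Implicit Defensive.
Import Order.TTheory GRing.Theory Num.Theory.
Import numFieldNormedType.Exports.
Local Open Scope classical_set_scope.
Local Open Scope ring_scope.

Definition oracle := nat -> bool.

Definition cat_oracle (s : seq bool) (X : oracle) : oracle :=
  fun n => if (n < size s)%N then nth false s n else X (n - size s)%N.

(** * Oracle Turing machines *)

(* [None] is the blank; every work tape is blank at the start. *)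
Definition symbol := option bool.

Inductive move := Left | Stay | Right.

(* A two-way infinite work tape: cells to the left of the head (nearest
   first), scanned cell, cells to the right; cells not listed are blank. *)
Record tape := Tape {
  left_cells : seq symbol;
  scanned : symbol;
  right_cells : seq symbol }.

Definition blank_tape := Tape [::] None [::].

Definition move_tape (m : move) (t : tape) : tape :=
  match m with
  | Stay => t
  | Left => Tape (behead (left_cells t)) (head None (left_cells t))
                 (scanned t :: right_cells t)
  | Right => Tape (scanned t :: left_cells t) (head None (right_cells t))
                  (behead (right_cells t))
  end.

Definition write_tape (a : symbol) (t : tape) : tape :=
  Tape (left_cells t) a (right_cells t).

(* The oracle tape has a leftmost cell, where a left move has no effect. *)
Definition move_oracle_head (m : move) (p : nat) : nat :=
  match m with Left => p.-1 | Stay => p | Right => p.+1 end.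

(* One line of the transition table of a machine with [k] work tapes: the
   state, the scanned oracle bit and the scanned work symbols for which it
   applies; then the new state, the move of the oracle head, the symbol written
   and the move made on each work tape, and the bit appended to the output, if
   any. *)
Record rule (k : nat) := Rule {
  rule_state : nat;
  rule_obit : bool;
  rule_scan : k.-tuple symbol;
  rule_next : nat;
  rule_omove : move;
  rule_work : k.-tuple (symbol * move);
  rule_out : option bool }.

(* The transition table is a finite list of lines, the first applicable one
   being used, so that every table denotes a (partial) transition function. *)
Record machine := Machine { ntapes : nat; rules : seq (rule ntapes) }.

Record config (k : nat) := Config {
  state : nat;
  oracle_head : nat;
  tapes : k.-tuple tape;
  output : seq bool }.

Definition initial k : config k :=
  Config 0 0 [tuple blank_tape | _ < k] [::].

Section Run.
Variables (M : machine) (X : oracle).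
Let k := ntapes M.

Definition applicable (c : config k) (r : rule k) : bool :=
  [&& rule_state r == state c, rule_obit r == X (oracle_head c) &
      rule_scan r == [tuple scanned (tnth (tapes c) i) | i < k]].

Definition fire (c : config k) (r : rule k) : config k :=
  Config (rule_next r) (move_oracle_head (rule_omove r) (oracle_head c))
    [tuple (let a := tnth (rule_work r) i in
            move_tape a.2 (write_tape a.1 (tnth (tapes c) i))) | i < k]
    (if rule_out r is Some b then rcons (output c) b else output c).

Definition halted (c : config k) : bool := ~~ has (applicable c) (rules M).

Definition step (c : config k) : config k :=
  if [seq r <- rules M | applicable c r] is r :: _ then fire c r else c.

Definition run (s : nat) : config k := iter s step (initial k).

End Run.

(* [output_at M X s] is M(X)[s]. *)
Definition output_at (M : machine) (X : oracle) (s : nat) : seq bool :=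
  output (run M X s).

(* M(X) is the infinite sequence Y. *)
Definition writes (M : machine) (X Y : oracle) : Prop :=
  (forall s, output_at M X s = mkseq Y (size (output_at M X s))) /\
  (forall n, exists s, (n <= size (output_at M X s))%N).

Definition writes_eventually_zero (M : machine) (X : oracle) : Prop :=
  exists rho : seq bool, writes M X (cat_oracle rho (fun=> false)).

(** * Relative computability *)

Definition nat_code (n : nat) : seq bool := rcons (nseq n true) false.

Definition halts (M : machine) (X : oracle) : Prop :=
  exists s, halted X (run M X s).

(* An input [n] is given to a machine working relative to [A] as the oracle
   1^n 0 A, and the result is what is on the output tape at the halt. *)
Definition with_input (n : nat) (A : oracle) : oracle :=
  cat_oracle (nat_code n) A.

Definition computable_in (A : oracle) (f : nat -> seq bool) : Prop :=
  exists M : machine, forall n, exists s,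
    halted (with_input n A) (run M (with_input n A) s) /\
    output_at M (with_input n A) s = f n.

Definition computable_nat_in (A : oracle) (f : nat -> nat) : Prop :=
  computable_in A (fun n => nseq (f n) true).

Definition computable_rat_in (A : oracle) (q : nat -> rat) : Prop :=
  exists f g h : nat -> nat,
    [/\ computable_nat_in A f, computable_nat_in A g, computable_nat_in A h &
        forall n, q n = (-1) ^+ f n * (g n)%:R / (h n).+1%:R].

Definition no_oracle : oracle := fun=> false.

(** * Effective lists of machines *)

Definition seq_code T (code : T -> seq bool) (s : seq T) : seq bool :=
  nat_code (size s) ++ flatten (map code s).

Definition optbool_code (a : option bool) : seq bool :=
  match a with
  | None => nat_code 0
  | Some false => nat_code 1
  | Some true => nat_code 2
  end.

Definition move_code (m : move) : seq bool :=
  match m with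
  | Left => nat_code 0
  | Stay => nat_code 1
  | Right => nat_code 2
  end.

Definition rule_code k (r : rule k) : seq bool :=
  nat_code (rule_state r) ++ [:: rule_obit r] ++
  seq_code optbool_code (rule_scan r) ++
  nat_code (rule_next r) ++ move_code (rule_omove r) ++
  seq_code (fun a => optbool_code a.1 ++ move_code a.2) (rule_work r) ++
  optbool_code (rule_out r).

Definition machine_code (M : machine) : seq bool :=
  nat_code (ntapes M) ++ seq_code (@rule_code (ntapes M)) (rules M).

Definition effective_list (L : nat -> machine) : Prop :=
  (forall M, exists e, L e = M) /\
  computable_in no_oracle (fun e => machine_code (L e)).

(** * Universal machines *)

Definition prefix_free_family (sigma : nat -> seq bool) : Prop :=
  forall e e', prefix (sigma e) (sigma e') -> sigma e = sigma e'.

(* The steps of [V] on [sigma e * X] that are counted are the simulated ones: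
   [t s] is the actual step at which [V] has completed step [s] of [L e] on
   [X].  With [t s = s] there would be no universal machine: in one step at most
   one oracle cell is scanned, whereas the prefix-free strings [sigma e] are
   unboundedly long and infinitely many [L e], pairwise different as functions
   of the oracle, write the first oracle bit at their first step. *)
Definition universal (L : nat -> machine) (V : machine) : Prop :=
  exists sigma : nat -> seq bool,
    [/\ computable_in no_oracle sigma, prefix_free_family sigma &
        forall (e : nat) (X : oracle), exists t : nat -> nat,
          (forall s, (t s < t s.+1)%N) /\
          forall s, output_at V (cat_oracle (sigma e) X) (t s) =
                    output_at (L e) X s].

(** * Left-c.e. reals relative to the halting problem *)

Definition cantor_pair (e n : nat) : nat := ('C((e + n).+1, 2) + n)%N.

(* The halting problem, as the set of the pairs <e, n> such that the machine of
   index [e] halts on the input [n]. *)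
Definition halting_problem (L : nat -> machine) : oracle := fun p =>
  `[< exists e n : nat, p = cantor_pair e n /\
                        halts (L e) (with_input n no_oracle) >].

Definition left_ce_jump (R : realType) (L : nat -> machine) (x : R) : Prop :=
  exists q : nat -> rat,
    [/\ computable_rat_in (halting_problem L) q,
        {homo q : m n / (m <= n)%N >-> m <= n} &
        (fun n => ratr (q n) : R) @ \oo --> x].

(** * Probability over the oracles *)

(* The oracle X is identified with the real sum_n X_n 2^-(n+1) of [0, 1[. *)
Definition binary_digits (R : realType) (x : R) : oracle :=
  fun n => odd (Num.truncn (x * 2 ^+ n.+1)).

Definition oracle_prob (R : realType) (P : set oracle) : \bar R :=
  lebesgue_measure [set x : R | 0 <= x < 1 /\ P (binary_digits x)].

(* Main.v *)
Require Import Defs.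
From mathcomp Require Import all_boot all_order all_algebra.
From mathcomp Require Import all_classical all_reals all_analysis.
From mathcomp Require Import measurable_realfun zify ring lra.
Set Implicit Arguments.
Unset Strict Implicit.
Unset Printing Implicit Defensive.
Local Open Scope nat_scope.

(** An output is infinite and eventually zero exactly when it is infinite and
    has finitely many ones.  "Finitely many ones" and "finite" are Sigma_2
    events, the second contained in the first, so the probability in (1) is a
    difference of probabilities of Sigma_2 events.  A Sigma_2 event is an
    increasing union of Pi_1 events, and whether k / 2^m is at most the
    probability of the m-th of them is a question to the halting problem; hence
    its probability is the limit of the roundings of these probabilities down
    to multiples of 2^-m, which are nondecreasing.

    For (2), the oracles with prefix 1^c are given to three machines built on a
    universal machine U: on 1^c00 we run U itself; on 1^c01 we write a zero
    whenever U writes a one; on 1^c10 we write a one whenever U writes a bit,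
    and a zero at every step.  The three events "eventually zero" are then "U's
    output is infinite with finitely many ones", "it has infinitely many ones"
    and "it is finite", so that their total contribution is 2^-(c+2) whatever U
    does.  The other oracles are the reals x < 1 - 2^-c.  There we write
    infinitely many ones iff x >= alpha', and infinitely many zeros iff
    x >= beta', where alpha' - beta' = alpha - beta - 2^-(c+2): as x < alpha'
    iff x < q_n - t for some n, and this is decided in the limit from
    approximations to the halting problem, it is a Sigma_2 event.  Rational
    translations put [beta', alpha'[ inside [0, 1 - 2^-c[.

    All machines come from one construction: a computable function g on strings
    yields a machine that at stage s writes g(X restricted to s + 1), and halts
    if g tells it to.  Computable functions are run by while programs on
    counters, which are compiled to Turing machines. *)

(** * Counter programs *)

(** Universality forces a copy of U on some block of oracles, and its share of the probability is
    not known. The three blocks turn this share into a rational constant, so that the only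
    arithmetic done on [alpha] and [beta] is a rational translation; these reals may lie anywhere,
    since only their difference is bounded. The two bits after 1^c choose one of four sub-blocks of
    measure 2^-(c+2); nothing is written on the fourth. The machine built for (2) has no access to
    the halting problem and sees [alpha] only through approximations that converge without a known
    rate. The behaviour of the output in the limit absorbs this: a condition that holds from some
    point on, for some parameter, becomes the finiteness of a set of events, and each event writes
    one bit. A stage sees a prefix of the oracle whose length is also the clock, so that only a
    computable function on strings has to be designed. Counters suit Turing machines because a
    counter can be a head position: each register has its own tape, which carries a single
    marker. *)

Inductive instr :=
  | IInc of nat | IDec of nat | IRead of nat | IOut of bool
  | IJz of nat & nat | IJmp of nat.

Inductive prog :=
  | Inc of nat | Dec of nat | Read of nat | Out of bool
  | Seq of prog & prog | While of nat & prog.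

Fixpoint psize p :=
  match p with
  | Seq p q => psize p + psize q
  | While _ p => (psize p).+2
  | _ => 1
  end.

Fixpoint compile (pc : nat) (p : prog) : seq instr :=
  match p with
  | Inc r => [:: IInc r]
  | Dec r => [:: IDec r]
  | Read r => [:: IRead r]
  | Out b => [:: IOut b]
  | Seq p q => compile pc p ++ compile (pc + psize p) q
  | While r p =>
      IJz r (pc + psize p).+2 :: rcons (compile pc.+1 p) (IJmp pc)
  end.

Lemma size_compile pc p : size (compile pc p) = psize p.
Proof.
elim: p pc => //= [p IHp q IHq|r p IHp] pc; first by rewrite size_cat IHp IHq.
by rewrite size_rcons IHp.
Qed.

Fixpoint pregs p :=
  match p with
  | Inc r | Dec r | Read r => r
  | Out _ => 0
  | Seq p q => maxn (pregs p) (pregs q)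
  | While r p => maxn r (pregs p)
  end.

Definition upd (f : nat -> nat) i v := fun j => if j == i then v else f j.

Record pstate := PState { regs : nat -> nat; rpos : nat; written : seq bool }.

Section Exec.
Variable X : oracle.

Definition pinc r st :=
  PState (upd (regs st) r (regs st r).+1) (rpos st) (written st).
Definition pdec r st :=
  PState (upd (regs st) r (regs st r).-1) (rpos st) (written st).
Definition pread r st :=
  PState (upd (regs st) r (X (rpos st) + regs st r)) (rpos st).+1 (written st).
Definition pout b st :=
  PState (regs st) (rpos st) (rcons (written st) b).

(** Only terminating runs have a derivation; infinite loops are handled by [program_machine_loops].
    A decrement demands a positive counter because on the tape it is a left move, which from the
    marker would leave the counter representation. *)
Inductive exec : prog -> pstate -> pstate -> Prop :=
  | EInc r st : exec (Inc r) st (pinc r st)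
  | EDec r st : 0 < regs st r -> exec (Dec r) st (pdec r st)
  | ERead r st : exec (Read r) st (pread r st)
  | EOut b st : exec (Out b) st (pout b st)
  | ESeq p q st1 st2 st3 :
      exec p st1 st2 -> exec q st2 st3 -> exec (Seq p q) st1 st3
  | EWhile0 r p st : regs st r = 0 -> exec (While r p) st st
  | EWhileS r p st1 st2 st3 : 0 < regs st1 r ->
      exec p st1 st2 -> exec (While r p) st2 st3 -> exec (While r p) st1 st3.

End Exec.

(** * Counters on Turing machine tapes *)

(* The counter [n] is the distance of the head to the right of a marker; [j]
   counts the listed blanks to the right of the head, which are irrelevant. *)
Definition ctape (n j : nat) : tape :=
  if n is n'.+1 then Tape (rcons (nseq n' None) (Some true)) None (nseq j None)
  else Tape [::] (Some true) (nseq j None).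

Lemma scanned_ctape n j : (scanned (ctape n j) == Some true) = (n == 0).
Proof. by case: n. Qed.

Lemma ctape_right n j :
  move_tape Right (write_tape (scanned (ctape n j)) (ctape n j)) =
  ctape n.+1 j.-1.
Proof. by case: n => [|n]; case: j. Qed.

Lemma ctape_left n j :
  move_tape Left (write_tape (scanned (ctape n.+1 j)) (ctape n.+1 j)) =
  ctape n j.+1.
Proof. by case: n. Qed.

Section Compiled.
Variables (code : seq instr) (k : nat).

Definition keep (sc : k.-tuple symbol) : k.-tuple (symbol * move) :=
  [tuple (tnth sc i, Stay) | i < k].

Definition bump_tape (r : nat) (m : move) (sc : k.-tuple symbol) :
    k.-tuple (symbol * move) :=
  [tuple (tnth sc i, if val i == r then m else Stay) | i < k].

Definition counter_is_zero (r : nat) (sc : k.-tuple symbol) :=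
  nth None sc r == Some true.

(* State 0 puts the markers on the tapes; state [pc.+1] is about to execute
   the instruction at [pc]. *)
Definition instr_rule (q : 'I_(size code).+1 * bool * k.-tuple symbol) : rule k :=
  let: (s, b, sc) := q in
  if val s is pc.+1 then
    match nth (IJmp 0) code pc with
    | IInc r => Rule s b sc s.+1 Stay (bump_tape r Right sc) None
    | IDec r => Rule s b sc s.+1 Stay (bump_tape r Left sc) None
    | IRead r =>
        Rule s b sc s.+1 Right (if b then bump_tape r Right sc else keep sc) None
    | IOut o => Rule s b sc s.+1 Stay (keep sc) (Some o)
    | IJz r l =>
        Rule s b sc (if counter_is_zero r sc then l.+1 else s.+1) Stay
          (keep sc) None
    | IJmp l => Rule s b sc l.+1 Stay (keep sc) None
    end
  else Rule s b sc 1 Stay [tuple (Some true, Stay) | i < k] None.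

(** With one line for every state, oracle bit and tuple of symbols, exactly one line applies as long
    as the state is in range, so the machine halts exactly when control leaves the code. *)
Definition code_machine : machine :=
  Machine [seq instr_rule q | q <- enum {: 'I_(size code).+1 * bool * k.-tuple symbol}].

Variable X : oracle.
Implicit Type c : config k.

Definition scan c : k.-tuple symbol := [tuple scanned (tnth (tapes c) i) | i < k].

Lemma instr_ruleE s b sc : [/\ rule_state (instr_rule (s, b, sc)) = s,
  rule_obit (instr_rule (s, b, sc)) = b & rule_scan (instr_rule (s, b, sc)) = sc].
Proof.
rewrite /instr_rule; case: s => [[|pc] /= sP] //.
by case: nth => // *; case: b.
Qed.

Lemma filter_code_machine c (lt_c : state c < (size code).+1) :
  [seq r <- rules code_machine | @applicable code_machine X c r] =
  [:: instr_rule (Ordinal lt_c, X (oracle_head c), scan c)].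
Proof.
rewrite /= filter_map.
rewrite (@eq_filter _ _ (pred1 (Ordinal lt_c, X (oracle_head c), scan c))).
  by rewrite filter_pred1_uniq ?enum_uniq ?mem_enum.
move=> -[[s b] sc] /=; rewrite /applicable.
have [-> -> ->] := instr_ruleE s b sc.
by rewrite -[RHS]/(((s == Ordinal lt_c) && (b == _)) && (sc == _)) -andbA.
Qed.

Lemma step_code_machine c (lt_c : state c < (size code).+1) :
  @Defs.step code_machine X c =
  @fire code_machine c (instr_rule (Ordinal lt_c, X (oracle_head c), scan c)).
Proof. by rewrite /Defs.step filter_code_machine. Qed.

Lemma halted_code_machine c : @halted code_machine X c = (size code < state c).
Proof.
rewrite /halted ltnNge -ltnS; case: (ltnP (state c) _) => [lt_c|ge_c].
  by rewrite has_count -size_filter filter_code_machine.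
apply/negP; rewrite /= has_map => /hasP[[[s b] sc] _].
rewrite /= /applicable; have [-> _ _] := instr_ruleE s b sc.
by rewrite ltn_eqF // (leq_trans (ltn_ord s)).
Qed.

Definition represents (pc : nat) (st : pstate) c : Prop :=
  [/\ state c = pc.+1, oracle_head c = rpos st, output c = written st &
      forall i : 'I_k, exists j, tnth (tapes c) i = ctape (regs st i) j].

Lemma tnth_fire c r i : tnth (tapes (@fire code_machine c r)) i =
  move_tape (tnth (rule_work r) i).2
    (write_tape (tnth (rule_work r) i).1 (tnth (tapes c) i)).
Proof. by rewrite /fire /= tnth_mktuple. Qed.

Lemma tnth_keep c i : tnth (keep (scan c)) i = (scanned (tnth (tapes c) i), Stay).
Proof. by rewrite !tnth_mktuple. Qed.

Lemma tnth_bump r m c i : tnth (bump_tape r m (scan c)) i =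
  (scanned (tnth (tapes c) i), if val i == r then m else Stay).
Proof. by rewrite !tnth_mktuple. Qed.

Lemma stay_tape t : move_tape Stay (write_tape (scanned t) t) = t.
Proof. by case: t. Qed.

Definition istep (i : instr) (pc : nat) (st : pstate) : nat * pstate :=
  match i with
  | IInc r => (pc.+1, pinc r st)
  | IDec r => (pc.+1, pdec r st)
  | IRead r => (pc.+1, pread X r st)
  | IOut b => (pc.+1, pout b st)
  | IJz r l => (if regs st r == 0 then l else pc.+1, st)
  | IJmp l => (l, st)
  end.

Definition iregs i :=
  match i with IInc r | IDec r | IRead r | IJz r _ => r | _ => 0 end.

Lemma istep_machine c pc st i : represents pc st c -> onth code pc = Some i ->
  iregs i < k -> (forall r, i = IDec r -> 0 < regs st r) ->
  represents (istep i pc st).1 (istep i pc st).2 (@Defs.step code_machine X c).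
Proof.
move=> [sE hE oE tE] code_pc ltrk pos.
have lt_pc : pc < size code by rewrite -onthTE code_pc.
have lt_c : state c < (size code).+1 by rewrite sE.
have nth_pc d : nth d code pc = i by apply: onth_nth.
rewrite step_code_machine /instr_rule.
have keepP r : rule_work r = keep (scan c) -> forall j : 'I_k, exists n,
    tnth (tapes (@fire code_machine c r)) j = ctape (regs st j) n.
  move=> rE j; have [n jE] := tE j; exists n.
  by rewrite tnth_fire rE tnth_keep stay_tape.
have bumpP r m x v : rule_work r = bump_tape x m (scan c) ->
    (forall j, exists n, move_tape m (write_tape (scanned (ctape (regs st x) j))
                   (ctape (regs st x) j)) = ctape v n) ->
    forall j : 'I_k, exists n,
    tnth (tapes (@fire code_machine c r)) j = ctape (upd (regs st) x v j) n.
  move=> rE vE j; have [n jE] := tE j; rewrite tnth_fire rE tnth_bump /= /upd jE.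
  case: eqP => [->|_]; last by exists n; rewrite stay_tape.
  by apply: vE.
have zeroP (r : nat) : r < k -> counter_is_zero r (scan c) = (regs st r == 0).
  move=> ltr; rewrite /counter_is_zero.
  have [n rE] := tE (Ordinal ltr).
  by rewrite -(tnth_nth _ _ (Ordinal ltr)) tnth_mktuple rE scanned_ctape.
rewrite /= sE nth_pc.
case: i {nth_pc code_pc} ltrk pos => [r|r|r|b|r l|l] ltrk pos; rewrite [istep _ _ _]/=.
- split; try (by rewrite /= ?hE ?oE); apply: (bumpP _ Right r (regs st r).+1) => // j.
  by exists j.-1; rewrite ctape_right.
- split; try (by rewrite /= ?hE ?oE); apply: (bumpP _ Left r (regs st r).-1) => // j.
  have := pos r erefl; case: (regs st r) => // n _.
  by exists j.+1; rewrite ctape_left.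
- split; try by rewrite /= ?hE ?oE.
  rewrite hE [pread _ _ _]/pread [regs _]/=; case: (X _).
    by apply: (bumpP _ Right r (regs st r).+1) => // j; exists j.-1; rewrite ctape_right.
  have -> : upd (regs st) r (0 + regs st r) = regs st.
    by apply: funext => j; rewrite /upd; case: eqP => // ->.
  exact: keepP.
- by split; try (by rewrite /= ?hE ?oE); apply: keepP.
- by split; try (by rewrite /= ?zeroP //; case: ifP); apply: keepP.
- by split; try (by rewrite /= ?hE ?oE); apply: keepP.
Qed.

Lemma step_code_machine0 :
  represents 0 (PState (fun=> 0) 0 [::]) (Defs.run code_machine X 1).
Proof.
have lt_c : state (initial k) < (size code).+1 by [].
rewrite /run [iter _ _ _]/= step_code_machine.
split=> // i; exists 0.
by rewrite tnth_fire /= tnth_mktuple /= !tnth_mktuple.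
Qed.

End Compiled.

(** * Correctness of the compilation of programs *)

Section CompiledProgram.
Variables (p0 : prog).
Let code := compile 0 p0.
Let k := (pregs p0).+1.
Let M := code_machine code k.
Variable X : oracle.
Implicit Type c : config k.

Definition code_at pc (s : seq instr) :=
  forall i, i < size s -> onth code (pc + i) = onth s i.

Lemma code_at_cat pc s1 s2 : code_at pc (s1 ++ s2) ->
  code_at pc s1 /\ code_at (pc + size s1) s2.
Proof.
move=> h; split=> i lti.
  by rewrite h ?size_cat ?ltn_addr // onth_cat lti.
rewrite -addnA h ?size_cat ?ltn_add2l // onth_cat ltnNge leq_addr /=.
by rewrite addKn.
Qed.

Lemma code_at1 pc i s : code_at pc (i :: s) -> onth code pc = Some i.
Proof. by move=> /(_ 0 isT); rewrite addn0. Qed.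

Lemma code_atS pc i s : code_at pc (i :: s) -> code_at pc.+1 s.
Proof. by move=> /(@code_at_cat pc [:: i] s)[_]; rewrite addn1. Qed.

Definition reaches c pc st n :=
  represents pc st (iter n (@Defs.step M X) c).

Lemma reaches_trans c pc st n pc' st' m : reaches c pc st n ->
  reaches (iter n (@Defs.step M X) c) pc' st' m -> reaches c pc' st' (m + n).
Proof. by rewrite /reaches iterD. Qed.

Lemma reaches_step c pc st i s : represents pc st c -> code_at pc (i :: s) ->
  iregs i < k -> (forall r, i = IDec r -> 0 < regs st r) ->
  reaches c (istep X i pc st).1 (istep X i pc st).2 1.
Proof. by move=> cE /code_at1 codeE ltr pos; apply: istep_machine. Qed.

(** Stated for one turn, with the body given only by what it reaches, so that it serves terminating
    and infinite loops alike. The bound [n.+1] says that a turn takes time, which makes the times of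
    an infinite run strictly increasing. *)
Lemma while_turn r p st st' pc c : 0 < regs st r -> maxn r (pregs p) < k ->
  code_at pc (compile pc (While r p)) -> represents pc st c ->
  (forall c', code_at pc.+1 (compile pc.+1 p) -> represents pc.+1 st c' ->
     exists n, reaches c' (pc.+1 + psize p) st' n) ->
  exists n, reaches c pc st' n.+1.
Proof.
move=> r_gt0; rewrite gtn_max => /andP[ltr ltp] codeE cE pE.
have codeE' := code_atS codeE.
have cE1 : reaches c pc.+1 st 1.
  by have := reaches_step cE codeE ltr; rewrite /= (gtn_eqF r_gt0); apply.
have [codep codej] : code_at pc.+1 (compile pc.+1 p) /\
    code_at (pc.+1 + psize p) [:: IJmp pc].
  by move: codeE'; rewrite -cats1 => /code_at_cat; rewrite size_compile.
have [n nE] := pE _ codep cE1.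
exists n.+1; rewrite -[n.+2]addn1; apply: (reaches_trans cE1).
rewrite -[n.+1]add1n; apply: (reaches_trans nE).
exact: (reaches_step nE codej).
Qed.

Lemma exec_reaches p st st' : exec X p st st' -> pregs p < k ->
  forall pc c, code_at pc (compile pc p) -> represents pc st c ->
  exists n, reaches c (pc + psize p) st' n.
Proof.
elim=> {p st st'}.
- move=> r st ltr pc c codeE cE; exists 1; rewrite addn1.
  exact: (reaches_step cE codeE).
- move=> r st r_gt0 ltr pc c codeE cE; exists 1; rewrite addn1.
  by apply: (reaches_step cE codeE) => // _ [<-].
- move=> r st ltr pc c codeE cE; exists 1; rewrite addn1.
  exact: (reaches_step cE codeE).
- move=> r st ltr pc c codeE cE; exists 1; rewrite addn1.
  exact: (reaches_step cE codeE).
- move=> p q st1 st2 st3 _ IHp _ IHq /=; rewrite gtn_max => /andP[ltp ltq] pc c.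
  case/code_at_cat; rewrite size_compile => codep codeq cE.
  have [n nE] := IHp ltp _ _ codep cE; have [m mE] := IHq ltq _ _ codeq nE.
  by exists (m + n); rewrite addnA; apply: (reaches_trans nE).
- move=> r p st r0 /=; rewrite gtn_max => /andP[ltr _] pc c codeE cE.
  by exists 1; have := reaches_step cE codeE ltr; rewrite /= r0 !addnS; apply.
- move=> r p st1 st2 st3 r_gt0 _ IHp _ IHw ltw pc c codeE cE.
  have [|n nE] := @while_turn r p st1 st2 pc c r_gt0 ltw codeE cE.
    by move=> c'; apply: IHp; apply: leq_ltn_trans ltw; apply: leq_maxr.
  have [m mE] := IHw ltw _ _ codeE nE.
  by exists (m + n.+1); apply: (reaches_trans nE).
Qed.

End CompiledProgram.

Definition program_machine (p : prog) := code_machine (compile 0 p) (pregs p).+1.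

Definition pstate0 := PState (fun=> 0) 0 [::].

Lemma code_at_all p : code_at p 0 (compile 0 p).
Proof. by []. Qed.

Theorem program_machine_halts X p st : exec X p pstate0 st ->
  exists s, halted X (Defs.run (program_machine p) X s) /\
            output_at (program_machine p) X s = written st.
Proof.
move=> pE.
have [n nE] := exec_reaches pE (ltnSn _) (@code_at_all p)
  (step_code_machine0 (compile 0 p) (pregs p).+1 X).
have [sE _ oE _] := nE.
exists (n + 1); rewrite /output_at /run iterD; split=> //.
by rewrite halted_code_machine sE size_compile.
Qed.

Theorem program_machine_loops X p r q (sts : nat -> pstate) :
  exec X p pstate0 (sts 0) ->
  (forall s, 0 < regs (sts s) r) ->
  (forall s, exec X q (sts s) (sts s.+1)) ->
  exists t : nat -> nat, (forall s, t s < t s.+1) /\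
    forall s, output_at (program_machine (Seq p (While r q))) X (t s) =
                written (sts s) /\
              ~~ halted X (Defs.run (program_machine (Seq p (While r q))) X (t s)).
Proof.
move=> pE r_gt0 qE; set P := Seq p _; set M := program_machine P.
have [ltp ltw] : pregs p < (pregs P).+1 /\ maxn r (pregs q) < (pregs P).+1.
  by rewrite !ltnS leq_maxl leq_maxr.
have [codep codew] := code_at_cat (code_at_all (p := P)).
rewrite size_compile add0n in codew.
have [n0 n0E] := exec_reaches pE ltp codep
  (step_code_machine0 (compile 0 P) (pregs P).+1 X).
pose rep s c := @represents (pregs P).+1 (psize p) (sts s) c.
(* The condition sits under the existential quantifier, so that [choice] yields a total function of
   the turn and the time. *)
have turn (x : nat * nat) : exists T, rep x.1 (Defs.run M X x.2) ->
    x.2 < T /\ rep x.1.+1 (Defs.run M X T).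
  case: x => s T; have [sE|] := pselect (rep s (Defs.run M X T)); last by exists 0.
  have [|n nE] := @while_turn P X r q _ (sts s.+1) _ _ (r_gt0 s) ltw codew sE.
    move=> c' codeq c'E; apply: (exec_reaches (qE s)) codeq c'E.
    by apply: leq_ltn_trans ltw; apply: leq_maxr.
  by exists (n.+1 + T) => _; split; [rewrite addSn ltnS leq_addl|rewrite /run iterD].
have [f fE] := choice turn.
pose t := fix t s := if s is s'.+1 then f (s', t s') else n0 + 1.
have tE s : rep s (Defs.run M X (t s)).
  elim: s => [|s IHs]; last by have [] := fE (s, t s) IHs.
  by rewrite /run iterD.
exists t; split=> [s|s]; first by have [] := fE (s, t s) (tE s).
have [sE _ oE _] := tE s; split=> //.
rewrite halted_code_machine -leqNgt sE size_compile /=.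
by rewrite addnS ltnS leq_addr.
Qed.

(** * Computable functions on the natural numbers *)

(** The registers from [b] on serve as a stack frame. Those beyond the list are zero, so appending
    zeros to the list changes nothing and provides scratch registers. *)
Definition window b (rho : nat -> nat) (l : seq nat) :=
  fun i => if i < b then rho i else nth 0 l (i - b).

Lemma window_nth b rho l j : window b rho l (b + j) = nth 0 l j.
Proof. by rewrite /window ltnNge leq_addr addKn. Qed.

Lemma upd_window b rho l j v :
  upd (window b rho l) (b + j) v = window b rho (set_nth 0 l j v).
Proof.
apply: funext => i; rewrite /upd /window.
case: (ltnP i b) => [ltib|leib]; first by case: eqP => // ?; lia.
rewrite nth_set_nth /=; congr (if _ then _ else _).
by rewrite -{1}(subnKC leib) eqn_add2l.
Qed.

Lemma window_pad b rho l n : window b rho (l ++ nseq n 0) = window b rho l.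
Proof.
apply: funext => i; rewrite /window; case: ifP => // _.
by rewrite nth_cat nth_nseq if_same; case: ltnP => // h; rewrite nth_default.
Qed.

Lemma window_cat b rho l1 l2 :
  window b rho (l1 ++ l2) = window (b + size l1) (window b rho l1) l2.
Proof.
apply: funext => i; rewrite /window nth_cat.
case: (ltnP i b) => [ltib|leib]; first by rewrite ltn_addr.
by rewrite ltn_subLR // subnDA.
Qed.

(** The quantification over [rho] says that the registers below [b] are preserved whatever they
    hold; this lets a program run above the live data of another one. *)
Definition execs X p b l l' := forall rho pos w,
  exec X p (PState (window b rho l) pos w) (PState (window b rho l') pos w).

Section Execs.
Variable X : oracle.
Implicit Types (b j : nat) (l : seq nat) (p q : prog).

Lemma execs_inc b j l : execs X (Inc (b + j)) b l (set_nth 0 l j (nth 0 l j).+1).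
Proof.
move=> rho pos w; have := EInc X (b + j) (PState (window b rho l) pos w).
by rewrite /pinc /= upd_window window_nth.
Qed.

Lemma execs_dec b j l : 0 < nth 0 l j ->
  execs X (Dec (b + j)) b l (set_nth 0 l j (nth 0 l j).-1).
Proof.
move=> lj rho pos w; have := @EDec X (b + j) (PState (window b rho l) pos w).
by rewrite /pdec /= upd_window window_nth; apply.
Qed.

Lemma execs_seq p q b l1 l2 l3 :
  execs X p b l1 l2 -> execs X q b l2 l3 -> execs X (Seq p q) b l1 l3.
Proof. by move=> pE qE rho pos w; apply: ESeq (pE _ _ _) (qE _ _ _). Qed.

Lemma execs_while0 p b j l : nth 0 l j = 0 -> execs X (While (b + j) p) b l l.
Proof. by move=> lj rho pos w; apply: EWhile0; rewrite /= window_nth. Qed.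

Lemma execs_whileS p b j l1 l2 l3 : 0 < nth 0 l1 j -> execs X p b l1 l2 ->
  execs X (While (b + j) p) b l2 l3 -> execs X (While (b + j) p) b l1 l3.
Proof.
move=> lj pE wE rho pos w; apply: EWhileS (pE _ _ _) (wE _ _ _).
by rewrite /= window_nth.
Qed.

Lemma execs_pad p b l l' m n :
  execs X p b (l ++ nseq m 0) (l' ++ nseq n 0) -> execs X p b l l'.
Proof. by move=> h rho pos w; have := h rho pos w; rewrite !window_pad. Qed.

Lemma execs_unpad p b l l' m n : execs X p b l l' ->
  execs X p b (l ++ nseq m 0) (l' ++ nseq n 0).
Proof. by move=> h rho pos w; rewrite !window_pad. Qed.

Lemma execs_frame p b l0 l l' : execs X p (b + size l0) l l' ->
  execs X p b (l0 ++ l) (l0 ++ l').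
Proof. by move=> h rho pos w; rewrite !window_cat; apply: h. Qed.

End Execs.

Definition pclear i := While i (Dec i).
Definition pmove i j := While i (Seq (Dec i) (Inc j)).
Definition pmove2 i j k := While i (Seq (Dec i) (Seq (Inc j) (Inc k))).

Lemma upd_same rho i : upd rho i (rho i) = rho.
Proof. by apply: funext => j; rewrite /upd; case: eqP => // ->. Qed.

Section Moves.
Variables (X : oracle).

Lemma exec_clear r rho pos w :
  exec X (pclear r) (PState rho pos w) (PState (upd rho r 0) pos w).
Proof.
move En: (rho r) => n; elim: n rho En => [|n IHn] rho En.
  by rewrite -En upd_same; apply: EWhile0.
apply: EWhileS (EDec _ _) _; rewrite /= ?En // /pdec /= En.
have -> : upd rho r 0 = upd (upd rho r n) r 0.
  by apply: funext => i; rewrite /upd; case: eqP.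
by apply: IHn; rewrite /upd eqxx.
Qed.

Lemma exec_move r s rho pos w : r != s ->
  exec X (pmove r s) (PState rho pos w)
    (PState (upd (upd rho r 0) s (rho s + rho r)) pos w).
Proof.
move=> rs; move En: (rho r) => n; elim: n rho En => [|n IHn] rho En.
  rewrite -{1}En upd_same addn0 upd_same; exact: EWhile0.
apply: EWhileS (ESeq (EDec _ _) (EInc _ _ _)) _; rewrite /= ?En //.
rewrite /pinc /pdec /= En.
set rho' := upd _ s _.
have -> : upd (upd rho r 0) s (rho s + n.+1) = upd (upd rho' r 0) s (rho' s + n).
  apply: funext => i; rewrite /rho' /upd eqxx.
  case: (eqVneq i s) => _; first by rewrite eq_sym (negbTE rs) addnS.
  by case: eqP.
by apply: IHn; rewrite /rho' /upd (negbTE rs) eqxx.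
Qed.

Lemma exec_move2 r s t rho pos w : r != s -> r != t -> s != t ->
  exec X (pmove2 r s t) (PState rho pos w)
    (PState (upd (upd (upd rho r 0) s (rho s + rho r)) t (rho t + rho r)) pos w).
Proof.
move=> rs rt st; move En: (rho r) => n; elim: n rho En => [|n IHn] rho En.
  rewrite -{1}En upd_same !addn0 !upd_same; exact: EWhile0.
apply: EWhileS (ESeq (EDec _ _) (ESeq (EInc _ _ _) (EInc _ _ _))) _; rewrite /= ?En //.
rewrite /pinc /pdec /= En.
set rho' := upd _ t _.
have -> : upd (upd (upd rho r 0) s (rho s + n.+1)) t (rho t + n.+1) =
          upd (upd (upd rho' r 0) s (rho' s + n)) t (rho' t + n).
  apply: funext => i; rewrite /rho' /upd !eqxx.
  case: (eqVneq i t) => _.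
    by rewrite !(eq_sym t) (negbTE st) (negbTE rt) addnS.
  case: (eqVneq i s) => _; last by case: eqP.
  by rewrite (negbTE st) (eq_sym s) (negbTE rs) addnS.
by apply: IHn; rewrite /rho' /upd (negbTE rs) (negbTE rt) eqxx.
Qed.

Variable b : nat.

Lemma execs_clear i l : execs X (pclear (b + i)) b l (set_nth 0 l i 0).
Proof.
move=> rho pos w; have := exec_clear (b + i) (window b rho l) pos w.
by rewrite upd_window.
Qed.

Lemma execs_move i j l : i != j -> execs X (pmove (b + i) (b + j)) b l
  (set_nth 0 (set_nth 0 l i 0) j (nth 0 l j + nth 0 l i)).
Proof.
move=> ij rho pos w.
have := @exec_move (b + i) (b + j) (window b rho l) pos w.
by rewrite eqn_add2l !upd_window !window_nth; apply.
Qed.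

Lemma execs_move2 i j k l : i != j -> i != k -> j != k ->
  execs X (pmove2 (b + i) (b + j) (b + k)) b l
  (set_nth 0 (set_nth 0 (set_nth 0 l i 0) j (nth 0 l j + nth 0 l i))
    k (nth 0 l k + nth 0 l i)).
Proof.
move=> ij ik jk rho pos w.
have := @exec_move2 (b + i) (b + j) (b + k) (window b rho l) pos w.
by rewrite !eqn_add2l !upd_window !window_nth; apply.
Qed.

End Moves.

(* The argument and the result are in register [b]; the registers above it are
   zero before and after the computation, and those below it are unchanged. *)
Definition computes (p : nat -> prog) (f : nat -> nat) :=
  forall b X x, execs X (p b) b [:: x] [:: f x].

Definition computable_fun f := exists p, computes p f.

Lemma computable_eq f g : f =1 g -> computable_fun f -> computable_fun g.
Proof. by move=> /funext ->. Qed.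

Lemma computable_succ : computable_fun S.
Proof. by exists (fun b => Inc (b + 0)) => b X x; apply: (@execs_inc _ _ 0). Qed.

Lemma computable_zero : computable_fun (fun=> 0).
Proof.
by exists (fun b => pclear (b + 0)) => b X x; apply: (@execs_clear _ _ 0).
Qed.

Lemma computable_comp f g : computable_fun f -> computable_fun g ->
  computable_fun (fun x => g (f x)).
Proof.
move=> [p pE] [q qE]; exists (fun b => Seq (p b) (q b)) => b X x.
exact: execs_seq (pE _ _ _) (qE _ _ _).
Qed.

Lemma computable_pred : computable_fun predn.
Proof.
(* The loop acts as a test, since [Dec] is barred at zero: its body empties register [b + 0] into
   [b + 1], hence runs at most once. *)
exists (fun b => Seq (While (b + 0) (Seq (Dec (b + 0)) (pmove (b + 0) (b + 1))))
                     (pmove (b + 1) (b + 0))) => b X x.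
apply: (@execs_pad _ _ _ _ _ 1 1) => /=.
apply: (@execs_seq _ _ _ _ _ [:: 0; x.-1]); last exact: (@execs_move _ _ 1 0).
case: x => [|x]; first exact: execs_while0.
apply: (@execs_whileS _ _ _ _ _ [:: 0; x]) => //; last exact: execs_while0.
apply: (@execs_seq _ _ _ _ _ [:: x; 0]); first exact: (@execs_dec _ _ 0).
exact: (@execs_move _ _ 0 1).
Qed.

(** With s = e + n in register [b + 1], the loop adds s, s - 1, ..., 1 to the n in register [b + 2];
    the sum of these numbers is the binomial coefficient in [cantor_pair]. *)
Definition ppair b :=
  Seq (pmove2 (b + 0) (b + 1) (b + 2))
    (Seq (While (b + 1)
           (Seq (pmove2 (b + 1) (b + 2) (b + 3))
             (Seq (pmove (b + 3) (b + 1)) (Dec (b + 1)))))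
         (pmove (b + 2) (b + 0))).

Lemma ppairE X b e n :
  execs X (ppair b) b [:: n; e] [:: cantor_pair e n].
Proof.
apply: (@execs_pad _ _ _ _ _ 2 3) => /=.
apply: (@execs_seq _ _ _ _ _ [:: 0; e + n; n; 0]).
  exact: (@execs_move2 _ _ 0 1 2).
apply: (@execs_seq _ _ _ _ _ [:: 0; 0; cantor_pair e n; 0]); last first.
  exact: (@execs_move _ _ 2 0).
rewrite /cantor_pair; move: (e + n) => s.
elim: s n => [|s IHs] n; first by rewrite bin_small //; apply: execs_while0.
apply: (@execs_whileS _ _ _ _ _ [:: 0; s; n + s.+1; 0]) => //.
  apply: (@execs_seq _ _ _ _ _ [:: 0; 0; n + s.+1; s.+1]).
    exact: (@execs_move2 _ _ 1 2 3).
  apply: (@execs_seq _ _ _ _ _ [:: 0; s.+1; n + s.+1; 0]).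
    exact: (@execs_move _ _ 3 1).
  exact: (@execs_dec _ _ 1).
have -> : 'C(s.+2, 2) + n = 'C(s.+1, 2) + (n + s.+1) by rewrite binS bin1; lia.
exact: IHs.
Qed.

Definition pcopy b := Seq (pmove2 (b + 0) (b + 1) (b + 2)) (pmove (b + 2) (b + 0)).

Lemma pcopyE X b x : execs X (pcopy b) b [:: x] [:: x; x].
Proof.
apply: (@execs_pad _ _ _ _ _ 2 1) => /=.
apply: (@execs_seq _ _ _ _ _ [:: 0; x; x]); first exact: (@execs_move2 _ _ 0 1 2).
exact: (@execs_move _ _ 2 0).
Qed.

Lemma computable_pair f g : computable_fun f -> computable_fun g ->
  computable_fun (fun x => cantor_pair (f x) (g x)).
Proof.
move=> [p pE] [q qE].
exists (fun b => Seq (pcopy b) (Seq (pcopy (b + 1)) (Seq (pclear (b + 0))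
  (Seq (q (b + 2)) (Seq (pmove (b + 2) (b + 0)) (Seq (p (b + 1)) (ppair b))))))).
move=> b X x.
apply: (@execs_seq _ _ _ _ _ [:: x; x]); first exact: pcopyE.
apply: (@execs_seq _ _ _ _ _ [:: x; x; x]).
  by apply: (@execs_frame _ _ _ [:: x]); apply: pcopyE.
apply: (@execs_seq _ _ _ _ _ [:: 0; x; x]); first exact: (@execs_clear _ _ 0).
apply: (@execs_seq _ _ _ _ _ [:: 0; x; g x]).
  by apply: (@execs_frame _ _ _ [:: 0; x]); apply: qE.
apply: (@execs_seq _ _ _ _ _ [:: g x; x]).
  by apply: (@execs_pad _ _ _ _ _ 0 1) => /=; apply: (@execs_move _ _ 2 0).
apply: (@execs_seq _ _ _ _ _ [:: g x; f x]).
  by apply: (@execs_frame _ _ _ [:: g x]); apply: pE.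
exact: ppairE.
Qed.

(* The successor in the order of the values of [cantor_pair]. *)
Definition cantor_next (u : nat * nat) : nat * nat :=
  if u.1 is e.+1 then (e, u.2.+1) else (u.2.+1, 0).

Definition cantor_unpair c := iter c cantor_next (0, 0).

Lemma cantor_nextE u : let v := cantor_next u in
  cantor_pair v.1 v.2 = (cantor_pair u.1 u.2).+1.
Proof.
case: u => [[|e] n] /=; rewrite /cantor_pair; last by rewrite addSnnS addnS.
by rewrite !addn0 add0n binS bin1; lia.
Qed.

Lemma cantor_unpairK c :
  cantor_pair (cantor_unpair c).1 (cantor_unpair c).2 = c.
Proof. by elim: c => //= c IHc; rewrite cantor_nextE IHc. Qed.

Lemma cantor_pairK e n : cantor_unpair (cantor_pair e n) = (e, n).
Proof.
have next_pair u c : cantor_unpair c = u -> cantor_unpair c.+1 = cantor_next u.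
  by move=> <-.
move En: (e + n) => s; elim: s e n En => [|s IHs] e n.
  by case: e n => [|e] [|n].
elim: n e => [|n IHn] e.
  rewrite addn0 => ->; have /= -> := cantor_nextE (0, s).
  by apply: next_pair (IHs _ _ _).
rewrite addnS -addSn => /IHn /next_pair; have /= -> := cantor_nextE (e.+1, n).
by [].
Qed.

(* One diagonal step on the registers [c; e; n; t; f]: [f] is set to test
   [e = 0] while [e] is moved to [t]. *)
Definition pnext b :=
  Seq (Dec (b + 0)) (Seq (Inc (b + 4))
  (Seq (While (b + 1) (Seq (Dec (b + 1)) (Seq (Inc (b + 3)) (pclear (b + 4)))))
  (Seq (While (b + 4) (Seq (Dec (b + 4)) (Seq (pmove (b + 2) (b + 1)) (Inc (b + 1)))))
    (While (b + 3) (Seq (Dec (b + 3)) (Seq (Inc (b + 2)) (pmove (b + 3) (b + 1)))))))).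

Lemma pnextE X b c u : execs X (pnext b) b [:: c.+1; u.1; u.2; 0; 0]
  [:: c; (cantor_next u).1; (cantor_next u).2; 0; 0].
Proof.
case: u => e n /=.
apply: (@execs_seq _ _ _ _ _ [:: c; e; n; 0; 0]); first exact: (@execs_dec _ _ 0).
apply: (@execs_seq _ _ _ _ _ [:: c; e; n; 0; 1]); first exact: (@execs_inc _ _ 4).
apply: (@execs_seq _ _ _ _ _ [:: c; 0; n; e; nat_of_bool (e == 0)]).
  case: e => [|e]; first exact: execs_while0.
  have body m t f : execs X (Seq (Dec (b + 1)) (Seq (Inc (b + 3)) (pclear (b + 4))))
      b [:: c; m.+1; n; t; f] [:: c; m; n; t.+1; 0].
    apply: (@execs_seq _ _ _ _ _ [:: c; m; n; t; f]); first exact: (@execs_dec _ _ 1).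
    apply: (@execs_seq _ _ _ _ _ [:: c; m; n; t.+1; f]).
      exact: (@execs_inc _ _ 3).
    exact: (@execs_clear _ _ 4).
  apply: execs_whileS (body _ _ _) _ => //=.
  have loop m t : execs X (While (b + 1)
      (Seq (Dec (b + 1)) (Seq (Inc (b + 3)) (pclear (b + 4)))))
      b [:: c; m; n; t; 0] [:: c; 0; n; t + m; 0].
    elim: m t => [|m IHm] t; first by rewrite addn0; apply: execs_while0.
    by apply: execs_whileS (body _ _ _) _ => //=; rewrite -[t + m.+1]addSnnS; apply: IHm.
  exact: loop.
case: e => [|e].
  apply: (@execs_seq _ _ _ _ _ [:: c; n.+1; 0; 0; 0]); last exact: execs_while0.
  apply: (@execs_whileS _ _ _ _ _ [:: c; n.+1; 0; 0; 0]) => //; last exact: execs_while0.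
  apply: (@execs_seq _ _ _ _ _ [:: c; 0; n; 0; 0]); first exact: (@execs_dec _ _ 4).
  apply: (@execs_seq _ _ _ _ _ [:: c; n; 0; 0; 0]); first exact: (@execs_move _ _ 2 1).
  exact: (@execs_inc _ _ 1).
apply: (@execs_seq _ _ _ _ _ [:: c; 0; n; e.+1; 0]); first exact: execs_while0.
apply: (@execs_whileS _ _ _ _ _ [:: c; e; n.+1; 0; 0]) => //; last exact: execs_while0.
apply: (@execs_seq _ _ _ _ _ [:: c; 0; n; e; 0]); first exact: (@execs_dec _ _ 3).
apply: (@execs_seq _ _ _ _ _ [:: c; 0; n.+1; e; 0]); first exact: (@execs_inc _ _ 2).
exact: (@execs_move _ _ 3 1).
Qed.

Lemma punpairE X b c : execs X (While (b + 0) (pnext b)) b [:: c]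
  [:: 0; (cantor_unpair c).1; (cantor_unpair c).2].
Proof.
apply: (@execs_pad _ _ _ _ _ 4 2) => /=.
suff loop m u : execs X (While (b + 0) (pnext b)) b [:: m; u.1; u.2; 0; 0]
    [:: 0; (iter m cantor_next u).1; (iter m cantor_next u).2; 0; 0].
  exact: (loop c (0, 0)).
elim: m u => [|m IHm] u; first exact: execs_while0.
by apply: execs_whileS (pnextE _ _ _ _) _ => //=; rewrite -iterS iterSr; apply: IHm.
Qed.

Definition cantor_fst c := (cantor_unpair c).1.
Definition cantor_snd c := (cantor_unpair c).2.

Lemma computable_fst : computable_fun cantor_fst.
Proof.
exists (fun b => Seq (While (b + 0) (pnext b))
  (Seq (pclear (b + 2)) (pmove (b + 1) (b + 0)))) => b X x.
apply: execs_seq (punpairE _ _ _) _.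
apply: (@execs_pad _ _ _ _ _ 0 2) => /=.
apply: execs_seq (@execs_clear _ _ 2 _) _; exact: (@execs_move _ _ 1 0).
Qed.

Lemma computable_snd : computable_fun cantor_snd.
Proof.
exists (fun b => Seq (While (b + 0) (pnext b))
  (Seq (pclear (b + 1)) (pmove (b + 2) (b + 0)))) => b X x.
apply: execs_seq (punpairE _ _ _) _.
apply: (@execs_pad _ _ _ _ _ 0 2) => /=.
apply: execs_seq (@execs_clear _ _ 1 _) _; exact: (@execs_move _ _ 2 0).
Qed.

Lemma computable_id : computable_fun id.
Proof. exact: computable_comp computable_succ computable_pred. Qed.

Lemma computable_cst c : computable_fun (fun=> c).
Proof.
elim: c => [|c IHc]; first exact: computable_zero.
exact: computable_comp IHc computable_succ.
Qed.

(** The only source of unbounded loops: iteration ([computable_iter]) and search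
    ([computable_search]) are instances. *)
Lemma computable_while f g h F :
  computable_fun f -> computable_fun g -> computable_fun h ->
  (forall x, exists n, [/\ f (iter n g (h x)) = 0,
     forall m, m < n -> 0 < f (iter m g (h x)) & F x = iter n g (h x)]) ->
  computable_fun F.
Proof.
move=> [p pE] [q qE] [r rE] FE.
pose test b := Seq (pcopy b) (p (b + 1)).
have testE b X x : execs X (test b) b [:: x] [:: x; f x].
  apply: execs_seq (pcopyE _ _ _) _.
  by apply: (@execs_frame _ _ _ [:: x]); apply: pE.
exists (fun b => Seq (r b) (Seq (test b)
  (While (b + 1) (Seq (pclear (b + 1)) (Seq (q b) (test b)))))) => b X x.
apply: execs_seq (rE _ _ _) _; apply: execs_seq (testE _ _ _) _.
have [n [fn0 fn ->]] := FE x.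
apply: (@execs_pad _ _ _ _ _ 0 1) => /=.
elim: n (h x) fn0 fn => [|n IHn] y fn0 fn.
  by rewrite [f y]fn0; apply: execs_while0.
have fy := fn 0 (ltn0Sn _).
apply: (@execs_whileS _ _ _ _ _ [:: g y; f (g y)]) => //.
  apply: (@execs_seq _ _ _ _ _ [:: y; 0]); first exact: (@execs_clear _ _ 1).
  apply: (@execs_seq _ _ _ _ _ [:: g y]); last exact: testE.
  apply: (@execs_pad _ _ _ _ _ 0 1).
  by apply: (@execs_unpad _ _ _ [:: y] _ 1 1); apply: qE.
rewrite iterSr; apply: IHn; rewrite -?iterSr // => m ltm.
by rewrite -iterSr; apply: fn.
Qed.

Lemma computable_iter f : computable_fun f ->
  computable_fun (fun x => iter (cantor_snd x) f (cantor_fst x)).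
Proof.
move=> cf.
pose g x := cantor_pair (f (cantor_fst x)) (cantor_snd x).-1.
pose F x := cantor_pair (iter (cantor_snd x) f (cantor_fst x)) 0.
apply: (@computable_eq (fun x => cantor_fst (F x))).
  by move=> x; rewrite /F /cantor_fst cantor_pairK.
apply: computable_comp computable_fst.
have iterg x m : iter m g x =
    cantor_pair (iter m f (cantor_fst x)) (cantor_snd x - m).
  elim: m => [|m IHm]; first by rewrite subn0 cantor_unpairK.
  by rewrite iterS IHm /g /cantor_fst /cantor_snd cantor_pairK /= subnS.
apply: (@computable_while cantor_snd g id).
- exact: computable_snd.
- apply: computable_pair; first exact: computable_comp computable_fst cf.
  exact: computable_comp computable_snd computable_pred.
- exact: computable_id.
move=> x; exists (cantor_snd x); split=> [|m|].
- by rewrite iterg subnn /cantor_snd cantor_pairK.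
- by rewrite iterg {2}/cantor_snd cantor_pairK /= subn_gt0.
- by rewrite iterg subnn.
Qed.

Lemma computable_search (P G F : nat -> nat) :
  computable_fun P -> computable_fun G ->
  (forall a, exists n, P (cantor_pair a n) = 0) ->
  (forall a n, P (cantor_pair a n) = 0 -> G (cantor_pair a n) = F a) ->
  computable_fun F.
Proof.
move=> cP cG exP GF.
have exP' a : exists n, P (cantor_pair a n) == 0.
  by have [n Pn] := exP a; exists n; rewrite Pn.
pose g x := cantor_pair (cantor_fst x) (cantor_snd x).+1.
pose S a := cantor_pair a (ex_minn (exP' a)).
apply: (@computable_eq (fun a => G (S a))) => [a|].
  by rewrite /S; case: ex_minnP => n /eqP Pn _; apply: GF.
apply: computable_comp cG.
have iterg a n : iter n g (cantor_pair a 0) = cantor_pair a n.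
  elim: n => // n IHn.
  by rewrite iterS IHn /g /cantor_fst /cantor_snd cantor_pairK.
apply: (@computable_while P g (fun a => cantor_pair a 0)) => //.
- apply: computable_pair computable_fst _.
  exact: computable_comp computable_snd computable_succ.
- by apply: computable_pair computable_id _; apply: computable_cst.
move=> a; rewrite /S; case: ex_minnP => n /eqP Pn min_n; exists n.
split=> [|m ltmn|]; rewrite iterg //.
by rewrite lt0n; apply/negP => /min_n; rewrite leqNgt ltmn.
Qed.

(** * Computable functions on encoded data *)

Class Coding (T : Type) := Code { encode : T -> nat; encode_inj : injective encode }.

Lemma cantor_pair_inj a b c d : cantor_pair a b = cantor_pair c d -> (a, b) = (c, d).
Proof. by rewrite -!cantor_pairK => ->. Qed.

Instance nat_coding : Coding nat := @Code nat id (fun _ _ => id).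

Lemma nat_of_bool_inj : injective nat_of_bool.
Proof. by move=> [] []. Qed.
Instance bool_coding : Coding bool := Code nat_of_bool_inj.

Section PairCoding.
Context {A B : Type} {cA : Coding A} {cB : Coding B}.
Definition encode_pair (x : A * B) := cantor_pair (encode x.1) (encode x.2).
Lemma encode_pair_inj : injective encode_pair.
Proof.
move=> [a b] [c d] /cantor_pair_inj[ac bd].
by rewrite (encode_inj ac) (encode_inj bd).
Qed.
#[global] Instance pair_coding : Coding (A * B) := Code encode_pair_inj.

(** The empty sequence has code 0 and a nonempty one a successor, so that a case distinction is a
    zero test followed by a predecessor; [option] is coded alike. *)
Fixpoint encode_seq (s : seq A) : nat :=
  if s is a :: s' then (cantor_pair (encode a) (encode_seq s')).+1 else 0.
Lemma encode_seq_inj : injective encode_seq.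
Proof.
elim=> [|a s IHs] [|b t] //= [] /cantor_pair_inj[ab st].
by rewrite (encode_inj ab) (IHs _ st).
Qed.
#[global] Instance seq_coding : Coding (seq A) := Code encode_seq_inj.

Definition encode_option (o : option A) := if o is Some a then (encode a).+1 else 0.
Lemma encode_option_inj : injective encode_option.
Proof. by move=> [a|] [b|] //= [ab]; rewrite (encode_inj ab). Qed.
#[global] Instance option_coding : Coding (option A) := Code encode_option_inj.
End PairCoding.

Generalizable Variables A B C D E.

Definition computable {A B} {cA : Coding A} {cB : Coding B} (f : A -> B) :=
  exists2 F, computable_fun F & forall a, F (encode a) = encode (f a).

Lemma comp_ext `{Coding A, Coding B} (f g : A -> B) : f =1 g -> computable f -> computable g.
Proof. by move=> /funext ->. Qed.

Lemma comp_fun (F : nat -> nat) : computable_fun F -> computable F.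
Proof. by exists F. Qed.

Lemma comp_id `{Coding A} : computable (fun x : A => x).
Proof. by exists id => //; apply: computable_id. Qed.

Lemma comp_cst `{Coding A, Coding B} (c : B) : computable (fun _ : A => c).
Proof. by exists (fun=> encode c) => //; apply: computable_cst. Qed.

Lemma comp_app `{Coding A, Coding B, Coding C} (g : B -> C) (f : A -> B) : computable g -> computable f ->
  computable (fun x => g (f x)).
Proof.
move=> [G cG GE] [F cF FE]; exists (fun x => G (F x)); last by move=> a; rewrite FE GE.
exact: computable_comp.
Qed.

Lemma comp_pair `{Coding A, Coding B, Coding C} (f : A -> B) (g : A -> C) : computable f -> computable g ->
  computable (fun x => (f x, g x)).
Proof.
move=> [F cF FE] [G cG GE]; exists (fun x => cantor_pair (F x) (G x)).
  exact: computable_pair.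
by move=> a; rewrite FE GE.
Qed.

Lemma comp_fst `{Coding A, Coding B, Coding C} (f : A -> B * C) : computable f -> computable (fun x => (f x).1).
Proof.
move=> [F cF FE]; exists (fun x => cantor_fst (F x)).
  exact: computable_comp cF computable_fst.
by move=> a; rewrite FE /cantor_fst cantor_pairK.
Qed.

Lemma comp_snd `{Coding A, Coding B, Coding C} (f : A -> B * C) : computable f -> computable (fun x => (f x).2).
Proof.
move=> [F cF FE]; exists (fun x => cantor_snd (F x)).
  exact: computable_comp cF computable_snd.
by move=> a; rewrite FE /cantor_snd cantor_pairK.
Qed.

Lemma comp_succ `{Coding A} (f : A -> nat) : computable f -> computable (fun x => (f x).+1).
Proof.
by move=> cf; apply: (comp_app (g := S)) => //; apply/comp_fun/computable_succ.
Qed.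

Lemma comp_pred `{Coding A} (f : A -> nat) : computable f -> computable (fun x => (f x).-1).
Proof.
by move=> cf; apply: (comp_app (g := predn)) => //; apply/comp_fun/computable_pred.
Qed.

Lemma comp_encode `{Coding A, Coding B} (f : A -> B) : computable f -> computable (fun x => encode (f x)).
Proof. by case=> F cF FE; exists F. Qed.

Lemma comp_iter `{Coding A, Coding B} (n : A -> nat) (h : A -> B -> B) (z : A -> B) :
  computable n -> computable (fun p : A * B => h p.1 p.2) -> computable z ->
  computable (fun x => iter (n x) (h x) (z x)).
Proof.
move=> [N cN NE] [K cK KE] [Z cZ ZE].
pose G y := cantor_pair (cantor_fst y) (K y).
pose I y := iter (cantor_snd y) G (cantor_fst y).
exists (fun x => cantor_snd (I (cantor_pair (cantor_pair x (Z x)) (N x)))).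
  apply: computable_comp computable_snd.
  apply: (@computable_comp _ I).
    apply: computable_pair cN; apply: computable_pair cZ; exact: computable_id.
  by apply: computable_iter; apply: computable_pair cK; apply: computable_fst.
move=> a; rewrite /I {2}/cantor_snd /cantor_fst !cantor_pairK /= NE ZE.
assert (E : forall m, iter m G (cantor_pair (encode a) (encode (z a))) =
    cantor_pair (encode a) (encode (iter m (h a) (z a)))).
  elim=> // m IHm; rewrite iterS IHm /G /cantor_fst cantor_pairK /=.
  by rewrite -(KE (a, _)).
by rewrite E /cantor_snd cantor_pairK.
Qed.

(** The code of the condition, 0 or 1, is the number of times the pair of the two values is
    swapped. *)
Lemma comp_if `{Coding A, Coding B} (b : A -> bool) (f g : A -> B) :
  computable b -> computable f -> computable g ->
  computable (fun x => if b x then f x else g x).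
Proof.
move=> cb cf cg.
apply: (comp_ext (f := 
  fun x => (iter (encode (b x)) (fun p : B * B => (p.2, p.1)) (g x, f x)).1)).
  by move=> x; case: (b x).
apply: comp_fst; apply: (comp_iter (n := fun x => encode (b x))
  (h := fun _ p => (p.2, p.1)) (z := fun x => (g x, f x))).
- exact: comp_encode.
- by apply: comp_pair; [apply: comp_snd|apply: comp_fst]; apply: comp_snd; apply: comp_id.
- exact: comp_pair.
Qed.

Lemma comp_eq0 `{Coding A} (f : A -> nat) : computable f -> computable (fun x => f x == 0).
Proof.
move=> cf; apply: (comp_ext (f := fun x => iter (f x) (fun=> false) true)).
  by move=> x; case: (f x).
by apply: (comp_iter (h := fun _ _ => false)) cf _ _; apply: comp_cst.
Qed.

Lemma comp_seq_case `{Coding A, Coding B, Coding C} (s : A -> seq B) (f : A -> B -> seq B -> C) (g : A -> C) :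
  computable s -> computable (fun p : A * (B * seq B) => f p.1 p.2.1 p.2.2) ->
  computable g ->
  computable (fun x => if s x is b :: s' then f x b s' else g x).
Proof.
move=> [S cS SE] [F cF FE] [G cG GE].
have [K cK KE] : computable (fun x : nat => if S x == 0 then G x
    else F (cantor_pair x (S x).-1)).
  apply: comp_if; [exact/comp_eq0/comp_fun|exact: comp_fun|apply: comp_fun].
  apply: (@computable_comp (fun x => cantor_pair x (S x).-1) F) => //.
  by apply: computable_pair computable_id _; apply: computable_comp computable_pred.
exists K => // a; rewrite [K _]KE SE /=.
by case: (s a) => [|b t] /=; rewrite ?GE // -(FE (a, (b, t))).
Qed.

Lemma comp_option_case `{Coding A, Coding B, Coding C} (s : A -> option B) (f : A -> B -> C) (g : A -> C) :
  computable s -> computable (fun p : A * B => f p.1 p.2) -> computable g ->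
  computable (fun x => if s x is Some b then f x b else g x).
Proof.
move=> [S cS SE] [F cF FE] [G cG GE].
have [K cK KE] : computable (fun x : nat => if S x == 0 then G x
    else F (cantor_pair x (S x).-1)).
  apply: comp_if; [exact/comp_eq0/comp_fun|exact: comp_fun|apply: comp_fun].
  apply: (@computable_comp (fun x => cantor_pair x (S x).-1) F) => //.
  by apply: computable_pair computable_id _; apply: computable_comp computable_pred.
exists K => // a; rewrite [K _]KE SE /=.
by case: (s a) => [b|] /=; rewrite ?GE // -(FE (a, b)).
Qed.

Lemma comp_some `{Coding A, Coding B} (f : A -> B) : computable f -> computable (fun x => Some (f x)).
Proof.
move=> [F cF FE]; exists (fun x => (F x).+1); last by move=> a; rewrite FE.
exact: computable_comp computable_succ.
Qed.

Lemma comp_cons `{Coding A, Coding B} (f : A -> B) (s : A -> seq B) : computable f -> computable s ->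
  computable (fun x => f x :: s x).
Proof.
move=> [F cF FE] [S cS SE]; exists (fun x => (cantor_pair (F x) (S x)).+1).
  exact: computable_comp (computable_pair cF cS) computable_succ.
by move=> a; rewrite FE SE.
Qed.

Lemma size_encode {A} {cA : Coding A} (s : seq A) : size s <= encode s.
Proof.
elim: s => //= a s IHs; rewrite ltnS (leq_trans IHs) //.
exact: leq_addl.
Qed.

(** Recursion on a list becomes a bounded iteration: the code of a list is at least its length
    ([size_encode]), and the turns in excess are idle because [next] fixes an empty list. *)
Lemma comp_foldl `{Coding A, Coding B, Coding C} (s : A -> seq B) (h : A -> C -> B -> C) (z : A -> C) :
  computable (fun p : A * (C * B) => h p.1 p.2.1 p.2.2) -> computable z ->
  computable s -> computable (fun x => foldl (h x) (z x) (s x)).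
Proof.
move=> ch cz cs.
pose next x (p : C * seq B) := if p.2 is b :: s' then (h x p.1 b, s') else p.
have nextE x n p : size p.2 <= n -> (iter n (next x) p).1 = foldl (h x) p.1 p.2.
  elim: n p => [|n IHn] [z' [|b s']] //= szp; last by rewrite -iterS iterSr IHn.
  by rewrite -iterS iterSr IHn.
apply: (comp_ext (f := fun x => (iter (encode (s x)) (next x) (z x, s x)).1)).
  by move=> x; rewrite nextE // size_encode.
apply: comp_fst; apply: (comp_iter (h := next)).
- exact: comp_encode.
- apply: (comp_seq_case (s := fun p : A * (C * seq B) => p.2.2)
    (f := fun p b s' => (h p.1 p.2.1 b, s')) (g := fun p => p.2)).
  + by do 2!apply: comp_snd; apply: comp_id.
  + apply: comp_pair; last by do 2!apply: comp_snd; apply: comp_id.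
    apply: (comp_app (g := fun p : A * (C * B) => h p.1 p.2.1 p.2.2)
     (f := fun q => (q.1.1, (q.1.2.1, q.2.1)))) => //.
    apply: comp_pair; first by do 2!apply: comp_fst; apply: comp_id.
    apply: comp_pair; first by apply: comp_fst; apply: comp_snd; apply: comp_fst; apply: comp_id.
    by apply: comp_fst; apply: comp_snd; apply: comp_id.
  + by apply: comp_snd; apply: comp_id.
- exact: comp_pair.
Qed.

Create HintDb comp.
#[global] Hint Constants Opaque : comp.
#[global] Hint Resolve comp_id comp_cst comp_fst comp_snd comp_pair comp_succ
  comp_pred comp_encode comp_if comp_eq0 comp_seq_case 
  comp_option_case comp_some comp_cons comp_iter comp_foldl : comp.

Lemma comp_app2 `{Coding A, Coding B, Coding C, Coding D} (h : B -> C -> D)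
    (f : A -> B) (g : A -> C) : computable (fun p : B * C => h p.1 p.2) ->
  computable f -> computable g -> computable (fun x => h (f x) (g x)).
Proof.
move=> ch cf cg.
by apply: (comp_app (g := fun p : B * C => h p.1 p.2)
  (f := fun x => (f x, g x))) => //; apply: comp_pair.
Qed.

Lemma comp_app3 `{Coding A, Coding B, Coding C, Coding D, Coding E}
    (h : B -> C -> D -> E) (f : A -> B) (g : A -> C) (k : A -> D) :
  computable (fun p : B * (C * D) => h p.1 p.2.1 p.2.2) ->
  computable f -> computable g -> computable k ->
  computable (fun x => h (f x) (g x) (k x)).
Proof.
move=> ch cf cg ck.
by apply: (comp_app (g := fun p : B * (C * D) => h p.1 p.2.1 p.2.2)
  (f := fun x => (f x, (g x, k x)))) => //; do !apply: comp_pair.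
Qed.

#[global] Hint Extern 2 (computable _) =>
  match goal with
  | h : computable ?f |- computable (fun x => ?f _) => eapply (comp_app h)
  | h : computable (fun p => ?f p.1 p.2) |- computable (fun x => ?f _ _) =>
      eapply (comp_app2 h)
  | h : computable (fun p => ?f p.1 p.2.1 p.2.2) |- computable (fun x => ?f _ _ _) =>
      eapply (comp_app3 h)
  end : comp.

Ltac comp := solve [eauto 100 with comp nocore].

Lemma comp_nat_of_bool `{Coding A} (f : A -> bool) :
  computable f -> computable (fun x => nat_of_bool (f x)).
Proof. by case=> F cF FE; exists F. Qed.
#[global] Hint Resolve comp_nat_of_bool : comp.

Lemma comp_add `{Coding A} (f g : A -> nat) : computable f -> computable g -> computable (fun x => f x + g x).
Proof.
move=> cf cg; apply: (comp_ext (f := fun x => iter (f x) S (g x))).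
  by move=> x; rewrite iter_succn addnC.
comp.
Qed.

Lemma comp_sub `{Coding A} (f g : A -> nat) : computable f -> computable g -> computable (fun x => f x - g x).
Proof.
move=> cf cg; apply: (comp_ext (f := fun x => iter (g x) predn (f x))).
  by move=> x; rewrite iter_predn.
comp.
Qed.
#[global] Hint Resolve comp_add comp_sub : comp.

Lemma comp_mul `{Coding A} (f g : A -> nat) : computable f -> computable g -> computable (fun x => f x * g x).
Proof.
move=> cf cg; apply: (comp_ext (f := fun x => iter (g x) (addn (f x)) 0)).
  by move=> x; rewrite iter_addn_0.
comp.
Qed.
#[global] Hint Resolve comp_mul : comp.

Lemma comp_exp `{Coding A} (f g : A -> nat) : computable f -> computable g -> computable (fun x => f x ^ g x).
Proof.
move=> cf cg; apply: (comp_ext (f := fun x => iter (g x) (muln (f x)) 1)).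
  by move=> x; rewrite iter_muln_1.
comp.
Qed.

Lemma comp_leq `{Coding A} (f g : A -> nat) : computable f -> computable g -> computable (fun x => f x <= g x).
Proof. move=> cf cg; rewrite /leq; comp. Qed.
#[global] Hint Resolve comp_leq : comp.

Lemma comp_and `{Coding A} (b c : A -> bool) : computable b -> computable c -> computable (fun x => b x && c x).
Proof. by move=> cb cc; rewrite /andb; comp. Qed.

Lemma comp_or `{Coding A} (b c : A -> bool) : computable b -> computable c -> computable (fun x => b x || c x).
Proof. by move=> cb cc; rewrite /orb; comp. Qed.

Lemma comp_negb `{Coding A} (b : A -> bool) : computable b -> computable (fun x => ~~ b x).
Proof. by move=> cb; rewrite /negb; comp. Qed.
#[global] Hint Resolve comp_and comp_or comp_negb : comp.

Lemma comp_imply `{Coding A} (b c : A -> bool) : computable b -> computable c -> computable (fun x => b x ==> c x).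
Proof. by move=> cb cc; rewrite /implb; comp. Qed.

Lemma comp_odd `{Coding A} (f : A -> nat) : computable f -> computable (fun x => odd (f x)).
Proof.
move=> cf; apply: (comp_ext (f := fun x => iter (f x) negb false)) => [x|].
  by elim: (f x) => //= n ->.
comp.
Qed.

#[global] Hint Resolve comp_exp comp_imply comp_odd : comp.

Lemma comp_eq `{Coding A} (T : eqType) {cT : Coding T} (f g : A -> T) :
  computable f -> computable g -> computable (fun x => f x == g x).
Proof.
move=> cf cg.
apply: (comp_ext (f := fun x => (encode (f x) <= encode (g x)) &&
                               (encode (g x) <= encode (f x)))) => [x|].
  by rewrite -eqn_leq (inj_eq encode_inj).
comp.
Qed.

Lemma comp_eqn `{Coding A} (f g : A -> nat) :
  computable f -> computable g -> computable (fun x => f x == g x).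
Proof. exact: comp_eq. Qed.

Lemma comp_eqb `{Coding A} (f g : A -> bool) :
  computable f -> computable g -> computable (fun x => f x == g x).
Proof. exact: comp_eq. Qed.

Lemma comp_eqseq `{Coding A} (f g : A -> seq nat) :
  computable f -> computable g -> computable (fun x => f x == g x).
Proof. exact: comp_eq. Qed.
#[global] Hint Resolve comp_eqn comp_eqb comp_eqseq : comp.

Lemma foldl_rev_cons (T : Type) (acc s : seq T) :
  foldl (fun acc a => a :: acc) acc s = catrev s acc.
Proof. by elim: s acc => //=. Qed.

Lemma comp_rev `{Coding A, Coding B} (s : A -> seq B) :
  computable s -> computable (fun x => rev (s x)).
Proof.
move=> cs; apply: (comp_ext (f := fun x =>
  foldl (fun acc a => a :: acc) [::] (s x))); last comp.
by move=> x; rewrite foldl_rev_cons.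
Qed.
#[global] Hint Resolve comp_rev : comp.

Lemma comp_cat `{Coding A, Coding B} (s t : A -> seq B) :
  computable s -> computable t -> computable (fun x => s x ++ t x).
Proof.
move=> cs ct; apply: (comp_ext (f := fun x =>
  foldl (fun acc a => a :: acc) (t x) (rev (s x)))); last comp.
by move=> x; rewrite foldl_rev_cons catrevE revK.
Qed.
#[global] Hint Resolve comp_cat : comp.

Lemma comp_rcons `{Coding A, Coding B} (s : A -> seq B) (b : A -> B) :
  computable s -> computable b -> computable (fun x => rcons (s x) (b x)).
Proof.
move=> cs cb; apply: (comp_ext (f := fun x => s x ++ [:: b x])); last comp.
by move=> x; rewrite cats1.
Qed.
#[global] Hint Resolve comp_rcons : comp.

Lemma comp_map `{Coding A, Coding B, Coding C} (h : A -> B -> C) (s : A -> seq B) :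
  computable (fun p : A * B => h p.1 p.2) -> computable s ->
  computable (fun x => map (h x) (s x)).
Proof.
move=> ch cs; apply: (comp_ext (f := fun x =>
  foldl (fun acc a => rcons acc (h x a)) [::] (s x))) => [x|].
  by rewrite -[map _ _]cat0s; elim: (s x) [::] => [|a t IHt] acc /=;
    rewrite ?cats0 // IHt cat_rcons.
comp.
Qed.
#[global] Hint Resolve comp_map : comp.

Lemma comp_has `{Coding A, Coding B} (h : A -> B -> bool) (s : A -> seq B) :
  computable (fun p : A * B => h p.1 p.2) -> computable s ->
  computable (fun x => has (h x) (s x)).
Proof.
move=> ch cs; apply: (comp_ext (f := fun x =>
  foldl (fun acc c => acc || c) false (map (h x) (s x)))); last comp.
move=> x; rewrite -[RHS]orFb; elim: (s x) false => [|a t IHt] acc /=.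
  by rewrite orbF.
by rewrite IHt orbA.
Qed.

Lemma comp_count `{Coding A, Coding B} (h : A -> B -> bool) (s : A -> seq B) :
  computable (fun p : A * B => h p.1 p.2) -> computable s ->
  computable (fun x => count (h x) (s x)).
Proof.
move=> ch cs; apply: (comp_ext (f := fun x =>
  foldl (fun acc (c : bool) => acc + c) 0 (map (h x) (s x)))); last comp.
move=> x; rewrite -[RHS]add0n; elim: (s x) 0 => [|a t IHt] acc /=.
  by rewrite addn0.
by rewrite IHt addnA.
Qed.
#[global] Hint Resolve comp_has comp_count : comp.

Lemma comp_all `{Coding A, Coding B} (h : A -> B -> bool) (s : A -> seq B) :
  computable (fun p : A * B => h p.1 p.2) -> computable s ->
  computable (fun x => all (h x) (s x)).
Proof.
move=> ch cs; apply: (comp_ext (f := fun x => ~~ has (fun b => ~~ h x b) (s x))).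
  by move=> x; rewrite has_predC negbK.
comp.
Qed.

Lemma comp_size `{Coding A, Coding B} (s : A -> seq B) :
  computable s -> computable (fun x => size (s x)).
Proof.
move=> cs; apply: (comp_ext (f := fun x => count (fun=> true) (s x))); last comp.
by move=> x; rewrite -(count_predT (s x)).
Qed.

Lemma comp_behead `{Coding A, Coding B} (s : A -> seq B) :
  computable s -> computable (fun x => behead (s x)).
Proof. move=> cs; rewrite /behead; comp. Qed.

Lemma comp_head `{Coding A, Coding B} (d : A -> B) (s : A -> seq B) :
  computable d -> computable s -> computable (fun x => head (d x) (s x)).
Proof. move=> cd cs; rewrite /head; comp. Qed.
#[global] Hint Resolve comp_all comp_size comp_behead comp_head : comp.

Lemma comp_drop `{Coding A, Coding B} (n : A -> nat) (s : A -> seq B) :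
  computable n -> computable s -> computable (fun x => drop (n x) (s x)).
Proof.
move=> cn cs; apply: (comp_ext (f := fun x => iter (n x) behead (s x))); last comp.
by move=> x; elim: (n x) (s x) => [|m IHm] [|a t] //=; rewrite -?iterS iterSr IHm.
Qed.
#[global] Hint Resolve comp_drop : comp.

Lemma comp_nth `{Coding A, Coding B} (d : A -> B) (s : A -> seq B) (n : A -> nat) :
  computable d -> computable s -> computable n ->
  computable (fun x => nth (d x) (s x) (n x)).
Proof.
move=> cd cs cn; apply: (comp_ext (f := fun x => head (d x) (drop (n x) (s x)))).
  by move=> x; rewrite -nth0 nth_drop addn0.
comp.
Qed.
#[global] Hint Resolve comp_nth : comp.

Lemma comp_iota `{Coding A} (m n : A -> nat) :
  computable m -> computable n -> computable (fun x => iota (m x) (n x)).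
Proof.
move=> cm cn; apply: (comp_ext (f := fun x =>
  iter (n x) (fun s => rcons s (m x + size s)) [::])); last comp.
move=> x; elim: (n x) => // k IHk.
by rewrite iterS IHk size_iota -[k.+1]addn1 iotaD cats1.
Qed.
#[global] Hint Resolve comp_iota : comp.

Lemma comp_nseq `{Coding A, Coding B} (n : A -> nat) (b : A -> B) :
  computable n -> computable b -> computable (fun x => nseq (n x) (b x)).
Proof.
move=> cn cb; apply: (comp_ext (f := fun x => iter (n x) (cons (b x)) [::])); last comp.
by move=> x; elim: (n x) => //= k ->.
Qed.
#[global] Hint Resolve comp_nseq : comp.

Lemma comp_filter `{Coding A, Coding B} (h : A -> B -> bool) (s : A -> seq B) :
  computable (fun p : A * B => h p.1 p.2) -> computable s ->
  computable (fun x => seq.filter (h x) (s x)).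
Proof.
move=> ch cs; apply: (comp_ext (f := fun x =>
  foldl (fun acc a => if h x a then rcons acc a else acc) [::] (s x))) => [x|].
  rewrite -[seq.filter _ _]cat0s; elim: (s x) [::] => [|a t IHt] acc /=.
    by rewrite cats0.
  by rewrite IHt; case: (h x a) => //; rewrite cat_rcons.
comp.
Qed.

Lemma comp_find `{Coding A, Coding B} (h : A -> B -> bool) (s : A -> seq B) :
  computable (fun p : A * B => h p.1 p.2) -> computable s ->
  computable (fun x => find (h x) (s x)).
Proof.
move=> ch cs; apply: (comp_ext (f := fun x => (foldl
  (fun (p : nat * bool) a => if p.2 then p else if h x a then (p.1, true) else (p.1.+1, false))
  (0, false) (s x)).1)) => [x|].
  have stuck n t : foldl (fun (p : nat * bool) a => if p.2 then p else
      if h x a then (p.1, true) else (p.1.+1, false)) (n, true) t = (n, true).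
    by elim: t.
  rewrite -[RHS]add0n; elim: (s x) 0 => [|a t IHt] n /=; first by rewrite addn0.
  by case: (h x a); [rewrite stuck addn0|rewrite IHt addSnnS].
comp.
Qed.
#[global] Hint Resolve comp_filter comp_find : comp.

(** * A computable simulation of all machines *)

(** The numbers are those used by [optbool_code] and, for [umove], by [move_code], so that parsing
    the code of a machine gives its quotation directly. *)
Definition usym (a : symbol) : nat :=
  match a with None => 0 | Some false => 1 | Some true => 2 end.

Definition umove (m : move) : nat :=
  match m with Left => 0 | Stay => 1 | Right => 2 end.

Lemma usym_inj : injective usym.
Proof. by move=> [[]|] [[]|]. Qed.

(* state, oracle bit, scanned symbols, next state, oracle move, work, output *)
Notation urule :=
  (nat * (bool * (seq nat * (nat * (nat * (seq (nat * nat) * nat))))))%type.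
Notation umachine := (nat * seq urule)%type.
Notation utape := (seq nat * (nat * seq nat))%type.
(* state, oracle head, tapes, output *)
Notation uconfig := (nat * (nat * (seq utape * seq bool)))%type.

Definition quote_rule k (r : rule k) : urule :=
  (rule_state r, (rule_obit r, (map usym (rule_scan r), (rule_next r,
    (umove (rule_omove r),
     (map (fun a => (usym a.1, umove a.2)) (rule_work r), usym (rule_out r))))))).

Definition quote_machine (M : machine) : umachine :=
  (ntapes M, map (@quote_rule (ntapes M)) (rules M)).

Definition quote_tape (t : tape) : utape :=
  (map usym (left_cells t), (usym (scanned t), map usym (right_cells t))).

Definition quote_config k (c : config k) : uconfig :=
  (state c, (oracle_head c, (map quote_tape (tapes c), output c))).

(** The oracle is a finite string, continued by zeros. This is exact for runs of at most as many
    steps as the string is long, since the head advances by at most one cell per step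
    ([run_mkseq]). *)
Definition uapplicable (y : seq bool) (c : uconfig) (r : urule) : bool :=
  (r.1 == c.1) && ((r.2.1 == nth false y c.2.1) &&
  (r.2.2.1 == map (fun t : utape => t.2.1) c.2.2.1)).

Definition uact (a : nat * nat) (t : utape) : utape :=
  if a.2 == 0 then (behead t.1, (head 0 t.1, a.1 :: t.2.2)) else
  if a.2 == 1 then (t.1, (a.1, t.2.2)) else
  (a.1 :: t.1, (head 0 t.2.2, behead t.2.2)).

Definition ufire (c : uconfig) (r : urule) : uconfig :=
  (r.2.2.2.1,
   (if r.2.2.2.2.1 == 0 then c.2.1.-1 else
    if r.2.2.2.2.1 == 1 then c.2.1 else c.2.1.+1,
    ([seq uact (nth (0, 0) r.2.2.2.2.2.1 i) (nth ([::], (0, [::])) c.2.2.1 i)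
       | i <- iota 0 (size c.2.2.1)],
     if r.2.2.2.2.2.2 == 0 then c.2.2.2 else
     rcons c.2.2.2 (r.2.2.2.2.2.2 == 2)))).

Definition ustep (M : umachine) (y : seq bool) (c : uconfig) : uconfig :=
  if [seq r <- M.2 | uapplicable y c r] is r :: _ then ufire c r else c.

Definition urun (M : umachine) (y : seq bool) (s : nat) : uconfig :=
  iter s (ustep M y) (0, (0, (nseq M.1 ([::], (0, [::])), [::]))).

Definition uhalted (M : umachine) (y : seq bool) (c : uconfig) : bool :=
  ~~ has (uapplicable y c) M.2.

Section Quote.
Variables (M : machine) (y : seq bool).
Let X : oracle := nth false y.
Let k := ntapes M.
Implicit Type c : config k.

Lemma uapplicable_quote c r :
  uapplicable y (quote_config c) (quote_rule r) = @applicable M X c r.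
Proof.
rewrite /uapplicable /applicable /= -val_eqE /= -(inj_eq (inj_map usym_inj)).
congr [&& _, _ & (_ == _)].
rewrite -[in LHS](map_tnth_enum (tapes c)) -!map_comp.
by apply: eq_map.
Qed.

Lemma uact_quote a t : uact (usym a.1, umove a.2) (quote_tape t) =
  quote_tape (move_tape a.2 (write_tape a.1 t)).
Proof.
by case: a => a m; case: t => [l s r]; case: m => //=; [case: l|case: r].
Qed.

Lemma ufire_quote c r : ufire (quote_config c) (quote_rule r) =
  quote_config (@fire M c r).
Proof.
congr (_, (_, (_, _))) => /=.
- by case: (rule_omove r).
- rewrite size_map size_tuple -val_enum_ord -map_comp.
  rewrite -map_comp; apply: eq_map => i /=.
  rewrite (nth_map (None, Stay)) ?size_tuple // (nth_map blank_tape) ?size_tuple //.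
  by rewrite -!tnth_nth uact_quote.
- by case: (rule_out r) => [[]|].
Qed.

Lemma ustep_quote c : ustep (quote_machine M) y (quote_config c) =
  quote_config (@Defs.step M X c).
Proof.
rewrite /ustep /Defs.step /quote_machine /= filter_map.
rewrite (eq_filter (uapplicable_quote c)).
by case: [seq _ <- _ | _] => //= r _; apply: ufire_quote.
Qed.

Lemma urun_quote s : urun (quote_machine M) y s = quote_config (Defs.run M X s).
Proof.
rewrite /urun /run; elim: s => [|s IHs].
  congr (_, (_, (_, _))); rewrite /= -map_comp -[in LHS](size_enum_ord (ntapes M)).
  by elim: (enum _) => //= i t ->.
by rewrite !iterS IHs ustep_quote.
Qed.

Lemma uhalted_quote c : uhalted (quote_machine M) y (quote_config c) = @halted M X c.
Proof.
rewrite /uhalted /halted /quote_machine /= has_map; congr (~~ _).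
by apply: eq_has => r; apply: uapplicable_quote.
Qed.

End Quote.

Lemma comp_uapplicable : computable
  (fun p : seq bool * (uconfig * urule) => uapplicable p.1 p.2.1 p.2.2).
Proof. rewrite /uapplicable; comp. Qed.

Lemma comp_uact : computable (fun p : (nat * nat) * utape => uact p.1 p.2).
Proof. rewrite /uact; comp. Qed.

Lemma comp_ufire : computable (fun p : uconfig * urule => ufire p.1 p.2).
Proof. have := comp_uact; rewrite /ufire => ?; comp. Qed.

Lemma comp_ustep : computable
  (fun p : umachine * (seq bool * uconfig) => ustep p.1 p.2.1 p.2.2).
Proof.
have := comp_uapplicable; have := comp_ufire.
rewrite /ustep => ? ?; comp.
Qed.

Lemma comp_urun : computable
  (fun p : umachine * (seq bool * nat) => urun p.1 p.2.1 p.2.2).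
Proof. have := comp_ustep; rewrite /urun => ?; comp. Qed.

Lemma comp_uhalted : computable
  (fun p : umachine * (seq bool * uconfig) => uhalted p.1 p.2.1 p.2.2).
Proof. have := comp_uapplicable; rewrite /uhalted => ?; comp. Qed.

(** * Decoding of machine codes *)

Section Parsers.

Definition parser T := seq bool -> T * seq bool.

(** The codes are self-delimiting: whatever [z] follows is returned untouched, so that parsers can
    be chained. *)
Definition parses T U (p : parser U) (code : T -> seq bool) (u : T -> U) :=
  forall x z, p (code x ++ z) = (u x, z).

Definition parse_nat : parser nat := fun z =>
  (find negb z, drop (find negb z).+1 z).

Definition parse_bool : parser bool := fun z => (head false z, behead z).

Definition parse_pair T U (p : parser T) (q : parser U) : parser (T * U) :=
  fun z => (((p z).1, (q (p z).2).1), (q (p z).2).2).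

Definition parse_seq T (p : parser T) : parser (seq T) := fun z =>
  iter (parse_nat z).1 (fun a => (rcons a.1 (p a.2).1, (p a.2).2))
    ([::], (parse_nat z).2).

Lemma parse_natP : parses parse_nat nat_code id.
Proof.
move=> n z; rewrite /parse_nat /nat_code; elim: n => [|n] /=; first by rewrite drop0.
by case=> -> ->.
Qed.

Lemma parse_boolP : parses parse_bool (fun b => [:: b]) id.
Proof. by []. Qed.

Lemma parse_pair_cat T T' U (p : parser T') (q : parser U) c (t : T -> T')
    x w z b z' : parses p c t -> q (w ++ z) = (b, z') ->
  parse_pair p q ((c x ++ w) ++ z) = ((t x, b), z').
Proof. by move=> pP; rewrite /parse_pair -catA pP /= => ->. Qed.

Lemma parse_seqP T U (p : parser U) c (t : T -> U) :
  parses p c t -> parses (parse_seq p) (seq_code c) (map t).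
Proof.
move=> pP s z; rewrite /parse_seq /seq_code -catA parse_natP /=.
rewrite -[map t s]cat0s; elim: s [::] => [|x s IHs] acc; first by rewrite cats0.
by rewrite iterSr /= -catA pP /= IHs cat_rcons.
Qed.

Lemma comp_parse_nat : computable parse_nat.
Proof. rewrite /parse_nat; comp. Qed.

Lemma comp_parse_bool : computable parse_bool.
Proof. rewrite /parse_bool; comp. Qed.

Lemma comp_parse_pair `{Coding A, Coding B} (p : parser A) (q : parser B) :
  computable p -> computable q -> computable (parse_pair p q).
Proof. rewrite /parse_pair => cp cq; comp. Qed.

Lemma comp_parse_seq `{Coding A} (p : parser A) :
  computable p -> computable (parse_seq p).
Proof. have := comp_parse_nat; rewrite /parse_seq => cn cp; comp. Qed.

Definition parse_rule : parser urule :=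
  parse_pair parse_nat (parse_pair parse_bool (parse_pair (parse_seq parse_nat)
    (parse_pair parse_nat (parse_pair parse_nat
       (parse_pair (parse_seq (parse_pair parse_nat parse_nat)) parse_nat))))).

Definition parse_machine : parser umachine :=
  parse_pair parse_nat (parse_seq parse_rule).

Lemma comp_parse_machine : computable parse_machine.
Proof.
by do !(apply: comp_parse_pair || apply: comp_parse_seq || apply: comp_parse_nat ||
        apply: comp_parse_bool).
Qed.

Lemma parse_symP : parses parse_nat optbool_code usym.
Proof. by move=> [[]|] z; apply: parse_natP. Qed.

Lemma parse_moveP : parses parse_nat move_code umove.
Proof. by move=> [] z; apply: parse_natP. Qed.

Lemma parse_ruleP k : parses parse_rule (@rule_code k) (@quote_rule k).
Proof.
have workP : parses (parse_pair parse_nat parse_nat)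
    (fun a : symbol * move => optbool_code a.1 ++ move_code a.2)
    (fun a => (usym a.1, umove a.2)).
  by move=> a w; apply: parse_pair_cat parse_symP (parse_moveP _ _).
move=> r z; apply: parse_pair_cat parse_natP _; apply: parse_pair_cat parse_boolP _.
apply: parse_pair_cat (parse_seqP parse_symP) _; apply: parse_pair_cat parse_natP _.
apply: parse_pair_cat parse_moveP _.
exact: parse_pair_cat (parse_seqP workP) (parse_symP _ _).
Qed.

Lemma parse_machineP : parses parse_machine machine_code quote_machine.
Proof.
move=> M z; apply: parse_pair_cat parse_natP _.
exact: (parse_seqP (@parse_ruleP _)).
Qed.

End Parsers.

(** * Uniform simulation of the machines in the given list *)

Section Universal.
Variables (L : nat -> machine) (hL : effective_list L).

Lemma with_input_no_oracle n : with_input n no_oracle = nth false (nat_code n).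
Proof.
apply: funext => i; rewrite /with_input /cat_oracle.
by case: ltnP => // h; rewrite nth_default.
Qed.

Lemma halted_run M X s s' : halted X (Defs.run M X s) -> s <= s' ->
  Defs.run M X s' = Defs.run M X s.
Proof.
move=> h /subnK <-; rewrite /run iterD -/(Defs.run M X s).
elim: (s' - s) => // n; rewrite iterS => ->.
rewrite /Defs.step; case E: [seq _ <- _ | _] => [|r t] //.
have : has (applicable X (Defs.run M X s)) (rules M).
  by rewrite has_count -size_filter E.
by rewrite (negbTE h).
Qed.

(** The list is effective through a machine that prints [machine_code (L e)]. Its run is simulated
    until it halts, and the printed code is parsed. *)
Lemma comp_quote : computable (fun e => quote_machine (L e)).
Proof.
have [_ [M ME]] := hL.
have [U UE] : exists U, U = quote_machine M by exists (quote_machine M).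
have run_code e s : urun U (nat_code e) s =
    quote_config (Defs.run M (with_input e no_oracle) s).
  by rewrite UE urun_quote with_input_no_oracle.
pose P (p : nat * nat) := uhalted U (nat_code p.1) (urun U (nat_code p.1) p.2).
pose G (p : nat * nat) := (parse_machine (urun U (nat_code p.1) p.2).2.2.2).1.
have cn : computable nat_code by rewrite /nat_code; comp.
have [P' cP P'E] : computable (fun p => ~~ P p).
  have := comp_uhalted; have := comp_urun; rewrite /P => ? ?; comp.
have [G' cG G'E] : computable G.
  have := comp_parse_machine; have := comp_urun; rewrite /G => ? ?; comp.
have haltP e : exists s, P (e, s).
  have [s [h _]] := ME e; exists s.
  by rewrite /P /= run_code UE uhalted_quote -with_input_no_oracle.
exists (fun e => encode (quote_machine (L e))) => //.
apply: (computable_search cP cG) => [e|e s].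
  have [s Ps] := haltP e; exists s.
  by rewrite [LHS](P'E (e, s)) /= Ps.
rewrite (P'E (e, s)) => /eqP; rewrite eqb0 negbK /P /= => h.
rewrite [LHS](G'E (e, s)); congr encode.
have -> : G (e, s) = (parse_machine (output (Defs.run M (with_input e no_oracle) s))).1.
  by rewrite /G run_code.
have [s' [h' oE]] := ME e.
rewrite run_code UE uhalted_quote -with_input_no_oracle in h.
have -> : output (Defs.run M (with_input e no_oracle) s) = machine_code (L e).
  rewrite -oE /output_at; case/orP: (leq_total s s') => le.
    by rewrite (halted_run h le).
  by rewrite (halted_run h' le).
by rewrite -[machine_code _]cats0 parse_machineP.
Qed.

Lemma comp_output : computable (fun p : nat * (seq bool * nat) =>
  output_at (L p.1) (nth false p.2.1) p.2.2).
Proof.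
have := comp_quote; have := comp_urun; set Q := fun e => quote_machine _ => ? ?.
apply: (comp_ext (f := fun p : nat * (seq bool * nat) =>
  (urun (Q p.1) p.2.1 p.2.2).2.2.2)) => [p|]; first by rewrite urun_quote.
comp.
Qed.

Lemma comp_halted : computable (fun p : nat * (seq bool * nat) =>
  halted (nth false p.2.1) (Defs.run (L p.1) (nth false p.2.1) p.2.2)).
Proof.
have := comp_quote; have := comp_urun; have := comp_uhalted.
set Q := fun e => quote_machine _ => ? ? ?.
apply: (comp_ext (f := fun p : nat * (seq bool * nat) =>
  uhalted (Q p.1) p.2.1 (urun (Q p.1) p.2.1 p.2.2))).
  by move=> p; rewrite urun_quote uhalted_quote.
comp.
Qed.

End Universal.

(** * Machines reacting to the prefixes of the oracle *)

Lemma iota0S s : iota 0 s.+1 = iota 0 s ++ [:: s].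
Proof. by rewrite -addn1 iotaD. Qed.

Lemma flatten_map_nil (S : eqType) (T : Type) (f : S -> seq T) s :
  {in s, forall i, f i = [::]} -> flatten (map f s) = [::].
Proof.
elim: s => //= i s IHs h; rewrite h ?mem_head //= IHs // => j js.
by apply: h; rewrite inE js orbT.
Qed.

Section Reactor.
Variables (E T F K B : nat -> prog).

(* [T], [F] test whether the first bit to be written is 1, is 0. *)
Definition pwrite :=
  Seq (pcopy (0 + 2)) (Seq (T (0 + 3)) (Seq (While (0 + 3) (Seq (Dec (0 + 3)) (Out true)))
  (Seq (pcopy (0 + 2)) (Seq (F (0 + 3)) (Seq (While (0 + 3) (Seq (Dec (0 + 3)) (Out false)))
    (B (0 + 2))))))).

(** Register 0 is the flag that keeps the loop going; register 1 holds the code of the prefix read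
    so far, reversed so that a new bit is put at the head; the registers from 2 on are scratch. *)
Definition pturn :=
  Seq (Read (0 + 2)) (Seq (ppair (0 + 1)) (Seq (Inc (0 + 1))
  (Seq (pcopy (0 + 1)) (Seq (E (0 + 2)) (Seq (While (0 + 2) pwrite)
  (Seq (pcopy (0 + 1)) (Seq (K (0 + 2))
    (While (0 + 2) (Seq (Dec (0 + 2)) (Dec (0 + 0))))))))))).

Definition preactor := Seq (Inc (0 + 0)) (While (0 + 0) pturn).

Variable g : seq bool -> seq bool * bool.
Hypotheses
  (EP : forall b X s, execs X (E b) b [:: encode (rev s)] [:: encode (g s).1])
  (TP : forall b X (s : seq bool), execs X (T b) b [:: encode s] [:: head false s : nat])
  (FP : forall b X (s : seq bool), execs X (F b) b [:: encode s] [:: ~~ head true s : nat])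
  (BP : forall b X (s : seq bool), execs X (B b) b [:: encode s] [:: encode (behead s)])
  (KP : forall b X s, execs X (K b) b [:: encode (rev s)] [:: (g s).2 : nat]).

Variable X : oracle.
Let st l pos w := PState (window 0 (fun=> 0) l) pos w.

Lemma exec_out (c d : bool) f a e pos w :
  exec X (While (0 + 3) (Seq (Dec (0 + 3)) (Out d)))
    (st [:: f; a; e; c : nat] pos w) (st [:: f; a; e; 0] pos (w ++ nseq c d)).
Proof.
case: c; last by rewrite cats0; apply: EWhile0.
rewrite cats1; apply: EWhileS => //; last exact: EWhile0.
apply: (ESeq (st2 := st [:: f; a; e; 0] pos w)).
  exact: (@execs_dec _ 0 3 [:: f; a; e; 1]).
exact: EOut.
Qed.

Lemma exec_write f a (s : seq bool) pos w :
  exec X (While (0 + 2) pwrite) (st [:: f; a; encode s] pos w)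
    (st [:: f; a; 0] pos (w ++ s)).
Proof.
elim: s w => [|x s IHs] w; first by rewrite cats0; apply: EWhile0.
have frame2 p l l' : execs X (p (0 + 2)) (0 + 2) l l' -> forall pos w,
    exec X (p (0 + 2)) (st [:: f, a & l] pos w) (st [:: f, a & l'] pos w).
  by move=> h ? ?; apply: (@execs_frame _ _ 0 [:: f; a]).
have frame3 p y l l' : execs X (p (0 + 3)) (0 + 3) l l' -> forall pos w,
    exec X (p (0 + 3)) (st [:: f, a, y & l] pos w) (st [:: f, a, y & l'] pos w).
  by move=> h ? ?; apply: (@execs_frame _ _ 0 [:: f; a; y]).
have pad y pos' w' : st [:: f; a; y; 0] pos' w' = st [:: f; a; y] pos' w'.
  by rewrite /st (@window_pad _ _ [:: f; a; y] 1).
have -> : w ++ x :: s = (w ++ [:: x]) ++ s by rewrite -catA.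
apply: EWhileS (IHs _) => //.
apply: ESeq (frame2 _ _ _ (pcopyE _ _ _) _ _) _.
apply: ESeq (frame3 _ _ _ _ (TP _ _ (x :: s)) _ _) _.
apply: ESeq (exec_out _ _ _ _ _ _ _) _; rewrite pad.
apply: ESeq (frame2 _ _ _ (pcopyE _ _ _) _ _) _.
apply: ESeq (frame3 _ _ _ _ (FP _ _ (x :: s)) _ _) _.
apply: ESeq (exec_out _ _ _ _ _ _ _) _; rewrite pad.
have -> : (w ++ nseq x true) ++ nseq (~~ x) false = w ++ [:: x].
  by case: x; rewrite ?cats0.
by apply: frame2; apply: BP (x :: s).
Qed.

Definition written_upto s := flatten [seq (g (mkseq X i.+1)).1 | i <- iota 0 s].
Definition active s := ~~ has (fun i => (g (mkseq X i.+1)).2) (iota 0 s).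
Definition rstate s :=
  st [:: active s : nat; encode (rev (mkseq X s))] s (written_upto s).

Lemma exec_turn s : active s -> exec X pturn (rstate s) (rstate s.+1).
Proof.
move=> act.
have frame1 p f l l' : execs X (p (0 + 1)) (0 + 1) l l' -> forall pos w,
    exec X (p (0 + 1)) (st (f :: l) pos w) (st (f :: l') pos w).
  by move=> h ? ?; apply: (@execs_frame _ _ 0 [:: f]).
have frame2 p f a l l' : execs X (p (0 + 2)) (0 + 2) l l' -> forall pos w,
    exec X (p (0 + 2)) (st [:: f, a & l] pos w) (st [:: f, a & l'] pos w).
  by move=> h ? ?; apply: (@execs_frame _ _ 0 [:: f; a]).
have pad f a pos' w' : st [:: f; a; 0] pos' w' = st [:: f; a] pos' w'.
  by rewrite /st (@window_pad _ _ [:: f; a] 1).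
rewrite {1}/rstate act; set a := encode (rev _).
apply: (ESeq (st2 := st [:: 1; a; X s : nat] s.+1 (written_upto s))).
  have := ERead X (0 + 2) (st [:: true : nat; a] s (written_upto s)).
  by rewrite /pread /= upd_window window_nth addn0.
apply: ESeq (frame1 ppair _ _ _ (ppairE _ _ _ _) _ _) _.
apply: ESeq (@execs_inc _ 0 1 _ _ _ _) _ => /=.
have -> : (cantor_pair (X s) a).+1 = encode (rev (mkseq X s.+1)).
  by rewrite mkseqS rev_rcons.
apply: ESeq (frame1 pcopy _ _ _ (pcopyE _ _ _) _ _) _.
apply: ESeq (frame2 E _ _ _ _ (EP _ _ _) _ _) _.
apply: ESeq (exec_write _ _ _ _ _) _; rewrite pad.
apply: ESeq (frame1 pcopy _ _ _ (pcopyE _ _ _) _ _) _.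
apply: ESeq (frame2 K _ _ _ _ (KP _ _ _) _ _) _.
rewrite /rstate /written_upto /active iota0S map_cat flatten_cat has_cat.
rewrite (negbTE act) /= orbF cats0 -pad.
case: (g _).2 => /=; last exact: EWhile0.
apply: EWhileS => //; last exact: EWhile0.
apply: ESeq (@execs_dec _ 0 2 [:: 1; _; 1] _ _ _ _) _ => //.
exact: (@execs_dec _ 0 0 [:: 1; _; 0]).
Qed.

Lemma reactor_start : exec X (Inc (0 + 0)) pstate0 (rstate 0).
Proof.
have -> : pstate0 = PState (window 0 (fun=> 0) [::]) 0 [::].
  by congr PState; apply: funext => i; rewrite /window /= nth_nil.
have -> : rstate 0 = PState (window 0 (fun=> 0) [:: 1]) 0 [::].
  by rewrite -(@window_pad _ _ [:: 1] 1).
exact: (@execs_inc X 0 0 [::]).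
Qed.

End Reactor.

(** The way back from [computable] to machines. The first clause describes infinite runs, including
    the fact that they have not halted at the times [t s]; in the second the flag is cleared and the
    loop is left. *)
Theorem reactor (g : seq bool -> seq bool * bool) : computable g ->
  exists M, forall X,
  ((forall s, active g X s) -> exists t : nat -> nat, (forall s, t s < t s.+1) /\
     forall s, output_at M X (t s) = written_upto g X s /\
               ~~ halted X (Defs.run M X (t s))) /\
  (forall s, active g X s -> ~~ active g X s.+1 ->
     exists T, halted X (Defs.run M X T) /\ output_at M X T = written_upto g X s.+1).
Proof.
move=> cg.
have [E' [E cE] EE] : computable (fun s => (g (rev s)).1) by comp.
have [K' [K cK] KE] : computable (fun s => (g (rev s)).2) by comp.
have [T' [T cT] TE] : computable (fun s : seq bool => head false s) by comp.
have [F' [F cF] FE] : computable (fun s : seq bool => ~~ head true s) by comp.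
have [B' [B cB] BE] : computable (fun s : seq bool => behead s) by comp.
have turn X s : active g X s -> exec X (pturn E T F K B) (rstate g X s) (rstate g X s.+1).
  apply: exec_turn => b Y u.
  - by rewrite -{2}(revK u) -EE; apply: cE.
  - by rewrite -[nat_of_bool _]TE; apply: cT.
  - by rewrite -[nat_of_bool _]FE; apply: cF.
  - by rewrite -BE; apply: cB.
  - by rewrite -{2}(revK u) -[nat_of_bool _]KE; apply: cK.
have regs_rstate X s : regs (rstate g X s) (0 + 0) = active g X s.
  by rewrite /= window_nth.
exists (program_machine (preactor E T F K B)) => X; split=> [act|s act nact].
  apply: (program_machine_loops (reactor_start g X)) => s; last exact: turn.
  by rewrite regs_rstate act.
have mono i j : i <= j -> active g X j -> active g X i.
  by move=> /subnKC <-; rewrite /active iotaD has_cat negb_or => /andP[].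
(* The derivation of the loop is built backwards from its exit, [i] being the number of turns that
   remain. *)
suff wE i : i <= s.+1 ->
    exec X (While (0 + 0) (pturn E T F K B)) (rstate g X (s.+1 - i)) (rstate g X s.+1).
  have := wE s.+1 (leqnn _); rewrite subnn => {}wE.
  exact: program_machine_halts (ESeq (reactor_start g X) wE).
elim: i => [|i IHi] lei.
  by rewrite subn0; apply: EWhile0; rewrite regs_rstate (negbTE nact).
have acti : active g X (s.+1 - i.+1) by apply: mono act; rewrite subSS leq_subr.
apply: EWhileS (turn _ _ acti) _; first by rewrite regs_rstate acti.
by rewrite subSS -subSn //; apply: IHi; apply: ltnW.
Qed.

Lemma mkseq_cat_oracle sigma X u :
  mkseq (cat_oracle sigma X) (size sigma + u) = sigma ++ mkseq X u.
Proof.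
rewrite /mkseq iotaD map_cat add0n -[in RHS](mkseq_nth false sigma); congr (_ ++ _).
  by apply/eq_in_map => i; rewrite mem_iota /cat_oracle add0n /= => ->.
rewrite -[size sigma]addn0 iotaDl -map_comp; apply: eq_map => i /=.
by rewrite /cat_oracle ltnNge leq_addr addKn.
Qed.

Lemma take_mkseq (X : oracle) n m : n <= m -> take n (mkseq X m) = mkseq X n.
Proof. by move=> le; rewrite /mkseq -map_take take_iota (minn_idPl le). Qed.

Lemma mkseq_cat_oracle_take sigma X u : u <= size sigma ->
  mkseq (cat_oracle sigma X) u = take u sigma.
Proof.
move=> le; rewrite -(take_mkseq (cat_oracle sigma X) le).
by rewrite -[size sigma]addn0 mkseq_cat_oracle cats0.
Qed.

(** * Computability relative to an oracle *)

Lemma parse_nat_input n A u :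
  parse_nat (mkseq (with_input n A) (n.+1 + u)) = (n, mkseq A u).
Proof.
have {1}-> : n.+1 = size (nat_code n) by rewrite size_rcons size_nseq.
by rewrite /with_input mkseq_cat_oracle parse_natP.
Qed.

(** Since [find] returns the length when there is no zero, this is the test that the input 1^n 0 has
    been read completely. *)
Lemma size_mkseq_input n A s : (find negb (mkseq (with_input n A) s) < s) = (n < s).
Proof.
case: (ltnP n s) => [lt|le].
  have := parse_nat_input n A (s - n.+1); rewrite subnKC // => /(congr1 fst) /= ->.
  exact: lt.
rewrite /with_input mkseq_cat_oracle_take; last first.
  by rewrite size_rcons size_nseq leqW.
rewrite /nat_code -cats1 takel_cat ?size_nseq // take_nseq //.
apply/negbTE; rewrite -leqNgt.
by elim: (s) => //= s' IHs; rewrite ltnS.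
Qed.

(** The answer [None] asks for a longer piece of the oracle; [Some w] writes [w] and halts. *)
Definition input_reaction (G : nat * seq bool -> option (seq bool)) (z : seq bool) :
    seq bool * bool :=
  if find negb z < size z then
    if G (parse_nat z) is Some w then (w, true) else ([::], false)
  else ([::], false).

Lemma comp_input_reaction G : computable G -> computable (input_reaction G).
Proof. have := comp_parse_nat; rewrite /input_reaction => ? ?; comp. Qed.

Lemma input_reactionE G n A s : input_reaction G (mkseq (with_input n A) s) =
  if n < s then
    if G (n, mkseq A (s - n.+1)) is Some w then (w, true) else ([::], false)
  else ([::], false).
Proof.
rewrite /input_reaction size_mkseq size_mkseq_input; case: ifP => // lt.
by rewrite -{1}(subnKC lt) parse_nat_input.
Qed.

Lemma input_active G n A u : (forall v, v < u -> G (n, mkseq A v) = None) ->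
  active (input_reaction G) (with_input n A) (n + u) /\
  written_upto (input_reaction G) (with_input n A) (n + u) = [::].
Proof.
move=> Gu.
have noneE i : i < n + u ->
    input_reaction G (mkseq (with_input n A) i.+1) = ([::], false).
  move=> lti; rewrite input_reactionE; case: ifP => // lt.
  by rewrite Gu // subSS ltn_subLR.
split; first by apply/hasPn => i; rewrite mem_iota add0n => /= /noneE ->.
by apply: flatten_map_nil => i; rewrite mem_iota add0n => /= /noneE ->.
Qed.

(** The functional [G] is consulted on longer and longer prefixes of [A], and its first answer is
    the result; [u] is the use of the computation. *)
Lemma computable_in_limit A (f : nat -> seq bool) G : computable G ->
  (forall n, exists2 u, G (n, mkseq A u) = Some (f n) &
     forall v, v < u -> G (n, mkseq A v) = None) ->
  computable_in A f.
Proof.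
move=> cG Gf; have [M ME] := reactor (comp_input_reaction cG).
exists M => n; have [u Gu ltu] := Gf n; have [_ haltM] := ME (with_input n A).
have [act wE] := input_active ltu.
have lastE : input_reaction G (mkseq (with_input n A) (n + u).+1) = (f n, true).
  by rewrite input_reactionE ltnS leq_addr subSS addKn Gu.
have [|T [hT oT]] := haltM _ act.
  by rewrite /active iota0S has_cat /= lastE orbT.
exists T; split=> //; rewrite oT /written_upto iota0S map_cat flatten_cat.
by rewrite -/(written_upto _ _ _) wE /= lastE /= cats0.
Qed.

Lemma computable_in_pure A (f : nat -> seq bool) : computable f -> computable_in A f.
Proof.
move=> cf; apply: (computable_in_limit (G := fun p => Some (f p.1))); first comp.
by move=> n; exists 0.
Qed.

(** Every Sigma_1 set is the halting set of a machine: the number of oracle bits read after the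
    input is the candidate [s]. *)
Lemma halting_search (P : nat * nat -> bool) : computable P ->
  exists M, forall n, halts M (with_input n no_oracle) <-> exists s, P (n, s).
Proof.
move=> cP.
pose G (p : nat * seq bool) := if P (p.1, size p.2) then Some [::] else None : option (seq bool).
have cG : computable G by rewrite /G; comp.
have [M ME] := reactor (comp_input_reaction cG); exists M => n.
have [neverM haltM] := ME (with_input n no_oracle); split; last first.
  move=> exP; case: (ex_minnP exP) => u Pu minu.
  have Gu v : v < u -> G (n, mkseq no_oracle v) = None.
    rewrite /G /= size_mkseq ltnNge; case: ifP => // /minu -> //.
  have [act _] := input_active Gu.
  have [|T [hT _]] := haltM _ act; last by exists T.
  rewrite /active iota0S has_cat /= input_reactionE ltnS leq_addr.
  by rewrite subSS addKn /G /= size_mkseq Pu orbT.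
move=> [T hT]; apply: contrapT => nP.
(* Without a witness every stage is active, so the machine is still running at arbitrarily late
   times, against the halt at [T]. *)
have act s : active (input_reaction G) (with_input n no_oracle) s.
  apply/hasPn => i _; rewrite input_reactionE; case: ifP => // _.
  by rewrite /G /=; case: ifP => // Ps; case: nP; exists (size (mkseq no_oracle (i.+1 - n.+1))).
have [t [t_inc tE]] := neverM act.
have leT s : s <= t s by elim: s => // s IHs; apply: leq_ltn_trans (t_inc s).
by have [_] := tE T; rewrite (halted_run hT (leT T)) hT.
Qed.

(** * Runs and outputs *)

Lemma oracle_head_run M X s : oracle_head (Defs.run M X s) <= s.
Proof.
elim: s => // s IHs; rewrite /run iterS -/(Defs.run M X s) /Defs.step.
case: [seq _ <- _ | _] => [|r _] /=; first exact: leqW.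
by case: (rule_omove r) => /=; lia.
Qed.

Lemma eq_run M X Y s : (forall i, i < s -> X i = Y i) -> Defs.run M X s = Defs.run M Y s.
Proof.
elim: s => // s IHs XY; rewrite /run !iterS -!/(Defs.run M _ s) IHs => [|i lti].
  rewrite /Defs.step; congr (if _ is r :: _ then _ else _).
  by apply: eq_filter => r; rewrite /applicable XY // ltnS oracle_head_run.
by apply: XY; apply: ltnW.
Qed.

Lemma run_mkseq M X s u : s <= u ->
  Defs.run M (nth false (mkseq X u)) s = Defs.run M X s.
Proof.
by move=> le; apply: eq_run => i lti; rewrite nth_mkseq // (leq_trans lti).
Qed.

Lemma output_step M X s : exists2 z, size z <= 1 &
  output_at M X s.+1 = output_at M X s ++ z.
Proof.
rewrite /output_at /run iterS -/(Defs.run M X s) /Defs.step.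
case: [seq _ <- _ | _] => [|r _] /=; first by exists [::]; rewrite ?cats0.
by case: (rule_out r) => [b|]; [exists [:: b]; rewrite ?cats1|exists [::]; rewrite ?cats0].
Qed.

Lemma output_prefix M X s s' : s <= s' ->
  exists z, output_at M X s' = output_at M X s ++ z.
Proof.
move=> /subnK <-; elim: (s' - s) => [|n [z IHn]]; first by exists [::]; rewrite cats0.
rewrite addSn; have [w _ ->] := output_step M X (n + s).
by rewrite IHn; exists (z ++ w); rewrite catA.
Qed.

Definition ones (w : seq bool) := count id w.

Lemma all_false_nseq (z : seq bool) : count id z = 0 -> z = nseq (size z) false.
Proof. by elim: z => //= -[] //= z IHz /IHz {1}->. Qed.

Lemma writes_eventually_zeroE M X : writes_eventually_zero M X <->
  (forall n, exists s, n <= size (output_at M X s)) /\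
  (exists m, forall s, ones (output_at M X s) <= m).
Proof.
split=> [[rho [wE inf]]|[inf [m bdd]]].
  split=> //; exists (size rho) => s; rewrite wE.
  case: (leqP (size (output_at M X s)) (size rho)) => [le|/ltnW/subnKC <-].
    rewrite mkseq_cat_oracle_take //; apply: leq_trans (count_size _ _) _.
    by rewrite size_take_min geq_minr.
  rewrite mkseq_cat_oracle /ones count_cat.
  have -> : count id (mkseq (fun=> false) (size (output_at M X s) - size rho)) = 0.
    by rewrite /mkseq; elim: (iota _ _).
  by rewrite addn0 count_size.
(* The string [rho] is the output at a stage where the number of ones is maximal; all later bits are
   zeros. *)
have exm : exists k, `[< exists s, ones (output_at M X s) = k >].
  by exists (ones (output_at M X 0)); apply/asboolP; exists 0.
have lem k : `[< exists s, ones (output_at M X s) = k >] -> k <= m.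
  by move=> /asboolP[s <-].
case: (ex_maxnP exm lem) => k /asboolP[s0 s0E] maxk.
exists (output_at M X s0); split=> // s.
case: (leqP s s0) => [le|/ltnW le].
  have [z zE] := output_prefix M X le.
  by rewrite mkseq_cat_oracle_take zE ?size_cat ?leq_addr // take_size_cat.
have [z zE] := output_prefix M X le; rewrite zE size_cat mkseq_cat_oracle.
congr (_ ++ _); rewrite [LHS]all_false_nseq.
  by rewrite /mkseq; elim: (size z) 0 => //= n IHn i; rewrite -(IHn i.+1).
have := maxk (ones (output_at M X s)); rewrite {2}zE /ones count_cat -/(ones _).
rewrite -[count id (output_at M X s0)]/(ones _) s0E.
by move=> /(_ (asboolT (ex_intro _ s erefl))); lia.
Qed.

(** * Binary digits and measure *)

Import Order.TTheory GRing.Theory Num.Theory numFieldNormedType.Exports.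
Local Open Scope classical_set_scope.
Local Open Scope ring_scope.

(** The [s] binary digits of [j], most significant first: the common prefix of the reals between j /
    2^s and (j + 1) / 2^s. *)
Definition bits (s j : nat) : seq bool := mkseq (fun n => odd (j %/ 2 ^ (s - n.+1))) s.

Section Digits.
Variable R : realType.
Implicit Types (x y : R) (s j : nat) (Q : seq bool -> bool).

Lemma truncn_divn y d : 0 <= y -> (0 < d)%N ->
  Num.truncn (y / d%:R) = (Num.truncn y %/ d)%N.
Proof.
move=> y0 d0; apply/eqP; rewrite truncn_eq ?divr_ge0 //.
have dR : 0 < d%:R :> R by rewrite ltr0n.
rewrite ler_pdivlMr // ltr_pdivrMr // -!natrM.
rewrite -truncn_ge_nat // -truncn_lt_nat //.
by rewrite leq_trunc_div /= ltn_ceil.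
Qed.

Lemma mkseq_digits x s : 0 <= x ->
  mkseq (binary_digits x) s = bits s (Num.truncn (x * 2 ^+ s)).
Proof.
move=> x0; apply/eq_in_map => i; rewrite mem_iota add0n => /= lti.
rewrite /binary_digits -truncn_divn ?expn_gt0 ?mulr_ge0 ?exprn_ge0 //.
congr (odd (Num.truncn _)); rewrite natrX -{1}(subnKC lti) exprD mulrA mulfK //.
Qed.

Definition dyadic s j : set R := `[j%:R / 2 ^+ s, j.+1%:R / 2 ^+ s[.

Lemma dyadicP s j x : 0 <= x -> dyadic s j x <-> Num.truncn (x * 2 ^+ s) = j.
Proof.
move=> x0; have e0 : 0 < 2 ^+ s :> R by rewrite exprn_gt0.
rewrite /dyadic /= in_itv /= ler_pdivrMr // ltr_pdivlMr //.
rewrite -truncn_eq ?mulr_ge0 ?exprn_ge0 //.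
by split=> /eqP.
Qed.

Lemma measurable_dyadic s j : measurable (dyadic s j).
Proof. exact: measurable_itv. Qed.

Lemma dyadic_measure s j : lebesgue_measure (dyadic s j) = ((2 ^+ s)^-1 : R)%:E.
Proof.
rewrite /dyadic lebesgue_measure_itv /= lte_fin.
have e0 : 0 < (2 ^+ s)^-1 :> R by rewrite invr_gt0 exprn_gt0.
by rewrite ltr_pM2r // ltr_nat leqnn -EFinB -mulrBl -natrB // subSnn mul1r.
Qed.

Definition cylinder s Q : set R :=
  [set x | 0 <= x < 1 /\ Q (mkseq (binary_digits x) s)].

Definition cylinder_piece s Q j : set R := if Q (bits s j) then dyadic s j else set0.

Lemma measurable_cylinder_piece s Q j : measurable (cylinder_piece s Q j).
Proof. by rewrite /cylinder_piece; case: ifP => // _; apply: measurable_dyadic. Qed.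

Lemma cylinderE s Q :
  cylinder s Q = \big[setU/set0]_(j < 2 ^ s) cylinder_piece s Q j.
Proof.
have e0 : 0 < 2 ^+ s :> R by rewrite exprn_gt0.
rewrite -bigcup_mkord /cylinder_piece; apply/seteqP; split=> x.
  move=> [/andP[x0 x1]]; rewrite mkseq_digits // => Qx.
  exists (Num.truncn (x * 2 ^+ s)); last by rewrite Qx; apply/dyadicP.
  rewrite /= truncn_lt_nat ?mulr_ge0 ?exprn_ge0 //.
  by rewrite natrX gtr_pMl.
move=> [j /= ltj]; case: ifP => // Qj xj; have x0 : 0 <= x.
  move: xj; rewrite /dyadic /= in_itv /= => /andP[le _].
  by apply: le_trans le; rewrite divr_ge0 // exprn_ge0.
have jE := (dyadicP s j x0).1 xj; rewrite /cylinder /= x0 mkseq_digits // jE Qj.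
split=> //=; move: ltj; rewrite -jE truncn_lt_nat ?mulr_ge0 ?exprn_ge0 //.
by rewrite natrX gtr_pMl.
Qed.

Lemma measurable_cylinder s Q : measurable (cylinder s Q).
Proof.
rewrite cylinderE; apply: bigsetU_measurable => j _; exact: measurable_cylinder_piece.
Qed.

Lemma cylinder_measure s Q : lebesgue_measure (cylinder s Q) =
  ((count (fun j => Q (bits s j)) (iota 0 (2 ^ s)))%:R / 2 ^+ s : R)%:E.
Proof.
rewrite cylinderE.
rewrite (measure_bigsetU lebesgue_measure (F := cylinder_piece s Q)); last 2 first.
- by move=> j; apply: measurable_cylinder_piece.
- apply/trivIsetP => i j _ _ ij; rewrite -subset0 /cylinder_piece => x.
  case: ifP => _ // [] xi; case: ifP => _ // xj.
  have x0 : 0 <= x.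
    move: xi; rewrite /dyadic /= in_itv /= => /andP[le _].
    by apply: le_trans le; rewrite divr_ge0 // exprn_ge0.
  move: ij; rewrite -((dyadicP s i x0).1 xi) -((dyadicP s j x0).1 xj).
  by rewrite eqxx.
rewrite -(big_mkord xpredT (fun j => lebesgue_measure (cylinder_piece s Q j))) /index_iota subn0.
elim: (iota 0 (2 ^ s)%N) => [|j t IHt]; first by rewrite big_nil mul0r.
rewrite big_cons IHt /= natrD mulrDl EFinD; congr (_ + _)%E.
rewrite /cylinder_piece; case: (Q _); last by rewrite measure0 mul0r.
by rewrite dyadic_measure mul1r.
Qed.

End Digits.

Arguments cylinder : clear implicits.

Definition reals_of (R : realType) (P : set oracle) : set R :=
  [set x : R | 0 <= x < 1 /\ P (binary_digits x)].
Arguments reals_of : clear implicits.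

Lemma reals_of_measure_lty (R : realType) (P : set oracle) :
  measurable (reals_of R P) -> (lebesgue_measure (reals_of R P) <= 1)%E.
Proof.
move=> mP; have -> : 1%E = lebesgue_measure (`[0, 1[%classic : set R).
  by rewrite lebesgue_measure_itv /= lte_fin ltr01 oppr0 adde0.
apply: le_measure; rewrite ?inE //.
by move=> x [x01 _]; rewrite /= in_itv.
Qed.

Definition sigma2 (Q : nat -> seq bool -> bool) : set oracle :=
  [set X | exists m, forall s, Q m (mkseq X s)].

(** * Approximation of the measure of a Sigma_2 class *)

Section Sigma2.
Variables (R : realType) (Q : nat -> seq bool -> bool).
Hypotheses
  (Qanti : forall m (X : oracle) s, Q m (mkseq X s.+1) -> Q m (mkseq X s))
  (Qmono : forall m y, Q m y -> Q m.+1 y).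

Let level m : set R := \bigcap_s cylinder R s (Q m).

Lemma measurable_level m : measurable (level m).
Proof. by apply: bigcap_measurable => [|s _]; [exists 0%N|apply: measurable_cylinder]. Qed.

Lemma reals_of_sigma2 : reals_of R (sigma2 Q) = \bigcup_m level m.
Proof.
apply/seteqP; split=> x.
  by move=> [x01 [m Qm]]; exists m => // s _; split.
by move=> [m _ lx]; split; [have [] := lx 0%N I|exists m => s; have [] := lx s I].
Qed.

Lemma measurable_sigma2 : measurable (reals_of R (sigma2 Q)).
Proof. by rewrite reals_of_sigma2; apply: bigcup_measurable => m _; apply: measurable_level. Qed.

Definition alive m s := count (fun j => Q m (bits s j)) (iota 0 (2 ^ s)).

(** Continuity from above: by [Qanti] the cylinders decrease with the length [s], and their
    intersection is the level. *)
Lemma level_measure_cvg m :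
  ((alive m s)%:R / 2 ^+ s : R)%:E @[s --> \oo] --> lebesgue_measure (level m).
Proof.
rewrite (_ : (fun s => _) = lebesgue_measure \o (fun s => cylinder R s (Q m))).
  apply: nonincreasing_cvg_mu.
  - by rewrite /= cylinder_measure ltry.
  - by move=> s; apply: measurable_cylinder.
  - exact: measurable_level.
  apply/nonincreasing_seqP => s; apply/subsetPset => x [x01 Qx].
  by split=> //; apply: Qanti.
by apply: funext => s /=; rewrite cylinder_measure.
Qed.

Definition level_prob m : R := fine (lebesgue_measure (level m)).

Lemma level_subset m : level m `<=` reals_of R (sigma2 Q).
Proof. by rewrite reals_of_sigma2 => x lx; exists m. Qed.

Lemma level_measureE m : lebesgue_measure (level m) = (level_prob m)%:E.
Proof.
rewrite fineK // ge0_fin_numE ?measure_ge0 //.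
apply: (@le_lt_trans _ _ 1%E); last exact: ltry.
apply: le_trans (reals_of_measure_lty measurable_sigma2).
apply: le_measure; rewrite ?inE; [exact: measurable_level|exact: measurable_sigma2|].
exact: level_subset.
Qed.

Lemma alive_cvg m : (alive m s)%:R / 2 ^+ s @[s --> \oo] --> level_prob m.
Proof.
have h := @level_measure_cvg m; rewrite level_measureE in h.
by move/fine_cvg: h.
Qed.

Lemma alive_ge m s : level_prob m <= (alive m s)%:R / 2 ^+ s.
Proof.
rewrite -lee_fin -level_measureE -cylinder_measure.
apply: le_measure; rewrite ?inE; [exact: measurable_level|exact: measurable_cylinder|].
by move=> x; apply.
Qed.

(** The approximations decrease to the measure, so a lower bound for the measure is one for each of
    them. For rational [a] and computable [Q] this makes it a Pi_1 statement. *)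
Lemma level_prob_ge m a : (forall s, a <= (alive m s)%:R / 2 ^+ s) <-> a <= level_prob m.
Proof.
split=> [ge_a|ge_a s]; last exact: le_trans (alive_ge m s).
have h := @alive_cvg m; rewrite -(cvg_lim _ h) //.
apply: limr_ge; first by apply/cvg_ex; exists (level_prob m).
exact: nearW.
Qed.

Lemma level_prob_ge0 m : 0 <= level_prob m.
Proof. by rewrite fine_ge0 ?measure_ge0. Qed.

Lemma level_prob_le1 m : level_prob m <= 1.
Proof.
rewrite (le_trans (alive_ge m 0)) // expr0 divr1 /alive.
by rewrite -[leRHS]/(1%:R) ler_nat (leq_trans (count_size _ _)).
Qed.

Lemma level_prob_cvg :
  level_prob m @[m --> \oo] --> fine (lebesgue_measure (reals_of R (sigma2 Q))).
Proof.
apply: fine_cvg; rewrite fineK; last first.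
  rewrite ge0_fin_numE ?measure_ge0 //.
  exact: le_lt_trans (reals_of_measure_lty measurable_sigma2) (ltry _).
rewrite reals_of_sigma2; apply: nondecreasing_cvg_mu.
- exact: measurable_level.
- by rewrite -reals_of_sigma2; apply: measurable_sigma2.
apply/nondecreasing_seqP => m; apply/subsetPset => x lx s _.
by have [x01 Qx] := lx s I; split=> //; apply: Qmono.
Qed.

Lemma level_prob_mono m : level_prob m <= level_prob m.+1.
Proof.
apply/level_prob_ge => s; rewrite (le_trans (alive_ge m s)) //.
rewrite ler_pM2r ?invr_gt0 ?exprn_gt0 // ler_nat.
by apply: sub_count => j; apply: Qmono.
Qed.

Definition floor_prob m := Num.truncn (2 ^+ m * level_prob m).

(** Rounding down on a grid twice as fine cannot give less, and [level_prob] grows with [m]; this is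
    what makes the approximations nondecreasing. *)
Lemma floor_prob_mono m : (2 * floor_prob m <= floor_prob m.+1)%N.
Proof.
have e0 n : 0 <= 2 ^+ n * level_prob n by rewrite mulr_ge0 ?exprn_ge0 ?level_prob_ge0.
rewrite /floor_prob truncn_ge_nat // natrM exprS -mulrA ler_pM2l //.
apply: (@le_trans _ _ (2 ^+ m * level_prob m)); first by rewrite truncn_le.
by rewrite ler_pM2l ?exprn_gt0 // level_prob_mono.
Qed.

(** A truncation counts the positive integers [k.+1] not above the real, here among the first 2^m
    because the measure is at most 1. Each of these comparisons is a Pi_1 question. *)
Lemma floor_probE m : floor_prob m =
  count (fun k => `[< forall s, (k.+1 * 2 ^ s <= alive m s * 2 ^ m)%N >]) (iota 0 (2 ^ m)).
Proof.
have e0 n : 0 < 2 ^+ n :> R by rewrite exprn_gt0.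
have -> : count (fun k => `[< forall s, (k.+1 * 2 ^ s <= alive m s * 2 ^ m)%N >])
    (iota 0 (2 ^ m)) = count (fun k => (k < floor_prob m)%N) (iota 0 (2 ^ m)).
  apply: eq_count => k; rewrite /floor_prob truncn_gt_nat.
  rewrite -ler_pdivrMl // mulrC; apply/idP/idP.
    move=> /asboolP h; apply/level_prob_ge => s; have := h s.
    by rewrite ler_pdivrMr // mulrAC ler_pdivlMr // -!natrX -!natrM ler_nat.
  move=> /level_prob_ge h; apply/asboolP => s; have := h s.
  by rewrite ler_pdivrMr // mulrAC ler_pdivlMr // -!natrX -!natrM ler_nat.
have le_m : (floor_prob m <= 2 ^ m)%N.
  rewrite -(ler_nat R) natrX (@le_trans _ _ (2 ^+ m * level_prob m)) //.
    by rewrite truncn_le mulr_ge0 ?exprn_ge0 ?level_prob_ge0.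
  by rewrite ler_piMr ?exprn_ge0 // level_prob_le1.
rewrite -(subnKC le_m) iotaD count_cat add0n.
rewrite (eq_in_count (a2 := xpredT)) => [|k]; last by rewrite mem_iota.
rewrite count_predT size_iota (eq_in_count (a2 := xpred0)) => [|k].
  by rewrite count_pred0 addn0.
by rewrite mem_iota => /andP[le _]; rewrite ltnNge le.
Qed.

(** The shape is the one prescribed by [computable_rat_in]: sign exponent, numerator, and a
    successor as denominator. *)
Definition sigma2_approx m : rat := (-1) ^+ 0 * (floor_prob m)%:R / (2 ^ m - 1).+1%:R.

Lemma sigma2_approxE m : ratr (sigma2_approx m) = (floor_prob m)%:R / 2 ^+ m :> R.
Proof.
rewrite /sigma2_approx expr0 mul1r subn1 prednK ?expn_gt0 //.
by rewrite rmorphM fmorphV !rmorph_nat natrX.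
Qed.

Lemma sigma2_approx_mono : {homo sigma2_approx : m n / (m <= n)%N >-> m <= n}.
Proof.
apply: homo_leq => [//|y x z|m]; first exact: le_trans.
rewrite -(ler_rat R) !sigma2_approxE ler_pdivrMr ?exprn_gt0 // mulrAC.
rewrite ler_pdivlMr ?exprn_gt0 // exprS mulrA -natrX -!natrM ler_nat.
by rewrite leq_mul2r mulnC floor_prob_mono orbT.
Qed.

Lemma sigma2_approx_cvg : ratr (sigma2_approx m) @[m --> \oo] -->
  fine (lebesgue_measure (reals_of R (sigma2 Q))).
Proof.
have e0 n : 0 < 2 ^+ n :> R by rewrite exprn_gt0.
apply: (@squeeze_cvgr _ _ _ _ (fun m => level_prob m - 2^-1 ^+ m) level_prob).
- apply: nearW => m; rewrite sigma2_approxE exprVn; apply/andP; split.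
    rewrite lerBlDr -[X in _ <= _ + X]mul1r -mulrDl ler_pdivlMr // mulrC ltW //.
    by rewrite natr1 truncnS_gt.
  by rewrite ler_pdivrMr // mulrC truncn_le mulr_ge0 ?level_prob_ge0 // ltW.
- rewrite -[X in _ --> X]subr0; apply: cvgB; first exact: level_prob_cvg.
  by apply: cvg_expr; rewrite ger0_norm ?invr_ge0 // invf_lt1 // ltr1n.
- exact: level_prob_cvg.
Qed.

End Sigma2.

(** * Probabilities of Sigma_2 events *)

Local Open Scope nat_scope.

Lemma comp_half : computable half.
Proof.
apply: (comp_ext (f := fun n => count odd (iota 0 n))) => [n|]; last comp.
elim: n => // n IHn; rewrite -addn1 iotaD count_cat IHn /= addn0 add0n addn1.
by rewrite /= uphalf_half addnC.
Qed.

Lemma comp_bits : computable (fun p : nat * nat => bits p.1 p.2).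
Proof.
apply: (comp_ext (f := fun p : nat * nat =>
  [seq odd (iter (p.1 - n.+1) half p.2) | n <- iota 0 p.1])) => [p|].
  apply: eq_map => n; congr odd; elim: (p.1 - n.+1) => [|k IHk]; first by rewrite divn1.
  by rewrite iterS IHk -divn2 -divnMA expnSr.
have := comp_half => ?; comp.
Qed.

Lemma comp_cantor_pair `{Coding A} (f g : A -> nat) :
  computable f -> computable g -> computable (fun x => cantor_pair (f x) (g x)).
Proof.
move=> cf cg; apply: (comp_ext (f := fun x => encode (f x, g x))) => //; comp.
Qed.
#[global] Hint Resolve comp_cantor_pair : comp.

Lemma comp_cantor_unpair : computable cantor_fst /\ computable cantor_snd.
Proof. by split; apply: comp_fun; [apply: computable_fst|apply: computable_snd]. Qed.

Lemma halting_problemE L e n :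
  halting_problem L (cantor_pair e n) = `[< halts (L e) (with_input n no_oracle) >].
Proof.
apply/asboolP/asboolP => [[e' [n' [/cantor_pair_inj[-> ->]]]]//|h].
by exists e, n.
Qed.

Section Part1.
Variables (R : realType) (L : nat -> machine) (hL : effective_list L).

Lemma left_ce_sigma2 (Q : nat -> seq bool -> bool) :
  computable (fun q : nat * seq bool => Q q.1 q.2) ->
  (forall m (X : oracle) s, Q m (mkseq X s.+1) -> Q m (mkseq X s)) ->
  (forall m y, Q m y -> Q m.+1 y) ->
  left_ce_jump L (fine (lebesgue_measure (reals_of R (sigma2 Q)))).
Proof.
move=> cQ Qanti Qmono; exists (sigma2_approx R Q); split; last 2 first.
- exact: sigma2_approx_mono.
- exact: sigma2_approx_cvg.
(* Halting is made to mean refutation: the search is for a stage [s] that violates the bound, so the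
   comparisons that hold are the negative answers. *)
pose P (p : nat * nat) :=
  alive Q (cantor_fst p.1) p.2 * 2 ^ cantor_fst p.1 < (cantor_snd p.1).+1 * 2 ^ p.2.
have cP : computable P.
  have [? ?] := comp_cantor_unpair; have ? := comp_bits.
  by rewrite /P /alive; comp.
have [M ME] := halting_search cP.
have [e eM] := hL.1 M.
pose query m k := cantor_pair e (cantor_pair m k).
have queryE m k : halting_problem L (query m k) =
    ~~ `[< forall s, k.+1 * 2 ^ s <= alive Q m s * 2 ^ m >].
  rewrite halting_problemE eM; apply/asboolP/idP.
    move/ME => [s]; rewrite /P /= /cantor_fst /cantor_snd cantor_pairK /= => lt.
    by apply/asboolP => /(_ s); rewrite leqNgt lt.
  move=> /asboolP/existsNP[s /negP]; rewrite -ltnNge => lt; apply/ME; exists s.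
  by rewrite /P /= /cantor_fst /cantor_snd cantor_pairK.
exists (fun=> 0), (floor_prob R Q), (fun m => 2 ^ m - 1); split=> //.
- by apply: computable_in_pure; comp.
(* No answer is given until the prefix of the halting problem is long enough to contain all 2^m
   queries. *)
- pose G (p : nat * seq bool) :=
    if all (fun k => query p.1 k < size p.2) (iota 0 (2 ^ p.1)) then
      Some (nseq (count (fun k => ~~ nth false p.2 (query p.1 k)) (iota 0 (2 ^ p.1))) true)
    else None.
  have cG : computable G by rewrite /G /query; comp.
  apply: (computable_in_limit cG) => m.
  have exu : exists u, all (fun k => query m k < u) (iota 0 (2 ^ m)).
    exists (\max_(k <- iota 0 (2 ^ m)) query m k).+1.
    by apply/allP => k kI; rewrite ltnS; apply: leq_bigmax_seq.
  case: (ex_minnP exu) => u allu minu; exists u => [|v ltv]; rewrite /G /= size_mkseq.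
    rewrite allu (floor_probE _ Qanti). congr Some; congr nseq; apply: eq_in_count => k kI.
    by rewrite nth_mkseq ?queryE ?negbK //; apply: (allP allu).
  by case: ifP => // /minu; rewrite leqNgt ltv.
- by apply: computable_in_pure; comp.
Qed.

(** The length of [y] is also the number of steps, and in that many steps only cells of [y] are
    scanned. *)
Definition output_bounded (c : seq bool -> nat) (V : machine) m (y : seq bool) : bool :=
  c (output_at V (nth false y) (size y)) <= m.

Lemma output_bounded_sigma2 c V : sigma2 (output_bounded c V) =
  [set X | exists m, forall s, c (output_at V X s) <= m].
Proof.
apply/seteqP; split=> X [m h]; exists m => s; have := h s;
  by rewrite /output_bounded size_mkseq /output_at run_mkseq.
Qed.

Definition prefix_monotone (c : seq bool -> nat) := forall y z, c y <= c (y ++ z).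

Lemma output_bounded_anti c V m X s : prefix_monotone c ->
  output_bounded c V m (mkseq X s.+1) -> output_bounded c V m (mkseq X s).
Proof.
move=> cm; rewrite /output_bounded !size_mkseq /output_at !run_mkseq //.
apply: leq_trans; have [z _] := output_step V X s.
by rewrite /output_at => ->; apply: cm.
Qed.

Lemma output_bounded_mono c V m y : output_bounded c V m y -> output_bounded c V m.+1 y.
Proof. exact: leqW. Qed.

Lemma comp_output_bounded c V : computable c ->
  computable (fun q : nat * seq bool => output_bounded c V q.1 q.2).
Proof.
move=> cc; have [e eV] := hL.1 V.
have [U UE] : exists U, U = fun p : nat * (seq bool * nat) =>
  output_at (L p.1) (nth false p.2.1) p.2.2 by eexists.
have cU : computable U by rewrite UE; apply: comp_output.
apply: (comp_ext (f := fun q => c (U (e, (q.2, size q.2))) <= q.1)) => [q|].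
  by rewrite UE /= eV.
comp.
Qed.

Lemma ones_prefix_monotone : prefix_monotone ones.
Proof. by move=> y z; rewrite /ones count_cat leq_addr. Qed.

Lemma size_prefix_monotone : prefix_monotone size.
Proof. by move=> y z; rewrite size_cat leq_addr. Qed.

Lemma comp_ones : computable ones.
Proof. rewrite /ones; apply: (comp_count (h := fun _ b => b)); comp. Qed.

Lemma prob_writes_eventually_zero V : exists alpha beta : R,
  [/\ left_ce_jump L alpha, left_ce_jump L beta &
      oracle_prob R [set X | writes_eventually_zero V X] = (alpha - beta)%:E]%R.
Proof.
pose Z := sigma2 (output_bounded ones V); pose S := sigma2 (output_bounded size V).
have mZ : measurable (reals_of R Z).
  exact: measurable_sigma2.
have mS : measurable (reals_of R S).
  exact: measurable_sigma2.
exists (fine (lebesgue_measure (reals_of R Z))), (fine (lebesgue_measure (reals_of R S))).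
split.
- apply: left_ce_sigma2 => *; [exact: comp_output_bounded comp_ones|
    exact: output_bounded_anti ones_prefix_monotone _|exact: output_bounded_mono].
- apply: left_ce_sigma2 => *; [apply: comp_output_bounded; comp|
    exact: output_bounded_anti size_prefix_monotone _|exact: output_bounded_mono].
have SZ : S `<=` Z.
  rewrite /S /Z !output_bounded_sigma2 => X [m h]; exists m => s.
  by apply: leq_trans (h s); apply: count_size.
have fin P : measurable (reals_of R P) ->
    lebesgue_measure (reals_of R P) = (fine (lebesgue_measure (reals_of R P)))%:E.
  move=> mP; rewrite fineK // ge0_fin_numE ?measure_ge0 //.
  exact: le_lt_trans (reals_of_measure_lty mP) (ltry _).
have -> : oracle_prob R [set X | writes_eventually_zero V X] =
    lebesgue_measure (reals_of R Z `\` reals_of R S).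
  congr (lebesgue_measure _); apply/seteqP; split=> x.
    move=> [x01 /writes_eventually_zeroE[inf bdd]]; split.
      by split=> //; rewrite /Z output_bounded_sigma2.
    move=> [_]; rewrite /S output_bounded_sigma2 => -[m h].
    by have [s] := inf m.+1; rewrite ltnNge h.
  move=> [[x01 xZ] nS]; split=> //; apply/writes_eventually_zeroE.
  move: xZ; rewrite /Z output_bounded_sigma2 => bdd; split=> // n.
  apply: contrapT => /forallNP nn; apply: nS; split=> //.
  rewrite /S output_bounded_sigma2; exists n => s.
  by have /negP := nn s; rewrite -ltnNge; apply: ltnW.
have lty : (lebesgue_measure (reals_of R Z) < +oo)%E.
  exact: le_lt_trans (reals_of_measure_lty mZ) (ltry _).
rewrite measureD; [|exact: mZ|exact: mS|exact: lty].
have -> : reals_of R Z `&` reals_of R S = reals_of R S.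
  by apply: setIidr => x [x01 Sx]; split=> //; apply: SZ.
by rewrite EFinB -(fin _ mZ) -(fin _ mS).
Qed.

End Part1.

(** * Limit approximations of functions computable in the jump *)

Section LimitLemma.
Variables (L : nat -> machine) (hL : effective_list L).

Definition halted_by u p := halted (nth false (nat_code (cantor_snd p)))
  (Defs.run (L (cantor_fst p)) (nth false (nat_code (cantor_snd p))) u).

Definition jump_table u : seq bool := [seq halted_by u p | p <- iota 0 u].

Definition jump_run e n u : config (ntapes (L e)) :=
  Defs.run (L e) (nth false (nat_code n ++ jump_table u)) u.

(** The guess at stage [u]: the machine runs for [u] steps on the table of what halts within [u]
    steps. Values are written in unary, so the length of the output is the value; 0 stands for a run
    that has not halted yet. *)
Definition jump_approx e n u : nat :=
  if halted (nth false (nat_code n ++ jump_table u)) (jump_run e n u)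
  then size (output (jump_run e n u)) else 0.

Lemma comp_jump_approx e : computable (fun q : nat * nat => jump_approx e q.1 q.2).
Proof.
pose O' (p : nat * (seq bool * nat)) := output_at (L p.1) (nth false p.2.1) p.2.2.
pose H' (p : nat * (seq bool * nat)) :=
  halted (nth false p.2.1) (Defs.run (L p.1) (nth false p.2.1) p.2.2).
have cO : computable O' := comp_output hL.
have cH : computable H' := comp_halted hL.
have cn : computable nat_code by rewrite /nat_code; comp.
have [? ?] := comp_cantor_unpair.
pose J u := [seq H' (cantor_fst p, (nat_code (cantor_snd p), u)) | p <- iota 0 u].
have cJ : computable J by rewrite /J; move: cH; move: (H') => h ch; comp.
apply: (comp_ext (f := fun q : nat * nat =>
  if H' (e, (nat_code q.1 ++ J q.2, q.2)) then
    size (O' (e, (nat_code q.1 ++ J q.2, q.2))) else 0)) => //.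
by move: cO cH cJ; move: (O') (H') (J) => o h j co ch cj; comp.
Qed.

Lemma halted_persist M X s s' : s <= s' -> halted X (Defs.run M X s) ->
  halted X (Defs.run M X s').
Proof. by move=> le h; rewrite (halted_run h le). Qed.

Lemma halted_by_limit p : exists u0, forall u, u0 <= u -> halted_by u p = halting_problem L p.
Proof.
have HE : halting_problem L p = `[< halts (L (cantor_fst p)) (nth false (nat_code (cantor_snd p))) >].
  by rewrite -{1}(cantor_unpairK p) halting_problemE with_input_no_oracle.
rewrite HE; case: asboolP => [[s hs]|nh].
  by exists s => u le; apply: halted_persist le hs.
by exists 0 => u _; apply/negbTE/negP => h; apply: nh; exists u.
Qed.

Lemma jump_table_limit n s : exists u0, forall u, u0 <= u -> forall i, i < s ->
  nth false (nat_code n ++ jump_table u) i = with_input n (halting_problem L) i.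
Proof.
elim: s => [|s [u0 IHs]]; first by exists 0.
have [u1 u1E] := halted_by_limit (s - size (nat_code n)).
exists (maxn u0 (maxn u1 s.+1)) => u; rewrite !geq_max => /and3P[le0 le1 lts] i.
rewrite ltnS leq_eqVlt => /orP[/eqP ->|]; last exact: IHs.
rewrite nth_cat /with_input /cat_oracle; case: ltnP => // le.
rewrite (nth_map 0) ?size_iota ?nth_iota ?add0n; try by apply: leq_ltn_trans (leq_subr _ _) lts.
exact: u1E.
Qed.

(** A halting computation scans finitely many cells of the oracle, and the tables settle on these;
    from then on the approximate run is the true one. *)
Lemma jump_approx_limit f : computable_nat_in (halting_problem L) f ->
  exists e, forall n, exists u0, forall u, u0 <= u -> jump_approx e n u = f n.
Proof.
move=> [M ME]; have [e eM] := hL.1 M; exists e => n.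
have [s [hs os]] := ME n; rewrite -eM in hs os.
(* The cell [s] is included, since the test for a halt at time [s] scans the cell under the head. *)
have [u0 u0E] := jump_table_limit n s.+1.
exists (maxn u0 s) => u; rewrite geq_max => /andP[le0 les].
set X := with_input n _ in hs os; pose Y := nth false (nat_code n ++ jump_table u).
have YX i : i <= s -> Y i = X i by move=> le; apply: u0E.
have runE : Defs.run (L e) Y s = Defs.run (L e) X s.
  by apply: eq_run => i lti; apply/YX/ltnW.
have hY : halted Y (Defs.run (L e) Y s).
  move: hs; rewrite runE /halted; congr (~~ _); apply: eq_has => r.
  by rewrite /applicable YX // oracle_head_run.
rewrite /jump_approx /jump_run (halted_persist les hY) (halted_run hY les) runE.
have -> : output (Defs.run (L e) X s) = nseq (f n) true by [].
by rewrite size_nseq.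
Qed.

End LimitLemma.

Lemma comp_take `{Coding A, Coding B} (n : A -> nat) (s : A -> seq B) :
  computable n -> computable s -> computable (fun x => take (n x) (s x)).
Proof.
move=> cn cs; apply: (comp_ext (f := fun x => rev (drop (size (s x) - n x) (rev (s x))))).
  by move=> x; rewrite -(size_rev (s x)) -take_rev revK.
comp.
Qed.
#[global] Hint Resolve comp_take : comp.

(** * Detecting the failure of an eventual property *)

Section Events.
Variable D : nat -> seq bool -> bool.

(** The guess [k] stands for: some [n <= k] satisfies [D n] at all lengths from [k] on. One number
    bounds both parameter and threshold, so that the guesses form a single sequence, and finitely
    many lengths refute a wrong one. *)
Definition plausible k (y : seq bool) :=
  has (fun n => all (fun v => (k <= v) ==> D n (take v y)) (iota 0 (size y).+1))
    (iota 0 k.+1).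

(** The current guess, raised by one whenever it is found refuted. An event is such a refutation, so
    there are finitely many events exactly when some guess survives. *)
Definition pointer (y : seq bool) :=
  foldl (fun k u => if plausible k (take u y) then k else k.+1) 0 (iota 0 (size y)).

Definition event (y : seq bool) : bool := ~~ plausible (pointer y) y.

Lemma comp_event : computable (fun p : nat * seq bool => D p.1 p.2) -> computable event.
Proof.
move=> cD.
have cp : computable (fun p : nat * seq bool => plausible p.1 p.2).
  by rewrite /plausible; comp.
have cq : computable pointer by rewrite /pointer; comp.
by rewrite /event; comp.
Qed.

Variable X : oracle.

Lemma plausible_mkseq k u : plausible k (mkseq X u) <->
  exists2 n, n <= k & forall v, k <= v -> v <= u -> D n (mkseq X v).
Proof.
rewrite /plausible size_mkseq; split.
  move=> /hasP[n]; rewrite mem_iota add0n ltnS => len /allP h; exists n => // v lev le.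
  have := h v; rewrite mem_iota add0n ltnS le => /(_ isT); rewrite lev /=.
  by rewrite take_mkseq.
move=> [n len h]; apply/hasP; exists n; first by rewrite mem_iota add0n ltnS.
apply/allP => v; rewrite mem_iota add0n ltnS => /= le; apply/implyP => lev.
by rewrite take_mkseq //; apply: h.
Qed.

Lemma pointerS u : pointer (mkseq X u.+1) =
  pointer (mkseq X u) + event (mkseq X u).
Proof.
have E v : v <= u -> foldl (fun k w => if plausible k (take w (mkseq X u.+1)) then k else k.+1)
    0 (iota 0 v) = foldl (fun k w => if plausible k (take w (mkseq X u)) then k else k.+1)
    0 (iota 0 v).
  elim: v => // v IHv lev; rewrite !iota0S !foldl_cat /= IHv 1?ltnW //.
  by rewrite !take_mkseq // ltnW // ltnW.
rewrite /event {1}/pointer size_mkseq iota0S foldl_cat E //=.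
rewrite take_mkseq // /pointer size_mkseq.
by case: plausible; rewrite ?addn0 ?addn1.
Qed.

Lemma pointerD u v : u <= v -> pointer (mkseq X u) <= pointer (mkseq X v).
Proof.
move=> /subnK <-; elim: (v - u) => // w IHw.
by rewrite addSn pointerS (leq_trans IHw) // leq_addr.
Qed.

Lemma event_finite : (exists N, forall u, N <= u -> ~~ event (mkseq X u)) <->
  exists n, exists N, forall v, N <= v -> D n (mkseq X v).
Proof.
split=> [[N noev]|[n [N Dn]]].
  set k := pointer (mkseq X N).
  have kE u : N <= u -> pointer (mkseq X u) = k.
    move=> /subnK <-; elim: (u - N) => // w IHw.
    by rewrite addSn pointerS IHw (negbTE (noev _ _)) ?addn0 // leq_addl.
  have pl u : N <= u -> plausible k (mkseq X u).
    by move=> leu; have := noev u leu; rewrite /event negbK kE.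
  apply: contrapT => nex.
  have fail n : exists v, k <= v /\ ~~ D n (mkseq X v).
    apply: contrapT => nf; apply: nex; exists n, k => v lev.
    by apply: contrapT => /negP nD; apply: nf; exists v.
  have [f fE] := choice fail.
  (* A length by which every candidate [n <= k] has failed. *)
  pose u := maxn N (\max_(n <- iota 0 k.+1) f n).
  have [n len Dn] := (plausible_mkseq k u).1 (pl u (leq_maxl _ _)).
  have [lev /negP[]] := fE n; apply: Dn => //.
  by rewrite leq_max; apply/orP; right; apply: leq_bigmax_seq; rewrite ?mem_iota.
(* This guess is never refuted, because [n] is among its candidates and holds from [N] on; so the
   pointer cannot pass it. *)
set k := maxn n N.
have bounded u : pointer (mkseq X u) <= k.
  elim: u => // u IHu; rewrite pointerS; case: (ltnP (pointer (mkseq X u)) k) => [lt|ge].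
    by rewrite (leq_trans _ lt) // -addn1 leq_add2l leq_b1.
  rewrite /event (_ : plausible _ _) ?addn0 //; apply/plausible_mkseq.
  exists n => [|v lev _]; first by apply: leq_trans ge; apply: leq_maxl.
  by apply: Dn; rewrite (leq_trans _ lev) // (leq_trans _ ge) // leq_maxr.
apply: contrapT => inf.
have grow m : exists u, m <= pointer (mkseq X u).
  elim: m => [|m [u leu]]; first by exists 0.
  have [v [lev ev]] : exists v, u <= v /\ event (mkseq X v).
    apply: contrapT => nv; apply: inf; exists u => v lev.
    by apply/negP => ev; apply: nv; exists v.
  exists v.+1; rewrite pointerS ev addn1 ltnS.
  by apply: leq_trans leu _; apply: pointerD.
by have [u] := grow k.+1; rewrite ltnNge bounded.
Qed.

End Events.

(** * A universal machine with a prescribed probability *)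

Definition fin_support (a : nat -> nat) := exists N, forall i, N <= i -> a i = 0.

Lemma fin_supportP a :
  fin_support a <-> exists m, forall s, sumn [seq a i | i <- iota 0 s] <= m.
Proof.
have sumS s : sumn [seq a i | i <- iota 0 s.+1] = sumn [seq a i | i <- iota 0 s] + a s.
  by rewrite iota0S map_cat sumn_cat /= addn0.
split=> [[N aN]|[m bdd]].
  exists (sumn [seq a i | i <- iota 0 N]) => s.
  case: (leqP s N) => [le|/ltnW /subnKC <-].
    by rewrite -(subnKC le) iotaD map_cat sumn_cat leq_addr.
  elim: (s - N) => [|k IHk]; first by rewrite addn0.
  by rewrite addnS sumS aN ?addn0 // leq_addr.
apply: contrapT => nf.
have grow k : exists s, k <= sumn [seq a i | i <- iota 0 s].
  elim: k => [|k [s les]]; first by exists 0.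
  have [i [lei ai]] : exists i, s <= i /\ 0 < a i.
    apply: contrapT => ni; apply: nf; exists s => i lei; apply/eqP.
    by rewrite -leqn0 leqNgt; apply/negP => ai; apply: ni; exists i.
  exists i.+1; rewrite sumS -addn1 leq_add //; apply: leq_trans les _.
  by rewrite -(subnKC lei) iotaD map_cat sumn_cat leq_addr.
by have [s] := grow m.+1; rewrite ltnNge bdd.
Qed.

Lemma fin_support_shift k a : fin_support (fun i => a (k + i)) <-> fin_support a.
Proof.
split=> [[N aN]|[N aN]]; last first.
  by exists N => i lei; apply: aN; apply: leq_trans lei (leq_addl _ _).
exists (k + N) => i lei; have lek : k <= i by apply: leq_trans lei; apply: leq_addr.
by rewrite -(subnKC lek); apply: aN; rewrite leq_subRL.
Qed.

Lemma eq_fin_support a b : a =1 b -> fin_support a <-> fin_support b.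
Proof. by move=> /funext ->. Qed.

Lemma reaction_eventually_zero g M X (t : nat -> nat) :
  (forall s, t s < t s.+1) ->
  (forall s, output_at M X (t s) = written_upto g X s) ->
  writes_eventually_zero M X <->
  ~ fin_support (fun i => size (g (mkseq X i.+1)).1) /\
  fin_support (fun i => ones (g (mkseq X i.+1)).1).
Proof.
move=> t_inc tE; rewrite writes_eventually_zeroE.
have leT s : s <= t s by elim: s => // s IHs; apply: leq_ltn_trans (t_inc s).
have sizeE s : size (output_at M X (t s)) =
    sumn [seq size (g (mkseq X i.+1)).1 | i <- iota 0 s].
  by rewrite tE size_flatten /shape -map_comp.
have onesE s : ones (output_at M X (t s)) =
    sumn [seq ones (g (mkseq X i.+1)).1 | i <- iota 0 s].
  by rewrite tE /ones count_flatten -map_comp.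
have mono c : prefix_monotone c -> forall s, c (output_at M X s) <= c (output_at M X (t s)).
  by move=> cm s; have [z ->] := output_prefix M X (leT s); apply: cm.
rewrite !fin_supportP; split=> [[inf [m bdd]]|[inf [m bdd]]]; split.
- move=> [m' bdd']; have [s] := inf m'.+1.
  by rewrite ltnNge (leq_trans (mono _ size_prefix_monotone s)) // sizeE.
- by exists m => s; rewrite -onesE.
- move=> n; apply: contrapT => nn; apply: inf; exists n => s; rewrite -sizeE.
  by rewrite leqNgt; apply/negP => lt; apply: nn; exists (t s); apply: ltnW.
- by exists m => s; apply: leq_trans (mono _ ones_prefix_monotone s) _; rewrite onesE.
Qed.

Section UniversalMachine.
Variables (L : nat -> machine) (hL : effective_list L).

(* The bits that machine [e] writes at its last step on [w], where
   [y = 1^e 0 w] and the number of steps is the length of [w]. *)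
Definition fresh_bits (y : seq bool) : seq bool :=
  if find negb y < size y then
    drop (size (output_at (L (parse_nat y).1) (nth false (parse_nat y).2)
                 (size (parse_nat y).2).-1))
      (output_at (L (parse_nat y).1) (nth false (parse_nat y).2)
                 (size (parse_nat y).2))
  else [::].

Lemma comp_fresh_bits : computable fresh_bits.
Proof.
have cO := comp_output hL; have cn := comp_parse_nat.
pose F (p : nat * (seq bool * nat)) := output_at (L p.1) (nth false p.2.1) p.2.2.
apply: (comp_ext (f := fun y => if find negb y < size y then
    drop (size (F ((parse_nat y).1, ((parse_nat y).2, (size (parse_nat y).2).-1))))
      (F ((parse_nat y).1, ((parse_nat y).2, size (parse_nat y).2)))
  else [::])) => //.
by move: cO; rewrite -/F; move: (F) => f cf; comp.
Qed.

(** The outputs telescope: on a string of length [e.+1 + k] the machine [L e] is run for [k] steps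
    and only the bits of the last step are returned, none for [k = 0]. *)
Lemma fresh_bits_input e Y q :
  flatten [seq fresh_bits (mkseq (with_input e Y) j) | j <- iota 0 (e.+1 + q).+1] =
  output_at (L e) Y q.
Proof.
have early j : j <= e -> fresh_bits (mkseq (with_input e Y) j) = [::].
  by move=> le; rewrite /fresh_bits size_mkseq size_mkseq_input ltnNge le.
have late k : fresh_bits (mkseq (with_input e Y) (e.+1 + k)) =
    drop (size (output_at (L e) Y k.-1)) (output_at (L e) Y k).
  rewrite /fresh_bits size_mkseq size_mkseq_input addSn ltnS leq_addr -addSn.
  by rewrite parse_nat_input /= size_mkseq /output_at !run_mkseq ?leq_pred.
elim: q => [|q IHq].
  have late0 : fresh_bits (mkseq (with_input e Y) e.+1) = [::].
    by rewrite -[e.+1]addn0 late; apply: drop_size.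
  rewrite addn0 iota0S map_cat flatten_cat flatten_map_nil => [|j]; last first.
    by rewrite mem_iota add0n ltnS => /early.
  by rewrite /= late0.
rewrite addnS iota0S map_cat flatten_cat IHq /= cats0 -addnS late /=.
by have [z _ ->] := output_step (L e) Y q; rewrite drop_size_cat.
Qed.

Variables (c : nat) (Da Db : nat -> seq bool -> bool).
Hypotheses (cDa : computable (fun p : nat * seq bool => Da p.1 p.2))
           (cDb : computable (fun p : nat * seq bool => Db p.1 p.2)).

(* On the three blocks 1^c00, 1^c01, 1^c10, an infinite output that is eventually
   zero is written on the oracles on which, respectively: the simulated machine
   does so; it writes infinitely many ones; its output is finite.  Exactly one
   of the three holds. *)
Definition block_bits (b1 b2 : bool) (w : seq bool) : seq bool :=
  if b1 then (if b2 then [::] else rcons (nseq (size w) true) false)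
  else if b2 then nseq (ones w) false else w.

(** Nothing is written before the block is known, at length [c.+2]. Off the blocks an event of [Da]
    writes a one and an event of [Db] a zero. The second component never asks for a halt. *)
Definition reaction (z : seq bool) : seq bool * bool :=
  (if size z < c.+2 then [::] else
   if all id (take c z) then
     block_bits (nth false z c) (nth false z c.+1) (fresh_bits (drop c.+2 z))
   else (if event Da z then [:: true] else [::]) ++
        (if event Db z then [:: false] else [::]), false).

Lemma comp_reaction : computable reaction.
Proof.
have := comp_event cDa; have := comp_event cDb; have := comp_fresh_bits.
have := comp_ones; rewrite /reaction /block_bits => ? ? ? ?.
have ca : computable (fun z => all id (take c z)).
  by apply: (comp_all (h := fun _ b => b)); comp.
comp.
Qed.

Definition tail_from (n : nat) (X : oracle) : oracle := fun i => X (n + i).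

Lemma drop_mkseq n (X : oracle) j : drop n (mkseq X (n + j)) = mkseq (tail_from n X) j.
Proof.
by rewrite /mkseq -map_drop drop_iota addKn add0n -[n in iota n _]addn0 iotaDl -map_comp.
Qed.

Lemma cat_oracle_cat s1 s2 X :
  cat_oracle (s1 ++ s2) X = cat_oracle s1 (cat_oracle s2 X).
Proof.
apply: funext => i; rewrite /cat_oracle nth_cat size_cat.
case: (ltnP i (size s1)) => [lt|le]; first by rewrite (leq_trans lt) // leq_addr.
by rewrite -ltn_subLR // subnDA.
Qed.

Lemma tail_cat_oracle s X : tail_from (size s) (cat_oracle s X) = X.
Proof. by apply: funext => i; rewrite /tail_from /cat_oracle ltnNge leq_addr addKn. Qed.

Lemma reaction_early X i : i < c.+1 -> (reaction (mkseq X i.+1)).1 = [::].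
Proof. by move=> lt; rewrite /reaction size_mkseq ltnS lt. Qed.

Lemma reaction_block X j : all id (mkseq X c) ->
  (reaction (mkseq X (c.+1 + j).+1)).1 =
  block_bits (X c) (X c.+1) (fresh_bits (mkseq (tail_from c.+2 X) j)).
Proof.
move=> ones_c; rewrite /reaction /fst size_mkseq -addSn (ltnNge _ c.+2) leq_addr.
rewrite drop_mkseq take_mkseq ?ones_c; last by rewrite !addSn -!addnS leq_addr.
by rewrite !nth_mkseq // !addSn ?ltnS ?leqW ?leq_addr.
Qed.

Lemma reaction_other X j : ~~ all id (mkseq X c) ->
  (reaction (mkseq X (c.+1 + j).+1)).1 =
  (if event Da (mkseq X (c.+1 + j).+1) then [:: true] else [::]) ++
  (if event Db (mkseq X (c.+1 + j).+1) then [:: false] else [::]).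
Proof.
move=> nones_c; rewrite /reaction /fst size_mkseq -addSn (ltnNge _ c.+2) leq_addr.
by rewrite take_mkseq ?(negbTE nones_c) // !addSn -!addnS leq_addr.
Qed.

Definition block_support (f : seq bool -> nat) (X : oracle) :=
  fin_support (fun j => f (fresh_bits (mkseq (tail_from c.+2 X) j))).

Definition reaction_zero (X : oracle) :=
  ~ fin_support (fun i => size (reaction (mkseq X i.+1)).1) /\
  fin_support (fun i => ones (reaction (mkseq X i.+1)).1).

Lemma reaction_zero_block X : all id (mkseq X c) -> reaction_zero X <->
  if X c then (if X c.+1 then False else block_support size X)
  else if X c.+1 then ~ block_support ones X
  else ~ block_support size X /\ block_support ones X.
Proof.
move=> ones_c.
have shiftE (f : seq bool -> nat) : fin_support (fun i => f (reaction (mkseq X i.+1)).1) <->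
    fin_support (fun j => f (block_bits (X c) (X c.+1)
      (fresh_bits (mkseq (tail_from c.+2 X) j)))).
  rewrite -(fin_support_shift c.+1); apply: eq_fin_support => j.
  by rewrite reaction_block.
rewrite /reaction_zero (shiftE size) (shiftE ones).
have ones_nseq n b : ones (nseq n b) = n * b.
  by rewrite /ones count_nseq mulnC.
have ones_rcons n : ones (rcons (nseq n true) false) = n.
  by rewrite /ones -cats1 count_cat count_nseq; case: n => [|n] /=; lia.
rewrite /block_bits /block_support; case: (X c); case: (X c.+1) => /=.
- by split=> // -[[]]; exists 0.
- split=> [[_ [N h]]|[N h]].
    by exists N => i lei; have := h i lei; rewrite ones_rcons.
  split; first by move=> [N' h']; have := h' N' (leqnn _); rewrite size_rcons.
  by exists N => i lei; rewrite ones_rcons h.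
- split=> [[h _]|h]; first by move=> [N fN]; apply: h; exists N => i lei; rewrite size_nseq fN.
  split; last by exists 0 => i _; rewrite ones_nseq muln0.
  by move=> [N fN]; apply: h; exists N => i lei; rewrite -(fN i lei) size_nseq.
- by [].
Qed.

(** Once there are finitely many ones, that is finitely many events of [Da], the output is infinite
    exactly when [Db] has infinitely many events. *)
Lemma reaction_zero_other X : ~~ all id (mkseq X c) -> reaction_zero X <->
  (exists n N, forall v, N <= v -> Da n (mkseq X v)) /\
  ~ (exists n N, forall v, N <= v -> Db n (mkseq X v)).
Proof.
move=> nones_c; pose ev D (b : bool) j :=
  if event D (mkseq X (c.+1 + j).+1) then [:: b] else [::].
have shiftE (f : seq bool -> nat) : fin_support (fun i => f (reaction (mkseq X i.+1)).1) <->
    fin_support (fun j => f (ev Da true j ++ ev Db false j)).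
  rewrite -(fin_support_shift c.+1); apply: eq_fin_support => j.
  by rewrite reaction_other.
rewrite /reaction_zero (shiftE size) (shiftE ones) /ev.
have finE (D : nat -> seq bool -> bool) : (exists n N, forall v, N <= v -> D n (mkseq X v)) <->
    fin_support (fun j => event D (mkseq X (c.+1 + j).+1)).
  rewrite -event_finite; split=> [[N h]|].
    exists N => j lej; rewrite (negbTE (h _ _)) // (leq_trans lej) //.
    by rewrite -addSn leq_addl.
  move=> [N h]; exists (c.+2 + N) => u leu; have le : c.+2 <= u.
    by apply: leq_trans leu; apply: leq_addr.
  have := h (u - c.+2); rewrite -addSn subnKC // leq_subRL // leu => /(_ isT).
  by case: event.
rewrite !finE /ones; split=> [[ninf [N h]]|[[N h] ninf]].
  have fa : fin_support (fun j => event Da (mkseq X (c.+1 + j).+1)).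
    by exists N => j lej; have := h j lej; case: event => //; case: event.
  split=> // -[N' h']; apply: ninf; case: fa => N'' h''.
  exists (maxn N' N'') => j; rewrite geq_max => /andP[le' le''].
  by rewrite size_cat; have := h' j le'; have := h'' j le''; do 2 case: event.
split; last by exists N => j lej; have := h j lej; do 2 case: event.
move=> [N' h']; apply: ninf; exists N' => j lej.
by have := h' j lej; rewrite size_cat; do 2 case: event.
Qed.

Definition sigma_word (e : nat) : seq bool :=
  nseq c true ++ [:: false; false] ++ nat_code e.

Lemma sigma_universal V : (forall X, exists t : nat -> nat, (forall s, t s < t s.+1) /\
    forall s, output_at V X (t s) = written_upto reaction X s) -> universal L V.
Proof.
move=> VE; exists sigma_word; split.
- by apply: computable_in_pure; rewrite /sigma_word /nat_code; comp.
- move=> e e'; rewrite /sigma_word => /prefixP[z].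
  rewrite -catA => /eqP; rewrite eqseq_cat // eqxx /= => /eqP[].
  rewrite -[nat_code e']cats0 => /(congr1 parse_nat).
  by rewrite !parse_natP => -[-> _]; rewrite cats0.
move=> e Y; set X := cat_oracle _ _; have [t [t_inc tE]] := VE X.
(* Stage [c.+1 + j] sees [j] bits after the marker 1^c00, of which [e.+1] code [e]; so step [q] of
   [L e] is done at the stage with [j = e.+1 + q], which the outer successor includes. *)
exists (fun q => t (c.+1 + (e.+1 + q).+1)); split=> [s|s].
  by rewrite [e.+1 + s.+1]addnS [_ + _.+2]addnS; apply: t_inc.
rewrite tE /written_upto iotaD map_cat flatten_cat.
have -> : flatten [seq (reaction (mkseq X i.+1)).1 | i <- iota 0 c.+1] = [::].
  by apply: flatten_map_nil => j; rewrite mem_iota add0n => /reaction_early ->.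
have XE : X = cat_oracle (nseq c true ++ [:: false; false]) (with_input e Y).
  by rewrite /X /sigma_word catA cat_oracle_cat.
have sizeE : size (nseq c true ++ [:: false; false]) = c.+2.
  by rewrite size_cat size_nseq addn2.
have ones_c : all id (mkseq X c).
  rewrite XE mkseq_cat_oracle_take ?sizeE ?leqW // take_size_cat ?size_nseq //.
  by rewrite all_nseq orbT.
have Xn n : n < c.+2 -> X n = nth false (nseq c true ++ [:: false; false]) n.
  by rewrite XE /cat_oracle sizeE => ->.
rewrite cat0s add0n -[X in iota X _]addn0 iotaDl -map_comp.
rewrite (eq_map (fun j => reaction_block j ones_c)).
rewrite !Xn // !nth_cat !size_nseq ltnn ltnNge leqnSn subnn subSnn.
have -> : tail_from c.+2 X = with_input e Y by rewrite -sizeE XE tail_cat_oracle.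
exact: fresh_bits_input.
Qed.

End UniversalMachine.

Local Open Scope ring_scope.

(** * Binary values, and translations of dyadic intervals *)

Definition binary_value (y : seq bool) : nat := foldl (fun a (b : bool) => a.*2 + b)%N 0%N y.

Lemma binary_value_rcons y b : binary_value (rcons y b) = ((binary_value y).*2 + b)%N.
Proof. by rewrite /binary_value foldl_rcons. Qed.

Lemma comp_binary_value : computable binary_value.
Proof.
apply: (comp_ext (f := fun y => foldl (fun a (b : bool) => a + a + b)%N 0%N y)) => [y|].
  by rewrite /binary_value; elim: y 0%N => //= b y IHy a; rewrite IHy addnn.
comp.
Qed.

Lemma binary_value_ones y : (binary_value y <= 2 ^ size y - 1)%N /\
  (binary_value y == 2 ^ size y - 1)%N = all id y.
Proof.
elim/last_ind: y => // y b [le eq].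
have e0 : (0 < 2 ^ size y)%N by rewrite expn_gt0.
rewrite binary_value_rcons size_rcons expnS all_rcons -eq /=.
split; first by case: b; lia.
case: b => /=; last by apply/negbTE/eqP; lia.
by apply/eqP/eqP; lia.
Qed.

Section RealDigits.
Variable R : realType.
Implicit Types x : R.

Lemma binary_value_digits x u : 0 <= x < 1 ->
  binary_value (mkseq (binary_digits x) u) = Num.truncn (x * 2 ^+ u).
Proof.
move=> /andP[x0 x1]; elim: u => [|u IHu].
  rewrite expr0 mulr1; apply/esym/eqP.
  by rewrite truncn_eq // x0.
rewrite mkseqS binary_value_rcons IHu /binary_digits.
have -> : x * 2 ^+ u = x * 2 ^+ u.+1 / 2%:R by rewrite exprSr mulrA mulfK // pnatr_eq0.
rewrite truncn_divn ?mulr_ge0 ?exprn_ge0 // divn2 addnC.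
exact: odd_double_half.
Qed.

(** The image measure agrees with the Lebesgue measure on the intervals ]x, y], which determine
    it. *)
Lemma lebesgue_measure_translate (a : R) (A : set R) : measurable A ->
  pushforward lebesgue_measure ((fun x => x - a) : _ -> measurableTypeR R) A =
  lebesgue_measure A.
Proof.
have mf : measurable_fun [set: R] (fun x : R => x - a).
  by apply: measurable_funB => //; exact: measurable_cst.
move=> mA; apply/esym/lebesgue_measure_unique => //= _ [[x y]] _ <-.
rewrite /pushforward.
have -> : (fun x => x - a) @^-1` `]x, y] = `]x + a, y + a]%classic.
  apply/seteqP; split=> z /=; rewrite !in_itv /= ltrBrDr lerBlDr //.
rewrite !lebesgue_measure_itv /= !lte_fin ltrD2r; case: ifP => // _.
by rewrite -!EFinB; congr (_%:E); ring.
Qed.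

Lemma truncn_addn (x : R) n : 0 <= x -> Num.truncn (x + n%:R) = (Num.truncn x + n)%N.
Proof.
move=> x0; apply/eqP; rewrite truncn_eq ?addr_ge0 // -addSn !natrD lerD2r ltrD2r.
by rewrite -truncn_eq.
Qed.

Definition tail_set m j (P : set oracle) : set R :=
  dyadic m j `&` [set x | P (tail_from m (binary_digits x))].

Lemma dyadic_ge0 m j x : dyadic m j x -> 0 <= x.
Proof.
rewrite /dyadic /= in_itv /= => /andP[le _].
by apply: le_trans le; rewrite divr_ge0 // exprn_ge0.
Qed.

(** For the digit of index m + i, the translation adds j 2^(i+1) to the integer whose parity is
    taken, and this number is even. *)
Lemma tail_digits_translate m j x : 0 <= x ->
  tail_from m (binary_digits (x + j%:R / 2 ^+ m)) = tail_from m (binary_digits x).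
Proof.
move=> x0; apply: funext => i; rewrite /tail_from /binary_digits -addnS mulrDl.
have -> : j%:R / 2 ^+ m * 2 ^+ (m + i.+1) = (j * 2 ^ i.+1)%:R :> R.
  by rewrite exprD natrM natrX mulrA divfK // expf_neq0 // pnatr_eq0.
rewrite truncn_addn ?mulr_ge0 ?exprn_ge0 // oddD oddM oddX.
by rewrite andbF addbF.
Qed.

Lemma tail_set_translate m j P :
  tail_set m j P = (fun x => x - j%:R / 2 ^+ m) @^-1` tail_set m 0 P.
Proof.
have e0 : 0 < 2 ^+ m :> R by rewrite exprn_gt0.
have dyE x : dyadic m j x <-> dyadic m 0 (x - j%:R / 2 ^+ m).
  rewrite /dyadic /= !in_itv /= mul0r subr_ge0 ltrBlDr -mulrDl.
  by rewrite [1 + _]addrC natr1.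
apply/seteqP; split=> x [].
  move=> /dyE dx Px; split=> //; move: Px.
  by rewrite /= -{1}(subrK (j%:R / 2 ^+ m) x) tail_digits_translate ?(dyadic_ge0 dx).
move=> dx Px; split; first exact/dyE.
by rewrite /= -(subrK (j%:R / 2 ^+ m) x) tail_digits_translate ?(dyadic_ge0 dx).
Qed.

Lemma tail_set_measure m j P : measurable (tail_set m 0 P) ->
  lebesgue_measure (tail_set m j P) = lebesgue_measure (tail_set m 0 P).
Proof. by move=> mP; rewrite tail_set_translate; apply: lebesgue_measure_translate. Qed.

(** The string 1^c00 has the binary value 2^(c+2) - 4, the largest value of c + 2 bits being 2^(c+2)
    - 1. *)
Lemma dyadic_block c x (b1 b2 : bool) : 0 <= x < 1 ->
  dyadic c.+2 (2 ^ c.+2 - 4 + (2 * b1 + b2)) x <->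
  [/\ all id (mkseq (binary_digits x) c), binary_digits x c = b1 &
      binary_digits x c.+1 = b2].
Proof.
move=> x01; have x0 : 0 <= x by case/andP: x01.
have [le eq] := binary_value_ones (mkseq (binary_digits x) c).
rewrite size_mkseq in le eq.
have e0 : (0 < 2 ^ c)%N by rewrite expn_gt0.
have -> : dyadic c.+2 (2 ^ c.+2 - 4 + (2 * b1 + b2)) x <->
    binary_value (mkseq (binary_digits x) c.+2) = (2 ^ c.+2 - 4 + (2 * b1 + b2))%N.
  by rewrite binary_value_digits //; apply: dyadicP.
rewrite !mkseqS !binary_value_rcons !expnS -eq.
move: le; set v := binary_value _ => le.
split=> [|[/eqP -> -> ->]]; last by lia.
case: (binary_digits x c); case: (binary_digits x c.+1); case: b1; case: b2 => /= h;
  by split=> //; try (apply/eqP); lia.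
Qed.

Lemma all_ones_digits c x : 0 <= x < 1 ->
  all id (mkseq (binary_digits x) c) = (1 - (2 ^+ c)^-1 <= x).
Proof.
move=> x01; have x0 : 0 <= x by case/andP: x01.
have [le eq] := binary_value_ones (mkseq (binary_digits x) c).
rewrite size_mkseq binary_value_digits // in le eq.
have e0 : 0 < 2 ^+ c :> R by rewrite exprn_gt0.
rewrite -eq eqn_leq le /= truncn_ge_nat ?mulr_ge0 ?exprn_ge0 //.
rewrite -ler_pdivrMr // natrB ?expn_gt0 // natrX mulrBl mulfV ?mul1r //.
Qed.

Lemma dyadic_block_lt1 c d x : (d < 4)%N -> dyadic c.+2 (2 ^ c.+2 - 4 + d) x -> 0 <= x < 1.
Proof.
move=> ltd dx; rewrite (dyadic_ge0 dx) /=; move: dx; rewrite /dyadic /= in_itv /= => /andP[_ lt].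
apply: lt_le_trans lt _; rewrite ler_pdivrMr ?exprn_gt0 // mul1r -natrX ler_nat.
have : (4 <= 2 ^ c.+2)%N by rewrite (@leq_exp2l 2 2).
by lia.
Qed.

End RealDigits.

Arguments tail_set : clear implicits.

Lemma exists_inv_exp2_lt (R : realType) (e : R) : 0 < e -> exists k, (2 ^+ k)^-1 < e.
Proof.
move=> e_gt0; have : (fun k => 2^-1 ^+ k : R) @ \oo --> 0.
  by apply: cvg_expr; rewrite ger0_norm ?invr_ge0 // invf_lt1 // ltr1n.
move=> /cvgrPdist_lt /(_ e e_gt0)[k _ kP]; exists k; have := kP k (leqnn k).
by rewrite sub0r normrN exprVn ger0_norm ?invr_ge0 ?exprn_ge0.
Qed.

(** * Left cuts of 0'-left-c.e. reals as limits of computable conditions *)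

Section Cut.
Variables (R : realType) (L : nat -> machine) (hL : effective_list L).

(* The inequality (v + 1) / 2^u + (a - a') / (b + 1) <= (-1)^f * g / (h + 1)
   with the denominators cleared. *)
Definition fraction_le (a a' b f g h u v : nat) : bool :=
  (v.+1 * b.+1 * h.+1 + a * 2 ^ u * h.+1 + odd f * (g * 2 ^ u * b.+1) <=
   a' * 2 ^ u * h.+1 + ~~ odd f * (g * 2 ^ u * b.+1))%N.

Lemma fraction_leE a a' b f g h u v : fraction_le a a' b f g h u v =
  (v.+1%:R / 2 ^+ u + (a%:R - a'%:R) / b.+1%:R <= (-1) ^+ f * g%:R / h.+1%:R :> R).
Proof.
have e0 : 0 < 2 ^+ u :> R by rewrite exprn_gt0.
have b0 : 0 < b.+1%:R :> R by rewrite ltr0n.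
have h0 : 0 < h.+1%:R :> R by rewrite ltr0n.
rewrite /fraction_le -(ler_nat R) !natrD !natrM !natrX -subr_ge0 -[RHS]subr_ge0.
set P := 2%:R ^+ u in e0 *; set B := b.+1%:R in b0 *; set H := h.+1%:R in h0 *.
rewrite -signr_odd -[RHS](pmulr_rge0 _ (mulr_gt0 (mulr_gt0 e0 b0) h0)).
congr (0 <= _); have [P0 B0 H0] : [/\ P != 0, B != 0 & H != 0].
  by split; apply: lt0r_neq0.
by case: (odd f) => /=; rewrite ?expr1 ?expr0; field; rewrite !nat1r P0 B0 H0.
Qed.

(** The comparison is made with the right end (v + 1) / 2^u of the dyadic interval around x; when it
    holds with the true values, x plus the shift is strictly below the approximation, as the strict
    cut demands. *)
Definition below_approx (ef eg eh a a' b n : nat) (y : seq bool) : bool :=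
  fraction_le a a' b (jump_approx L ef n (size y)) (jump_approx L eg n (size y))
    (jump_approx L eh n (size y)) (size y) (binary_value y).

Lemma comp_below_approx ef eg eh a a' b :
  computable (fun p : nat * seq bool => below_approx ef eg eh a a' b p.1 p.2).
Proof.
have := comp_jump_approx hL ef; have := comp_jump_approx hL eg.
have := comp_jump_approx hL eh; have := comp_binary_value.
by rewrite /below_approx /fraction_le => ? ? ? ?; comp.
Qed.

(** For fixed [n] the guesses settle, so that the condition eventually becomes the exact comparison
    with [q n]. Conversely, if the cut inequality holds, some [q n] is strictly above x plus the
    shift, and the gap has room for a dyadic interval of length 2^-u once [u] is large. *)
Lemma below_approx_cut (x alpha : R) (q : nat -> rat) f g h ef eg eh a a' b :
  0 <= x < 1 ->
  {homo q : m n / (m <= n)%N >-> m <= n} ->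
  (fun n => ratr (q n) : R) @ \oo --> alpha ->
  (forall n, q n = (-1) ^+ f n * (g n)%:R / (h n).+1%:R) ->
  (forall n, exists u0, forall u, (u0 <= u)%N -> jump_approx L ef n u = f n) ->
  (forall n, exists u0, forall u, (u0 <= u)%N -> jump_approx L eg n u = g n) ->
  (forall n, exists u0, forall u, (u0 <= u)%N -> jump_approx L eh n u = h n) ->
  (exists n N, forall v, (N <= v)%N ->
     below_approx ef eg eh a a' b n (mkseq (binary_digits x) v)) <->
  x + (a%:R - a'%:R) / b.+1%:R < alpha.
Proof.
move=> x01 q_mono q_cvg qE fL gL hhL; have x0 : 0 <= x by case/andP: x01.
set t := (a%:R - a'%:R) / b.+1%:R.
have e0 u : 0 < 2 ^+ u :> R by rewrite exprn_gt0.
have exact_at n : exists u0, forall u, (u0 <= u)%N ->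
    below_approx ef eg eh a a' b n (mkseq (binary_digits x) u) =
    ((Num.truncn (x * 2 ^+ u)).+1%:R / 2 ^+ u + t <= ratr (q n)).
  have [u1 u1E] := fL n; have [u2 u2E] := gL n; have [u3 u3E] := hhL n.
  exists (maxn u1 (maxn u2 u3)) => u; rewrite !geq_max => /and3P[le1 le2 le3].
  rewrite /below_approx size_mkseq u1E // u2E // u3E // fraction_leE.
  rewrite binary_value_digits //; congr (_ <= _); rewrite qE.
  by rewrite !rmorphM rmorphXn rmorphN1 fmorphV !rmorph_nat.
have q_le n : ratr (q n) <= alpha.
  rewrite -(cvg_lim _ q_cvg) //; apply: nondecreasing_cvgn_le.
    by move=> i j /q_mono; rewrite ler_rat.
  by apply/cvg_ex; exists alpha.
split=> [[n [N below]]|lt_alpha].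
  have [u0 u0E] := exact_at n.
  have := below (maxn N u0) (leq_maxl _ _); rewrite u0E ?leq_maxr // => le.
  apply: lt_le_trans (q_le n); apply: lt_le_trans le; rewrite ltrD2r.
  by rewrite ltr_pdivlMr // truncnS_gt.
have [n lt_q] : exists n, x + t < ratr (q n).
  apply: contrapT => /forallNP nlt; have : alpha <= x + t.
    rewrite -(cvg_lim _ q_cvg) //; apply: limr_le; first by apply/cvg_ex; exists alpha.
    by apply: nearW => n; have /negP := nlt n; rewrite -leNgt.
  by rewrite leNgt lt_alpha.
have [u0 u0E] := exact_at n; exists n.
have [k ltk] : exists k, (2 ^+ k)^-1 < ratr (q n) - (x + t).
  by apply: exists_inv_exp2_lt; rewrite subr_gt0.
exists (maxn u0 k) => u; rewrite geq_max => /andP[le0 lek]; rewrite u0E //.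
have le_inv : (2 ^+ u)^-1 <= (2 ^+ k)^-1 :> R.
  by rewrite lef_pV2 ?posrE // ler_eXn2l // ltr1n.
have le_x : (Num.truncn (x * 2 ^+ u)).+1%:R / 2 ^+ u <= x + (2 ^+ u)^-1.
  rewrite -natr1 mulrDl mul1r lerD2r ler_pdivrMr //.
  by rewrite truncn_le mulr_ge0 // ltW.
lra.
Qed.

Lemma rat_as_difference (q : rat) : exists a a' b : nat,
  ratr q = (a%:R - a'%:R) / b.+1%:R :> R.
Proof.
have d0 := denq_gt0 q; have [d dE] : exists d : nat, denq q = d.+1.
  by case: (denq q) d0 => [[|d]|] // _; exists d.
have [a [a' aE]] : exists a a' : nat, (numq q)%:~R = a%:R - a'%:R :> R.
  case: (numq q) => n; first by exists n, 0%N; rewrite subr0.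
  by exists 0%N, n.+1; rewrite NegzE sub0r mulrNz.
by exists a, a', d; rewrite -aE /ratr dE.
Qed.

End Cut.

(* [measureU] with [lebesgue_measure], not a coercion of it, on both sides. *)
Lemma lebesgue_measureU (R : realType) (A B : set R) :
  measurable A -> measurable B -> A `&` B = set0 ->
  lebesgue_measure (A `|` B) = (lebesgue_measure A + lebesgue_measure B)%E.
Proof. by move=> mA mB AB; rewrite measureU. Qed.

(** * The measure contributed by the three blocks *)

Section BlockMeasure.
Variables (R : realType) (L : nat -> machine).

(** Here [Z] is the oracle after the block marker. With [size] the event is that the simulated
    output is finite, with [ones] that it has finitely many ones. *)
Definition limited (f : seq bool -> nat) : set oracle :=
  [set Z | fin_support (fun j => f (fresh_bits L (mkseq Z j)))].

Lemma measurable_tail_limited m j f : (j < 2 ^ m)%N ->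
  measurable (tail_set R m j (limited f)).
Proof.
move=> ltj.
(* A condition on the last position only; the quantifier over all prefixes in [sigma2] supplies the
   others. *)
pose Q N y := ((m + N <= size y) ==> (f (fresh_bits L (drop m y)) == 0))%N.
have -> : tail_set R m j (limited f) = dyadic m j `&` reals_of R (sigma2 Q).
  have QE X : sigma2 Q X <-> limited f (tail_from m X).
    split=> [[N h]|[N h]]; exists N => i.
      move=> lei; have := h (m + i)%N.
      by rewrite /Q size_mkseq leq_add2l lei drop_mkseq => /eqP.
    rewrite /Q size_mkseq; apply/implyP => lei; have le : (m <= i)%N.
      by apply: leq_trans lei; apply: leq_addr.
    by rewrite -(subnKC le) drop_mkseq h // leq_subRL.
  apply/seteqP; split=> x [dx Px]; split=> //; last by case: Px => _ /QE.
  split; last exact/QE.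
  rewrite (dyadic_ge0 dx) /=; move: dx; rewrite /dyadic /= in_itv /= => /andP[_ lt].
  apply: lt_le_trans lt _; rewrite ler_pdivrMr ?exprn_gt0 // mul1r -natrX ler_nat.
  exact: ltj.
by apply: measurableI; [exact: measurable_dyadic|exact: measurable_sigma2].
Qed.

Lemma tail_setD m j P Q : tail_set R m j (P `\` Q) = tail_set R m j P `\` tail_set R m j Q.
Proof.
apply/seteqP; split=> x; first by move=> [dx [Px nQ]]; split=> // -[].
by move=> [[dx Px] nQ]; split=> //; split=> // Qx; apply: nQ.
Qed.

Lemma tail_setT m j : tail_set R m j setT = dyadic m j.
Proof. by apply/seteqP; split=> x //; case. Qed.

Lemma dyadic_disjoint m i j (A B : set R) : i != j ->
  A `<=` dyadic m i -> B `<=` dyadic m j -> A `&` B = set0.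
Proof.
move=> ij Ai Bj; rewrite -subset0 => x [/Ai xi /Bj xj]; have x0 := dyadic_ge0 xi.
by case/eqP: ij; rewrite -((dyadicP m i x0).1 xi) -((dyadicP m j x0).1 xj).
Qed.

Lemma tail_set_subset m j P : tail_set R m j P `<=` dyadic m j.
Proof. by move=> x []. Qed.

(* The three tail events partition the oracles, and blocks of equal length are
   translates of each other. *)
Lemma block_measure m j0 j1 j2 (S O : set oracle) : S `<=` O ->
  j0 != j1 -> j0 != j2 -> j1 != j2 ->
  (forall j, j \in [:: 0; j0; j1; j2]%N -> measurable (tail_set R m j S)) ->
  (forall j, j \in [:: 0; j0; j1; j2]%N -> measurable (tail_set R m j O)) ->
  measurable (tail_set R m j0 (O `\` S) `|`
    (tail_set R m j1 (setT `\` O) `|` tail_set R m j2 S)) /\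
  lebesgue_measure (tail_set R m j0 (O `\` S) `|`
    (tail_set R m j1 (setT `\` O) `|` tail_set R m j2 S)) = ((2 ^+ m)^-1)%:E.
Proof.
move=> SO j01 j02 j12 mS mO.
have mOS j : j \in [:: 0; j0; j1; j2]%N -> measurable (tail_set R m j (O `\` S)).
  by move=> jI; rewrite tail_setD; apply: measurableD; [exact: mO|exact: mS].
have mnO j : j \in [:: 0; j0; j1; j2]%N -> measurable (tail_set R m j (setT `\` O)).
  move=> jI; rewrite tail_setD tail_setT.
  by apply: measurableD; [exact: measurable_dyadic|exact: mO].
have [i0 i1 i2 iz] : [/\ j0 \in [:: 0; j0; j1; j2]%N, j1 \in [:: 0; j0; j1; j2]%N,
    j2 \in [:: 0; j0; j1; j2]%N & 0%N \in [:: 0; j0; j1; j2]%N].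
  by rewrite !inE !eqxx !orbT.
split.
  by apply: measurableU; [exact: mOS|apply: measurableU; [exact: mnO|exact: mS]].
rewrite lebesgue_measureU; [|exact: mOS|by apply: measurableU; [exact: mnO|exact: mS]|]; last first.
  rewrite setIUr (dyadic_disjoint j01 (@tail_set_subset m _ _) (@tail_set_subset m _ _)).
  by rewrite (dyadic_disjoint j02 (@tail_set_subset m _ _) (@tail_set_subset m _ _)) setU0.
rewrite lebesgue_measureU; [|exact: mnO|exact: mS|by apply: (dyadic_disjoint j12); apply: tail_set_subset].
rewrite (tail_set_measure _ (mOS _ iz)) (tail_set_measure _ (mnO _ iz)).
rewrite (tail_set_measure _ (mS _ iz)).
rewrite -(dyadic_measure R m 0) -tail_setT.
have -> : tail_set R m 0 setT = tail_set R m 0 (O `\` S) `|`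
    (tail_set R m 0 (setT `\` O) `|` tail_set R m 0 S).
  apply/seteqP; split=> x; last by move=> [[dx _]|[[dx _]|[dx _]]].
  move=> [dx _]; have [Ox|nO] := pselect (O (tail_from m (binary_digits x))).
    have [Sx|nS] := pselect (S (tail_from m (binary_digits x))); first by right; right.
    by left; split.
  by right; left; split.
rewrite lebesgue_measureU; [|exact: mOS|by apply: measurableU; [exact: mnO|exact: mS]|]; last first.
  rewrite -subset0 => x [[_ [Ox nS]]] [[_ [_ nO]]|[_ Sx]]; [exact: nO|exact: nS].
rewrite lebesgue_measureU; [|exact: mnO|exact: mS|] => //.
by rewrite -subset0 => x [[_ [_ nO]] [_ /SO]].
Qed.

End BlockMeasure.

Definition limit_cut (R : realType) (D : nat -> seq bool -> bool) (r : R) :=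
  forall x : R, 0 <= x < 1 ->
    (exists n N, forall v, (N <= v)%N -> D n (mkseq (binary_digits x) v)) <-> x < r.

Lemma left_ce_jump_cut (R : realType) (L : nat -> machine) (hL : effective_list L)
    (alpha : R) (t : rat) : left_ce_jump L alpha ->
  exists D : nat -> seq bool -> bool,
    computable (fun p : nat * seq bool => D p.1 p.2) /\ limit_cut D (alpha - ratr t).
Proof.
move=> [q [[f [g [h [cf cg ch qE]]]] q_mono q_cvg]].
have [ef fL] := jump_approx_limit hL cf.
have [eg gL] := jump_approx_limit hL cg.
have [eh hhL] := jump_approx_limit hL ch.
have [a [a' [b tE]]] := rat_as_difference R t.
exists (below_approx L ef eg eh a a' b); split; first exact: comp_below_approx.
by move=> x x01; rewrite ltrBrDr tE; apply: (below_approx_cut _ _ _ x01 q_mono q_cvg qE).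
Qed.

(** * The probability of the constructed machine and the choice of the constants *)

Section Conclusion.
Variables (R : realType) (L : nat -> machine) (hL : effective_list L).

(** The bound on [hi] keeps the interval clear of the oracles with prefix 1^c, which are the reals
    from 1 - 2^-c on. *)
Lemma reals_of_reaction_zero c (Da Db : nat -> seq bool -> bool) (lo hi : R) :
  0 <= lo -> hi <= 1 - (2 ^+ c)^-1 ->
  limit_cut Da hi ->
  limit_cut Db lo ->
  reals_of R (reaction_zero L c Da Db) = `[lo, hi[%classic `|`
    (tail_set R c.+2 (2 ^ c.+2 - 4 + 0) (limited L ones `\` limited L size) `|`
      (tail_set R c.+2 (2 ^ c.+2 - 4 + 1) (setT `\` limited L ones) `|`
       tail_set R c.+2 (2 ^ c.+2 - 4 + 2) (limited L size))).
Proof.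
move=> lo0 hi1 DaE DbE.
have inv_gt0 : 0 < (2 ^+ c)^-1 :> R by rewrite invr_gt0 exprn_gt0.
apply/seteqP; split=> x.
  move=> [x01 zx]; case: (boolP (all id (mkseq (binary_digits x) c))) => [ones_c|nones_c].
    move/(reaction_zero_block _ _ _ ones_c): zx; rewrite /block_support.
    have blockE b1 b2 : binary_digits x c = b1 -> binary_digits x c.+1 = b2 ->
        dyadic c.+2 (2 ^ c.+2 - 4 + (2 * b1 + b2)) x.
      by move=> b1E b2E; apply/dyadic_block.
    case c1E: (binary_digits x c); case c2E: (binary_digits x c.+1) => // zx; right.
    - by right; right; split=> //; apply: blockE c1E c2E.
    - by right; left; split; [exact: blockE c1E c2E|split].
    - by left; split; [exact: blockE c1E c2E|case: zx].
  left; move/(reaction_zero_other _ _ _ nones_c): zx => -[/(DaE _ x01) lt_hi nlo].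
  rewrite /= in_itv /= lt_hi andbT leNgt; apply/negP => lt_lo; apply: nlo.
  exact/DbE.
have block d b1 b2 P : d = (2 * nat_of_bool b1 + nat_of_bool b2)%N ->
    tail_set R c.+2 (2 ^ c.+2 - 4 + d) P x ->
    [/\ 0 <= x < 1, all id (mkseq (binary_digits x) c), binary_digits x c = b1,
        binary_digits x c.+1 = b2 & P (tail_from c.+2 (binary_digits x))].
  move=> dE [dx Px]; have x01 : 0 <= x < 1.
    by apply: dyadic_block_lt1 dx; rewrite dE; case: b1 b2 {dE} => -[].
  by move: dx; rewrite dE => /(dyadic_block _ _ _ x01)[].
move=> [|[|[|]]].
- rewrite /= in_itv /= => /andP[lex ltx]; have x01 : 0 <= x < 1.
    by rewrite (le_trans lo0 lex) /= (lt_le_trans ltx) // (le_trans hi1) // gerBl ltW.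
  split=> //; apply/reaction_zero_other; first by rewrite all_ones_digits // -ltNge (lt_le_trans ltx).
  by split; [exact/DaE|rewrite (DbE x x01); apply/negP; rewrite -leNgt].
- move/(block 0%N false false _ erefl) => [x01 ones_c c1E c2E [Ox nSx]].
  by split=> //; apply/reaction_zero_block => //; rewrite c1E c2E.
- move/(block 1%N false true _ erefl) => [x01 ones_c c1E c2E [_ nOx]].
  by split=> //; apply/reaction_zero_block => //; rewrite c1E c2E.
- move/(block 2%N true false _ erefl) => [x01 ones_c c1E c2E Sx].
  by split=> //; apply/reaction_zero_block => //; rewrite c1E c2E.
Qed.

Lemma limited_ones : limited L size `<=` limited L ones.
Proof.
move=> Z [N h]; exists N => j lej; apply/eqP; rewrite -leqn0 -(h j lej).
exact: count_size.
Qed.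

Lemma reaction_zero_measure c (Da Db : nat -> seq bool -> bool) (lo hi : R) :
  0 <= lo <= hi -> hi <= 1 - (2 ^+ c)^-1 ->
  limit_cut Da hi ->
  limit_cut Db lo ->
  lebesgue_measure (reals_of R (reaction_zero L c Da Db)) =
    (hi - lo + (2 ^+ c.+2)^-1)%:E.
Proof.
move=> /andP[lo0 lo_hi] hi1 DaE DbE; rewrite (reals_of_reaction_zero lo0 hi1 DaE DbE).
have ge4 : (4 <= 2 ^ c.+2)%N by rewrite (@leq_exp2l 2 2).
have small f j : j \in [:: 0; 2 ^ c.+2 - 4 + 0; 2 ^ c.+2 - 4 + 1; 2 ^ c.+2 - 4 + 2]%N ->
    measurable (tail_set R c.+2 j (limited L f)).
  move=> jI; apply: measurable_tail_limited.
  by move: jI; rewrite !inE => /or4P[] /eqP ->; lia.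
have [mB Bm] := @block_measure R c.+2 (2 ^ c.+2 - 4 + 0)%N (2 ^ c.+2 - 4 + 1)%N
  (2 ^ c.+2 - 4 + 2)%N _ _ limited_ones ltac:(lia) ltac:(lia) ltac:(lia)
  (small size) (small ones).
rewrite lebesgue_measureU; [|exact: measurable_itv|exact: mB|]; last first.
  rewrite -subset0 => x [/=]; rewrite in_itv /= => /andP[_ ltx] Bx.
  have block d b1 b2 P : d = (2 * nat_of_bool b1 + nat_of_bool b2)%N ->
      tail_set R c.+2 (2 ^ c.+2 - 4 + d) P x -> False.
    move=> dE [dx Px]; have x01 : 0 <= x < 1.
      by apply: dyadic_block_lt1 dx; rewrite dE; case: b1 b2 {dE} => -[].
    move: dx; rewrite dE => /(dyadic_block _ _ _ x01)[].
    by rewrite all_ones_digits // leNgt (lt_le_trans ltx).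
  case: Bx => [|[]]; [exact: (block 0%N false false)|exact: (block 1%N false true)|
    exact: (block 2%N true false)].
rewrite Bm lebesgue_measure_itv /= lte_fin EFinD; congr (_ + _)%E.
(* The interval may be empty, in which case its ends coincide. *)
rewrite EFinB; case: ltP => // hi_lo; have -> : hi = lo by apply/le_anti/andP.
by rewrite -EFinB subrr.
Qed.

Lemma exists_universal_machine (alpha beta : R) :
  left_ce_jump L alpha -> left_ce_jump L beta -> 0 < alpha - beta < 1 ->
  exists V, universal L V /\
    oracle_prob R [set X | writes_eventually_zero V X] = (alpha - beta)%:E.
Proof.
move=> ce_a ce_b /andP[d0 d1].
(* The first bound leaves the interval a positive length after 2^-(c+2) is taken off; the second
   makes an interval of length alpha - beta fit below 1 - 2^-c. *)
have [c ltc] : exists c, (2 ^+ c)^-1 < Num.min (alpha - beta) (1 - (alpha - beta)).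
  by apply: exists_inv_exp2_lt; rewrite lt_min d0 subr_gt0.
move: ltc; rewrite lt_min => /andP[ltc1 ltc2].
pose w : R := (2 ^+ c.+2)^-1.
have [w0 w1] : 0 < w /\ w <= (2 ^+ c)^-1.
  split; first by rewrite invr_gt0 exprn_gt0.
  by rewrite lef_pV2 ?posrE ?exprn_gt0 // ler_eXn2l // ?ltr1n // leqW.
(* The lower end [beta - ratr t'] is positive because t' is below beta; by the other bound it is
   less than 1 - 2^-c - (alpha - beta), so the upper end stays below 1 - 2^-c. *)
have [t' /itvP t'I] : exists t' : rat,
    ratr t' \in `](beta - (1 - (2 ^+ c)^-1 - (alpha - beta))), beta[.
  by apply: rat_in_itvoo; lra.
have lt_t' : beta - (1 - (2 ^+ c)^-1 - (alpha - beta)) < ratr t' by rewrite t'I.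
have gt_t' : ratr t' < beta by rewrite t'I.
(* The additional 2^-(c+2) shortens the interval by exactly what the blocks contribute. *)
pose t : rat := t' + (2 ^+ c.+2)^-1.
have tE : ratr t = ratr t' + w :> R.
  by rewrite rmorphD fmorphV rmorphXn /= rmorph_nat.
have [Da [cDa DaE]] := left_ce_jump_cut hL t ce_a.
have [Db [cDb DbE]] := left_ce_jump_cut hL t' ce_b.
have [V VE] := reactor (comp_reaction hL c cDa cDb).
have {}VE X : exists u : nat -> nat, (forall s, (u s < u s.+1)%N) /\
    forall s, output_at V X (u s) = written_upto (reaction L c Da Db) X s.
  have [never _] := VE X; have [|u [u_inc uE]] := never.
    by move=> s; apply/hasPn.
  by exists u; split=> // s; case: (uE s).
exists V; split; first exact: sigma_universal VE.
have -> : oracle_prob R [set X | writes_eventually_zero V X] =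
    lebesgue_measure (reals_of R (reaction_zero L c Da Db)).
  congr (lebesgue_measure _); apply/seteqP; split=> x [x01 zx]; split=> //;
    have [u [u_inc uE]] := VE (binary_digits x);
    exact/(reaction_eventually_zero u_inc uE).
rewrite (@reaction_zero_measure c Da Db (beta - ratr t') (alpha - ratr t)).
- by rewrite -/w tE; congr (_%:E); ring.
- by rewrite tE; lra.
- by rewrite tE; lra.
- exact: DaE.
- exact: DbE.
Qed.

End Conclusion.

Theorem theorem4p1 (R : realType) (L : nat -> machine)
    (hL : effective_list L) :
  (forall V : machine,
     exists alpha beta : R,
       [/\ left_ce_jump L alpha, left_ce_jump L beta &
           oracle_prob R [set X | writes_eventually_zero V X] =
             (alpha - beta)%:E]) /\
  (forall alpha beta : R,
     left_ce_jump L alpha -> left_ce_jump L beta ->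
     0 < alpha - beta < 1 ->
     exists V : machine,
       universal L V /\
       oracle_prob R [set X | writes_eventually_zero V X] =
         (alpha - beta)%:E).
Proof.
split; first exact: prob_writes_eventually_zero.
exact: exists_universal_machine.
Qed.
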